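(* Let $\Phi$ be any fixed sentence of the two-variable fragment of first-order logic with counting quantifiers, i.e. a function-free first-order sentence using only the variables $x,y$ (possibly reused), built from atoms, Boolean connectives, the quantifiers $\forall,\exists$ and the counting quantifiers $\exists_{=k},\exists_{\le k},\exists_{\ge k}$ (for finitely many fixed natural numbers $k$). Then computing the weighted first-order model count of $\Phi$ is domain-liftable: there is an algorithm which, given a finite domain $\Delta$ and weight functions $w,\overline{w}$ assigning rational numbers to the predicates of the language, computes $\mathrm{WFOMC}(\Phi,w,\overline{w},\Delta)$ in time polynomial in $|\Delta|$ and in the number of bits needed to encode the weights.
   Context: Fix a function-free first-order language with a finite set $\mathcal{R}$ of predicates. A domain $\Delta$ is a finite set of constants. A possible world $\omega$ on $\Delta$ is a set of ground atoms $R(t_1,\dots,t_{\mathrm{arity}(R)})$ with $R\in\mathcal{R}$, $t_i\in\Delta$ (namely those atoms true in $\omega$); $\Omega_\Delta$ denotes the set of all possible worlds on $\Delta$. For a predicate $R$, $N(R,\omega)$ is the number of ground atoms of $R$ in $\omega$. Given weight functions $w,\overline{w}:\mathcal{R}\to\mathbb{Q}$, a sentence $\Gamma$ and a set $\Omega$ of possible worlds on $\Delta$, $$\mathrm{WFOMC}(\Gamma,w,\overline{w},\Omega)=\sum_{\omega\in\Omega,\ \omega\models\Gamma}\ \prod_{R\in\mathcal{R}} w(R)^{N(R,\omega)}\,\overline{w}(R)^{|\Delta|^{\mathrm{arity}(R)}-N(R,\omega)},$$ and $\mathrm{WFOMC}(\Gamma,w,\overline{w},\Delta):=\mathrm{WFOMC}(\Gamma,w,\overline{w},\Omega_\Delta)$.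 Counting quantifiers: $\omega\models\exists_{\ge k}x\,\psi(x)$ iff there are at least $k$ distinct $t\in\Delta$ with $\omega\models\psi(t)$; $\exists_{\le k}x\,\psi(x)$ means $\neg\exists_{\ge k+1}x\,\psi(x)$; $\exists_{=k}x\,\psi(x)$ means $\exists_{\le k}x\,\psi(x)\wedge\exists_{\ge k}x\,\psi(x)$. *)

(* Defs.v *)
From HB Require Import structures.
From mathcomp Require Import all_boot all_order all_algebra.
Set Implicit Arguments. Unset Strict Implicit. Unset Printing Implicit Defensive.
Import Order.TTheory GRing.Theory Num.Theory.

(* Only the two variables x, y exist, so every formula is two-variable.     *)

Inductive var := Vx | Vy.

Definition var_eqb (u v : var) : bool :=
  match u, v with Vx, Vx | Vy, Vy => true | _, _ => false end.

Section Syntax.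
Variables (m : nat) (ar : 'I_m -> nat).

Inductive c2form :=
  | FAtom (r : 'I_m) of (ar r).-tuple var
  | FNot of c2form
  | FAnd of c2form & c2form
  | FOr of c2form & c2form
  | FImp of c2form & c2form
  | FIff of c2form & c2form
  | FAll of var & c2form
  | FEx of var & c2form
  | FCntGe of nat & var & c2form
  | FCntLe of nat & var & c2form
  | FCntEq of nat & var & c2form.

Fixpoint free (f : c2form) (v : var) : bool :=
  match f with
  | FAtom _ t => has (var_eqb v) (val t)
  | FNot g => free g v
  | FAnd g h | FOr g h | FImp g h | FIff g h => free g v || free h v
  | FAll u g | FEx u g | FCntGe _ u g | FCntLe _ u g | FCntEq _ u g =>
      ~~ var_eqb u v && free g v
  end.

Definition sentence (f : c2form) : bool := ~~ free f Vx && ~~ free f Vy.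

Variable n : nat.

Definition gatom := {r : 'I_m & (ar r).-tuple 'I_n}.
Definition world := {set gatom}.

Definition upd (a : var -> option 'I_n) (v : var) (d : 'I_n) : var -> option 'I_n :=
  fun u => if var_eqb u v then Some d else a u.

Fixpoint holds (om : world) (a : var -> option 'I_n) (f : c2form) : bool :=
  match f with
  | FAtom r t =>
      [exists tt : (ar r).-tuple 'I_n,
         (Tagged (fun r => (ar r).-tuple 'I_n) tt \in om)
         && [forall i, a (tnth t i) == Some (tnth tt i)]]
  | FNot g => ~~ holds om a g
  | FAnd g h => holds om a g && holds om a h
  | FOr g h => holds om a g || holds om a h
  | FImp g h => holds om a g ==> holds om a h
  | FIff g h => holds om a g == holds om a h
  | FAll v g => [forall d : 'I_n, holds om (upd a v d) g]
  | FEx v g => [exists d : 'I_n, holds om (upd a v d) g]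
  | FCntGe k v g => k <= #|[pred d : 'I_n | holds om (upd a v d) g]|
  | FCntLe k v g => #|[pred d : 'I_n | holds om (upd a v d) g]| <= k
  | FCntEq k v g => #|[pred d : 'I_n | holds om (upd a v d) g]| == k
  end.

Definition models (om : world) (f : c2form) : bool := holds om (fun _ => None) f.

Definition Ncount (r : 'I_m) (om : world) : nat :=
  #|[set g in om | tag g == r]|.

Definition weight (w wbar : 'I_m -> rat) (om : world) : rat :=
  \prod_(r : 'I_m) (w r ^+ Ncount r om * wbar r ^+ (n ^ ar r - Ncount r om))%R.

Definition WFOMC (f : c2form) (w wbar : 'I_m -> rat) : rat :=
  (\sum_(om : world | models om f) weight w wbar om)%R.

End Syntax.

Inductive sym := SBlank | S0 | S1 | SSep | SPlus | SMinus | SSlash.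

Definition sym_eqb (a b : sym) : bool :=
  match a, b with
  | SBlank, SBlank | S0, S0 | S1, S1 | SSep, SSep
  | SPlus, SPlus | SMinus, SMinus | SSlash, SSlash => true
  | _, _ => false
  end.

Inductive move := MLeft | MRight | MStay.

Record TM := {
  tm_nstates : nat;
  (* None = halt; start state is ord0 *)
  tm_delta : 'I_tm_nstates.+1 -> sym -> option ('I_tm_nstates.+1 * sym * move)
}.

Record config (M : TM) := Config {
  cstate : 'I_(tm_nstates M).+1;
  cleft : seq sym;   (* cells left of the head, nearest first *)
  chead : sym;
  cright : seq sym   (* cells right of the head, nearest first *)
}.

Definition init (M : TM) (inp : seq sym) : config M :=
  match inp with
  | [::] => Config ord0 [::] SBlank [::]
  | s :: r => Config ord0 [::] s r
  end.

Definition do_move (M : TM) (q : 'I_(tm_nstates M).+1) (l : seq sym) (s : sym)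
    (r : seq sym) (mv : move) : config M :=
  match mv with
  | MStay => Config q l s r
  | MLeft => match l with
             | [::] => Config q [::] SBlank (s :: r)
             | a :: l' => Config q l' a (s :: r)
             end
  | MRight => match r with
              | [::] => Config q (s :: l) SBlank [::]
              | a :: r' => Config q (s :: l) a r'
              end
  end.

Fixpoint exec (M : TM) (t : nat) (c : config M) : option (config M) :=
  match tm_delta (cstate c) (chead c) with
  | None => Some c
  | Some (q, s, mv) =>
      match t with
      | 0 => None
      | t'.+1 => exec t' (do_move q (cleft c) s (cright c) mv)
      end
  end.

Definition tape_contents (M : TM) (c : config M) : seq sym :=
  rev (cleft c) ++ chead c :: cright c.

(* little-endian binary digits of k (empty for 0) *)
Fixpoint bin_fuel (fuel k : nat) : seq sym :=
  match fuel with
  | 0 => [::]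
  | f.+1 => if k == 0 then [::] else (if odd k then S1 else S0) :: bin_fuel f k./2
  end.
Definition bin (k : nat) : seq sym := bin_fuel k k.

Definition enc_int (z : int) : seq sym :=
  (if (z < 0)%R then SMinus else SPlus) :: bin `|z|%N.

Definition enc_rat (q : rat) : seq sym :=
  enc_int (numq q) ++ SSlash :: bin `|denq q|%N.

Definition enc_input (m n : nat) (w wbar : 'I_m -> rat) : seq sym :=
  nseq n S1 ++ SSep ::
  flatten [seq enc_rat (w r) ++ [:: SSep] | r <- enum 'I_m] ++
  flatten [seq enc_rat (wbar r) ++ [:: SSep] | r <- enum 'I_m].

Definition outputs (M : TM) (c : config M) (q : rat) : Prop :=
  exists a b : nat, tape_contents c = nseq a SBlank ++ enc_rat q ++ nseq b SBlank.

(* Main.v *)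
(* Every quantified subformula of [Phi] has at most one free variable and can be
   written with [exists_(>= k)].  Name each one by a fresh unary predicate, a
   "bit": then a world models [Phi] iff the bits, which are uniquely determined,
   satisfy their defining equations "bit j of e iff at least k_j elements d
   satisfy a quantifier-free q_j(e, d)" and a quantifier-free matrix.  So the
   count is a sum over the nullary atoms, over a unary label (atoms on one
   element, bits) per element and over a binary label (atoms on two elements) per
   pair.  Each element only has to remember its unary label and, per definition,
   the number of witnesses met so far, capped at the largest threshold: finitely
   many classes.  Let the pairs interact one element at a time.  The partial sums
   depend only on how many elements are in each class, so a dynamic program over
   polynomially many such histograms computes the count.  Atoms on at least three
   elements are invisible to [Phi] and factor out.

   Rational weights are cleared to integers; multiplying both weights of R by D_R
   multiplies the count by D_R ^ (n ^ arity R).  Polynomial time is obtained by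
   closure: the class [FP] of functions on tree-encoded data computed by stack
   programs in polynomial time contains folds with polynomially bounded
   accumulators, and a three-stack program is simulated on a single tape with
   polynomial overhead. *)

From HB Require Import structures.
From mathcomp Require Import all_boot all_order all_algebra.
From mathcomp Require Import zify ring.
Require Import Defs.
Set Implicit Arguments. Unset Strict Implicit. Unset Printing Implicit Defensive.

(** * Single-tape machines from structured programs *)

(** A histogram can replace the labelled elements only because meetings commute: the counters of one
    element never influence what another one counts, which depends on unary labels and the label of
    the pair alone. So pairs may be visited in any order and orientation, and the automaton may take
    whichever element lies in the first occupied class. Bits weigh one on both sides; their
    equations have exactly one solution per world, so adding them leaves the count unchanged. The
    matrix is tested at each element and hence says nothing over the empty domain, which is computed
    separately. Classes, labels and moves depend on [Phi] alone, so only class sizes and weights are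
    data; the domain size is unary on the tape, which makes tables of size polynomial in it
    affordable. Closure under folds fails without a bound on the accumulator (iterated squaring), so
    arithmetic comes with bounds on the length of its results. Products are arranged with the
    growing factor on the right, where its length counts only once. *)

Definition syms := [:: SBlank; S0; S1; SSep; SPlus; SMinus; SSlash].
Definition sym_code (s : sym) : nat :=
  match s with SBlank => 0 | S0 => 1 | S1 => 2 | SSep => 3
         | SPlus => 4 | SMinus => 5 | SSlash => 6 end.
Lemma sym_codeK : cancel sym_code (nth SBlank syms).
Proof. by case. Qed.
HB.instance Definition _ := Countable.copy sym (can_type sym_codeK).
Lemma syms_enumP : Finite.axiom syms.
Proof. by case. Qed.
HB.instance Definition _ := isFinite.Build sym syms_enumP.

(* A register, the cells left of the head (nearest first), and the cells from
   the head rightwards; a missing cell is blank. *)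
Definition mem := (sym * seq sym * seq sym)%type.
Definition rg (m : mem) := m.1.1.
Definition hd (m : mem) := head SBlank m.2.

Definition mv (d : move) (l : seq sym) (s : sym) (r : seq sym) :=
  match d with
  | MStay => (l, s :: r)
  | MRight => (s :: l, r)
  | MLeft => (behead l, head SBlank l :: s :: r)
  end.

Definition conf (M : TM) q (l r : seq sym) : config M :=
  Config q l (head SBlank r) (behead r).

Lemma do_moveE (M : TM) q l s r d :
  @do_move M q l s r d = conf q (mv d l s r).1 (mv d l s r).2.
Proof. by case: d l r => [] [|a l] [|b r]. Qed.

(** A machine with one exit: the next state [None] leaves the fragment, so composition only decides
    where exits lead. The register is read and written by the transition function and is merged into
    the finite control at the end. *)
Record frag := Frag {
  fQ : finType;
  fstart : fQ;
  fdl : fQ -> sym -> sym -> option fQ * sym * sym * move }.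

Definition act (a : sym * sym * move) (m : mem) : mem :=
  let: (x, s, d) := a in
  (x, (mv d m.1.2 s (behead m.2)).1, (mv d m.1.2 s (behead m.2)).2).

(** Not the identity: past the end of the tape it materialises the blank under the head. Control
    steps have this effect. *)
Definition stay (m : mem) := act (rg m, hd m, MStay) m.

Inductive frun (F : frag) : fQ F -> mem -> nat -> mem -> Prop :=
  | frun_exit q m x s d : fdl q (rg m) (hd m) = (None, x, s, d) ->
      frun q m 1 (act (x, s, d) m)
  | frun_step q q' m x s d n m' : fdl q (rg m) (hd m) = (Some q', x, s, d) ->
      frun q' (act (x, s, d) m) n m' -> frun q m n.+1 m'.

Inductive tp :=
  | TAct of (sym -> sym -> sym * sym * move)
  | TSeq of tp & tp
  | TIf of (sym -> sym -> bool) & tp & tp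
  | TWhile of (sym -> sym -> bool) & tp.

(** The number is only an upper bound on the steps, so bounds of composites may be rounded up at
    once. A test costs a step of its own. *)
Inductive trun : tp -> mem -> nat -> mem -> Prop :=
  | tr_act f m n : 0 < n -> trun (TAct f) m n (act (f (rg m) (hd m)) m)
  | tr_seq p q m1 n1 m2 n2 m3 n : trun p m1 n1 m2 -> trun q m2 n2 m3 ->
      n1 + n2 <= n -> trun (TSeq p q) m1 n m3
  | tr_if (c : sym -> sym -> bool) p q m n m' N :
      trun (if c (rg m) (hd m) then p else q) m n m' -> n < N ->
      trun (TIf c p q) m N m'
  | tr_stop (c : sym -> sym -> bool) p m N : ~~ c (rg m) (hd m) -> 0 < N ->
      trun (TWhile c p) m N (stay m)
  | tr_go (c : sym -> sym -> bool) p m1 n1 m2 n2 m3 N : c (rg m1) (hd m1) ->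
      trun p m1 n1 m2 -> trun (TWhile c p) m2 n2 m3 -> n1 + n2 < N ->
      trun (TWhile c p) m1 N m3.

(** [e] is where an exit of the embedded fragment leads; [None] makes it an exit of the whole. *)
Definition redir (Q Q' : Type) (f : Q -> Q') (e : option Q')
    (a : option Q * sym * sym * move) : option Q' * sym * sym * move :=
  let: (o, x, s, d) := a in (if o is Some q then Some (f q) else e, x, s, d).

Definition frag_seq F G := @Frag (fQ F + fQ G)%type (inl (fstart F)) (fun q x h =>
  match q with
  | inl q => redir inl (Some (inr (fstart G))) (fdl q x h)
  | inr q => redir inr None (fdl q x h)
  end).
Definition frag_if (c : sym -> sym -> bool) F G :=
  @Frag (option (fQ F + fQ G)%type) None (fun q x h =>
  match q with
  | None => (Some (Some (if c x h then inl (fstart F) else inr (fstart G))), x, h, MStay)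
  | Some (inl q) => redir (fun q => Some (inl q)) None (fdl q x h)
  | Some (inr q) => redir (fun q => Some (inr q)) None (fdl q x h)
  end).
Definition frag_while (c : sym -> sym -> bool) F :=
  @Frag (option (fQ F)) None (fun q x h =>
  match q with
  | None => (if c x h then Some (Some (fstart F)) else None, x, h, MStay)
  | Some q => redir Some (Some None) (fdl q x h)
  end).

Fixpoint comp (p : tp) : frag :=
  match p with
  | TAct f => @Frag unit tt (fun _ x h => let: (x', s, d) := f x h in (None, x', s, d))
  | TSeq p q => frag_seq (comp p) (comp q)
  | TIf c p q => frag_if c (comp p) (comp q)
  | TWhile c p => frag_while c (comp p)
  end.

Lemma frun_redir_exit (F G : frag) (f : fQ F -> fQ G) :
  (forall q x h, fdl (f q) x h = redir f None (fdl q x h)) ->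
  forall q m n m', frun q m n m' -> frun (f q) m n m'.
Proof.
move=> Hf q m n m'; elim=> {q m n m'} [q m x s d E|q q' m x s d n m' E _ IH].
  by apply: frun_exit; rewrite Hf E.
by apply: frun_step IH; rewrite Hf E.
Qed.

Lemma frun_redir_cont (F G : frag) (f : fQ F -> fQ G) (e : fQ G) :
  (forall q x h, fdl (f q) x h = redir f (Some e) (fdl q x h)) ->
  forall q m n m', frun q m n m' ->
  forall n' m'', frun e m' n' m'' -> frun (f q) m (n + n') m''.
Proof.
move=> Hf q m n m'; elim=> {q m n m'} [q m x s d E|q q' m x s d n m' E _ IH] n' m'' H.
  by apply: frun_step H; rewrite Hf E.
by rewrite addSn; apply: frun_step (IH _ _ H); rewrite Hf E.
Qed.

Lemma act_stay a m : act a (stay m) = act a m.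
Proof. by case: a => [[x s] d]. Qed.

(** The test of a conditional or a loop takes one control step before its body, which therefore
    starts from [stay m]. *)
Lemma frun_stay (F : frag) (q : fQ F) m n m' : frun q m n m' -> frun q (stay m) n m'.
Proof.
case=> {q m n m'} [q m x s d E|q q' m x s d n m' E H].
  by rewrite -act_stay; apply: frun_exit.
by apply: (@frun_step _ _ q' _ x s d) => //; rewrite act_stay.
Qed.

Lemma trun_frun p m n m' : trun p m n m' ->
  exists2 k, k <= n & frun (fstart (comp p)) m k m'.
Proof.
elim=> {p m n m'} /=.
- move=> f m n n0; exists 1 => //.
  case E: (f _ _) => [[x s] d]; apply: (@frun_exit (comp (TAct f))).
  by rewrite /= E.
- move=> p q m1 n1 m2 n2 m3 n _ [k1 l1 H1] _ [k2 l2 H2] len.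
  exists (k1 + k2); first lia.
  apply: (@frun_redir_cont _ (frag_seq _ _) inl (inr (fstart (comp q)))) H1 _ _ _ => //.
  exact: (@frun_redir_exit _ (frag_seq _ _) inr) H2.
- move=> c p q m n m' N _ [k l H] lN; exists k.+1; first lia.
  move/frun_stay: H => H; apply: (@frun_step (frag_if c (comp p) (comp q)) None _ m (rg m) (hd m) MStay) => //=.
  rewrite -/(stay m); case: (c _ _) H => H.
    exact: (@frun_redir_exit _ (frag_if _ _ _) (fun q => Some (inl q))) H.
  exact: (@frun_redir_exit _ (frag_if _ _ _) (fun q => Some (inr q))) H.
- move=> c p m N nc N0; exists 1 => //; apply: (@frun_exit (frag_while c _)).
  by rewrite /= (negbTE nc).
- move=> c p m1 n1 m2 n2 m3 N cm _ [k1 l1 H1] _ [k2 l2 H2] len.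
  exists (k1 + k2).+1; first lia.
  apply: (@frun_step (frag_while c (comp p)) None (Some (fstart (comp p))) m1 (rg m1) (hd m1) MStay).
    by rewrite /= cm.
  rewrite -/(stay m1); move/frun_stay: H1 => H1.
  exact: (@frun_redir_cont _ (frag_while _ _) Some None) H1 _ _ H2.
Qed.

Section ToTM.
Variable F : frag.
Let Q : finType := (fQ F * sym)%type.

(** A machine starts in state 0, so this number is reserved for the start in addition to its regular
    number. Regular states are shifted by one, and the last number, which decodes to nothing,
    halts. *)
Definition dec (k : 'I_(#|Q|.+2)) : option Q :=
  if k == ord0 then Some (fstart F, SBlank)
  else omap (fun j : 'I_#|Q| => enum_val j) (insub k.-1).
Definition encst (o : option Q) : 'I_(#|Q|.+2) :=
  if o is Some q then lift ord0 (widen_ord (leqnSn _) (enum_rank q)) else ord_max.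

Lemma encstK o : dec (encst o) = o.
Proof.
case: o => [q|]; rewrite /dec /=.
  rewrite (_ : insub _ = Some (enum_rank q)) /= ?enum_rankK //.
  exact: valK.
by rewrite insubF //= ltnn.
Qed.

Definition toTM : TM := @Build_TM #|Q|.+1 (fun k h =>
  if dec k is Some (q, x) then
    let: (o, x', s, d) := fdl q x h in
    Some (encst (omap (fun q => (q, x')) o), s, d)
  else None).

Definition mconf (k : 'I_(#|Q|.+2)) (m : mem) : config toTM :=
  @conf toTM k m.1.2 m.2.

Lemma frun_exec q m n m' : frun q m n m' -> forall k, dec k = Some (q, rg m) ->
  exec n (mconf k m) = Some (mconf ord_max m').
Proof.
have exec_max t m0 : exec t (mconf ord_max m0) = Some (mconf ord_max m0).
  by case: t => [|t]; rewrite /= -[ord_max]/(encst None) encstK.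
elim=> {q m n m'} [q [[x0 l] r] x s d E|q q' [[x0 l] r] x s d n m' E _ IH] k Hk.
  rewrite /= Hk E do_moveE; exact: (exec_max 0 (act (x, s, d) (x0, l, r))).
rewrite /= Hk E /= do_moveE; apply: IH; exact: (encstK (Some (q', x))).
Qed.

End ToTM.

Lemma trun_exec p inp n m' : trun p (SBlank, [::], inp) n m' ->
  exists2 k, k <= n & exists q, exec k (init (toTM (comp p)) inp) =
    Some (@conf (toTM (comp p)) q m'.1.2 m'.2).
Proof.
case/trun_frun=> k lk /frun_exec /(_ ord0) H; exists k => //.
exists ord_max; rewrite -[RHS]H //; congr exec.
by case: inp {H}.
Qed.

(** * Stack programs on one tape *)

Notation B := SBlank.

Lemma trun_weak p m n m' N : trun p m n m' -> n <= N -> trun p m N m'.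
Proof.
case=> {p m n m'}.
- by move=> f m n n0 nN; apply: tr_act; lia.
- by move=> p q m1 n1 m2 n2 m3 n H1 H2 le1 le2; apply: (tr_seq H1 H2); lia.
- by move=> c p q m n m' N' H l1 l2; apply: (tr_if H); lia.
- by move=> c p m N' h l1 l2; apply: tr_stop => //; lia.
- by move=> c p m1 n1 m2 n2 m3 N' h H1 H2 l1 l2; apply: (tr_go h H1 H2); lia.
Qed.

Lemma tr_seq' p q m1 n1 m2 m2' n2 m3 m3' n : trun p m1 n1 m2 -> trun q m2' n2 m3 ->
  m2 = m2' -> m3 = m3' -> n1 + n2 <= n -> trun (TSeq p q) m1 n m3'.
Proof. by move=> H1 H2 e <-; rewrite -{}e in H2; exact: tr_seq H1 H2. Qed.

(* A list of stacks is laid out on the tape as its members, tops to the left,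
   each followed by a blank. *)
Definition flat (st : seq (seq sym)) := flatten [seq rcons s B | s <- st].
Definition filled (s : seq sym) := all (fun c => c != B) s.

Definition tR := TAct (fun x h => (x, h, MRight)).
Definition tL := TAct (fun x h => (x, h, MLeft)).
Definition swR := TAct (fun x h => (h, x, MRight)).
Definition swL := TAct (fun x h => (h, x, MLeft)).
Definition setreg s := TAct (fun _ h => (s, h, MStay)).
Definition nb (_ h : sym) := h != B.

Fixpoint trep i p := if i is i'.+1 then TSeq p (trep i' p) else TAct (fun x h => (x, h, MStay)).

Lemma trun_R x l h r n : 0 < n -> trun tR (x, l, h :: r) n (x, h :: l, r).
Proof. exact: (@tr_act _ (x, l, h :: r)). Qed.
Lemma trun_L x l h r n : 0 < n ->
  trun tL (x, l, h :: r) n (x, behead l, head B l :: h :: r).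
Proof. exact: (@tr_act _ (x, l, h :: r)). Qed.
Lemma trun_swR x l h r n : 0 < n -> trun swR (x, l, h :: r) n (h, x :: l, r).
Proof. exact: (@tr_act _ (x, l, h :: r)). Qed.
Lemma trun_swL x l h r n : 0 < n ->
  trun swL (x, l, h :: r) n (h, behead l, head B l :: x :: r).
Proof. exact: (@tr_act _ (x, l, h :: r)). Qed.

Definition goto1 := TSeq (TWhile nb tR) tR.

Lemma goto1P s x l r : filled s ->
  trun goto1 (x, l, s ++ B :: r) (4 * size s + 4) (x, rev (rcons s B) ++ l, r).
Proof.
move=> fs; rewrite rev_rcons /=.
apply: (@tr_seq _ _ _ (4 * size s + 2) (x, rev s ++ l, B :: r) 1); last lia; last exact: trun_R.
elim: s fs l => [|c s IH] fs l.
  exact: (@tr_stop nb tR (x, l, B :: r)).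
case/andP: fs => cB fs; rewrite cat_cons rev_cons cat_rcons.
apply: (@tr_go _ _ (x, l, c :: s ++ B :: r)) (IH fs _) _ => //.
  exact: trun_R (ltnSn 0).
by rewrite /=; lia.
Qed.

Lemma flat_cons s st : flat (s :: st) = s ++ B :: flat st.
Proof. by rewrite /flat /= cat_rcons. Qed.
Lemma flat_cat s t : flat (s ++ t) = flat s ++ flat t.
Proof. by rewrite /flat map_cat flatten_cat. Qed.

Lemma trun_skip x l h r n : 0 < n ->
  trun (TAct (fun x h => (x, h, MStay))) (x, l, h :: r) n (x, l, h :: r).
Proof. exact: (@tr_act _ (x, l, h :: r)). Qed.

Lemma flat_neq st r i : i < size st -> exists h t, flat (drop i st) ++ r = h :: t.
Proof.
move=> lt; rewrite (drop_nth [::] lt) flat_cons.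
by case: (nth _ _ _) => [|h t]; [exists B | exists h]; eexists.
Qed.

Lemma gotoP i st x l r : i < size st -> all filled st ->
  trun (trep i goto1) (x, l, flat st ++ r) (4 * size (flat (take i st)) + 1)
    (x, rev (flat (take i st)) ++ l, flat (drop i st) ++ r).
Proof.
elim: i st x l => [|i IH] st x l.
  move=> lt _; rewrite take0 drop0; have:= flat_neq r lt; rewrite drop0 => -[h [t ->]].
  exact: trun_skip.
case: st => [|s st] //= lt /andP[fs fst].
rewrite !flat_cons -catA /=.
apply: (tr_seq' (goto1P x l _ fs) (IH _ _ _ lt fst)) => //.
  by rewrite rev_rcons rev_cat rev_cons -catA cat_rcons.
  by rewrite !size_cat /=; lia.
Qed.

(** Each swap writes the previous symbol and picks up the current one, so the stack moves one cell
    to the right and a blank enters on its left. *)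
Lemma carryR1 s l r : filled s ->
  trun (TSeq (TWhile nb swR) swR) (B, l, s ++ B :: r) (4 * size s + 4)
    (B, rev s ++ B :: l, r).
Proof.
have: forall x L y, y :: L = rev s ++ x :: l -> filled s ->
  trun (TWhile nb swR) (x, l, s ++ B :: r) (4 * size s + 2) (y, L, B :: r).
  elim: s l => [|c s IH] l x L y.
    by case=> -> -> _; exact: (@tr_stop nb swR (x, l, B :: r)).
  rewrite rev_cons cat_rcons => E /andP[cB fs].
  apply: (@tr_go nb swR (x, l, c :: s ++ B :: r)) (IH _ _ _ _ E fs) _ => //.
    exact: trun_swR (ltnSn 0).
  by rewrite /=; lia.
move=> H fs; case E: (rev s ++ B :: l) => [|y L]; first by case: (rev s) E.
have := @trun_swR y L B r 1 isT => H1.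
by apply: (tr_seq' (H _ _ _ (esym E) fs) H1) => //; lia.
Qed.

Lemma carryRP i st l r : i < size st -> all filled st -> exists2 L,
  trun (trep i (TSeq (TWhile nb swR) swR)) (B, l, flat st ++ r)
    (4 * size (flat (take i st)) + 1) (B, L, flat (drop i st) ++ r)
  & B :: L = rev (flat (take i st)) ++ B :: l.
Proof.
elim: i st l => [|i IH] st l.
  move=> lt _; rewrite take0 drop0; have:= flat_neq r lt; rewrite drop0 => -[h [t ->]].
  by exists l => //; exact: trun_skip.
case: st => [|s st] //= lt /andP[fs fst].
have [L H E] := IH st (rev s ++ B :: l) lt fst; exists L.
  rewrite !flat_cons -catA /=; apply: (tr_seq' (carryR1 l _ fs) H) => //.
  by rewrite !size_cat /=; lia.
by rewrite E flat_cons rev_cat rev_cons cat_rcons -catA.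
Qed.

Lemma while_L x s l r : filled s -> head B l = B ->
  trun (TWhile nb tL) (x, behead (rev s ++ l), head B (rev s ++ l) :: r)
    (4 * size s + 2) (x, behead l, B :: s ++ r).
Proof.
elim/last_ind: s r => [|s c IH] r.
  by move=> _ Bl; rewrite /= Bl; exact: (@tr_stop nb tL (x, behead l, B :: r)).
rewrite /filled all_rcons rev_rcons /= => /andP[cB fs] Bl; rewrite cat_rcons.
apply: (@tr_go nb tL (x, rev s ++ l, c :: r)) (IH _ fs Bl) _ => //.
  exact: trun_L (ltnSn 0).
by rewrite size_rcons; lia.
Qed.

Definition home1 := TSeq tL (TSeq tL (TSeq (TWhile nb tL) tR)).
Lemma home1P x s l h r : filled s -> head B l = B ->
  trun home1 (x, rev (rcons s B) ++ l, h :: r)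
    (4 * size s + 5) (x, B :: behead l, s ++ B :: h :: r).
Proof.
move=> fs Bl; rewrite rev_rcons /=.
have H1 := @trun_L x (B :: rev s ++ l) h r 1 isT.
have H2 := @trun_L x (rev s ++ l) B (h :: r) 1 isT.
have H3 := @while_L x s l (B :: h :: r) fs Bl.
have H4 := @trun_R x (behead l) B (s ++ B :: h :: r) 1 isT.
apply: (tr_seq H1 (tr_seq H2 (tr_seq H3 H4 (leqnn _)) (leqnn _))); lia.
Qed.

Fixpoint home i := if i is i'.+1 then TSeq home1 (home i') else TAct (fun x h => (x, h, MStay)).

Lemma flat_rcons st s : flat (rcons st s) = flat st ++ rcons s B.
Proof. by rewrite -[rcons st s]cats1 flat_cat /flat /= cats0. Qed.

Lemma take_flat i st : i < size st ->
  flat (take i.+1 st) = flat (take i st) ++ rcons (nth [::] st i) B.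
Proof. by move=> lt; rewrite (take_nth [::] lt) flat_rcons. Qed.

Lemma head_flat st a : head B (rev (flat st) ++ nseq a B) = B.
Proof.
case/lastP: st => [|st s]; first by case: a.
by rewrite flat_rcons rev_cat rev_rcons.
Qed.

(** Moving left off the written part creates a blank. This changes only the number of leading
    blanks, which is therefore existential in the statements that follow. *)
Lemma behead_flat st a : exists a',
  B :: behead (rev (flat st) ++ nseq a B) = rev (flat st) ++ nseq a' B.
Proof.
case/lastP: st => [|st s]; first by exists a.-1.+1; case: a.
by exists a; rewrite flat_rcons rev_cat rev_rcons.
Qed.

Lemma nth_filled st i : all filled st -> filled (nth [::] st i).
Proof. by move=> f; case: (ltnP i (size st)) => [/(all_nthP [::] f)//|/(nth_default [::])->]. Qed.

Lemma homeP i st x a r : i < size st -> all filled st -> exists a',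
  trun (home i) (x, rev (flat (take i st)) ++ nseq a B, flat (drop i st) ++ r)
    (5 * size (flat (take i st)) + 1) (x, nseq a' B, flat st ++ r).
Proof.
move=> lt fst; elim: i a lt => [|i IH] a lt.
  exists a; rewrite take0 drop0; have:= flat_neq r lt; rewrite drop0 => -[h [t ->]].
  exact: trun_skip.
have [h [t E]] := flat_neq r lt.
have [a1 E1] := behead_flat (take i st) a.
have [a2 H2] := IH a1 (ltnW lt); exists a2.
have H1 := @home1P x (nth [::] st i) (rev (flat (take i st)) ++ nseq a B) h t
  (nth_filled i fst) (head_flat _ _).
rewrite take_flat ?(ltnW lt) // rev_cat -catA E.
apply: (tr_seq' H1 H2) => //; last by rewrite size_cat size_rcons; lia.
by rewrite E1 -E [in RHS](drop_nth [::]) ?(ltnW lt) // flat_cons -catA.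
Qed.

(** Mirror image of the right shift. The last action writes the carried symbol over a free blank to
    the left of all stacks. *)
Fixpoint carryL i := if i is i'.+1 then TSeq (TSeq swL (TWhile nb swL)) (carryL i')
  else TAct (fun x h => (B, x, MStay)).

Lemma while_swL x s l r : filled s -> head B l = B -> exists y R,
  trun (TWhile nb swL) (x, behead (rev s ++ l), head B (rev s ++ l) :: r)
    (4 * size s + 2) (y, behead l, B :: R) /\ y :: R = s ++ x :: r.
Proof.
elim/last_ind: s x r => [|s c IH] x r.
  move=> _ Bl; rewrite /= Bl; exists x, r; split=> //.
  exact: (@tr_stop nb swL (x, behead l, B :: r)).
rewrite /filled all_rcons rev_rcons /= => /andP[cB fs] Bl; rewrite cat_rcons.
have [y [R [H E]]] := IH c (x :: r) fs Bl; exists y, R; split=> //.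
apply: (@tr_go nb swL (x, rev s ++ l, c :: r)) H _ => //.
  exact: trun_swL (ltnSn 0).
by rewrite size_rcons; lia.
Qed.

Lemma carryLP i st y a r : i <= size st -> all filled st -> exists a',
  trun (carryL i) (y, behead (rev (flat (take i st)) ++ nseq a B), B :: r)
    (4 * size (flat (take i st)) + 1) (B, nseq a' B, flat (take i st) ++ y :: r).
Proof.
move=> lt fst; elim: i y a r lt => [|i IH] y a r lt.
  exists a.-1; rewrite take0 (_ : behead _ = nseq a.-1 B); last by case: a.
  exact: (@tr_act _ (y, _, B :: r)).
have Hl := head_flat (take i st) a.
have H1 := @trun_swL y (rev (nth [::] st i) ++ rev (flat (take i st)) ++ nseq a B) B r 1 isT.
have [z [R [H2 E]]] := while_swL B (y :: r) (nth_filled i fst) Hl.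
have [a' H3] := IH z a R (ltnW lt); exists a'.
rewrite take_flat // rev_cat rev_rcons -catA /=.
apply: (tr_seq' (tr_seq H1 H2 (leqnn _)) H3) => //.
  by rewrite E -cats1 -!catA.
by rewrite size_cat size_rcons; lia.
Qed.

(** Room in stack [i] is made by shifting the stacks before it one cell to the left, so the tape
    grows only on its blank left side. *)
Definition push i s := TSeq (trep i goto1) (TSeq (TAct (fun _ h => (s, h, MLeft))) (carryL i)).

Lemma flat_set st i s : i < size st -> flat (set_nth [::] st i s) =
  flat (take i st) ++ s ++ B :: flat (drop i.+1 st).
Proof. by move=> lt; rewrite set_nthE lt flat_cat flat_cons. Qed.
Lemma flat_split st i : i < size st -> flat st =
  flat (take i st) ++ nth [::] st i ++ B :: flat (drop i.+1 st).
Proof.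
by move=> lt; rewrite -flat_cons -drop_nth // -flat_cat cat_take_drop.
Qed.

Lemma pushP i st s x a r : i < size st -> all filled st -> exists a',
  trun (push i s) (x, nseq a B, flat st ++ r) (20 * size (flat st))
    (B, nseq a' B, flat (set_nth [::] st i (s :: nth [::] st i)) ++ r).
Proof.
move=> lt fst; have H1 := gotoP x (nseq a B) r lt fst.
have [h [t E]] := flat_neq r lt.
have H2 := @tr_act (fun _ h => (s, h, MLeft)) (x, rev (flat (take i st)) ++ nseq a B, h :: t) 1 isT.
have [a' H3] := carryLP s a (h :: t) (ltnW lt) fst; exists a'.
apply: (tr_seq' H1 (tr_seq' H2 H3 _ (erefl _) (leqnn _))).
- by rewrite /act /= head_flat.
- by rewrite E.
- rewrite -E flat_set // (drop_nth [::] lt) flat_cons -!catA /=; rewrite -?catA //.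
have := congr1 size (flat_split lt); rewrite !size_cat /=; lia.
Qed.

(** A blank under the head means that stack [i] is empty. Otherwise the stacks before it are shifted
    one cell to the right over its top, which ends up in the register. *)
Definition pop i :=
  TSeq (trep i goto1) (TIf nb
   (TSeq (home i) (TSeq (setreg B) (TSeq (trep i (TSeq (TWhile nb swR) swR)) (TSeq swR (home i)))))
   (TSeq (setreg B) (home i))).

Lemma popP i st x a r : i < size st -> all filled st -> exists a',
  trun (pop i) (x, nseq a B, flat st ++ r) (40 * size (flat st))
    (head B (nth [::] st i), nseq a' B,
     flat (set_nth [::] st i (behead (nth [::] st i))) ++ r).
Proof.
move=> lt fst; have H1 := gotoP x (nseq a B) r lt fst.
have sz := congr1 size (flat_split lt); rewrite !size_cat /= in sz.
have [h0 [t0 E0]] : exists h t, flat st ++ r = h :: t.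
  by have:= @flat_neq st r 0; rewrite drop0; apply; lia.
have [h [t E]] := flat_neq r lt.
have D : h :: t = nth [::] st i ++ B :: flat (drop i.+1 st) ++ r.
  by rewrite -E (drop_nth [::] lt) flat_cons -catA.
case En: (nth [::] st i) => [|c s].
  rewrite En in D; case: D => Dh Dt.
  have H2 := @tr_act (fun _ h => (B, h, MStay)) (x, rev (flat (take i st)) ++ nseq a B, h :: t) 1 isT.
  have [a' H3] := homeP B a r lt fst; exists a'.
  rewrite E in H1; have H : trun (TSeq (setreg B) (home i))
      (x, rev (flat (take i st)) ++ nseq a B, h :: t) (5 * size (flat (take i st)) + 2)
      (B, nseq a' B, flat st ++ r).
    apply: (tr_seq' H2 H3) => //; last by lia.
    by rewrite /act /= E.
  rewrite (_ : flat _ = flat st); last by rewrite flat_set // [RHS](flat_split lt) En.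
  apply: (tr_seq H1 (tr_if (n := 5 * size (flat (take i st)) + 2) _ (leqnn _))); last by lia.
  by rewrite (_ : nb _ _ = false) //= /nb /hd /= Dh.
have ch : c != B by have := nth_filled i fst; rewrite En => /andP[].
rewrite En in D; case: D => Dh Dt.
have [a1 H2] := homeP x a r lt fst.
have H3 := @tr_act (fun _ h => (B, h, MStay)) (x, nseq a1 B, h0 :: t0) 1 isT.
have [L H4 EL] := carryRP (nseq a1 B) r lt fst.
have H5 := @trun_swR B L h t 1 isT.
set st' := set_nth [::] st i s.
have lt' : i < size st' by rewrite size_set_nth; lia.
have fst' : all filled st'.
  apply/(all_nthP [::]) => j _; rewrite /st' nth_set_nth /=; case: eqP => _; last exact: nth_filled.
  by have := nth_filled i fst; rewrite En => /andP[].
(* The shift frees one cell on the left, whence [a1.+1] blanks. *)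
have [a' H6] := homeP c a1.+1 r lt' fst'; exists a'.
have Et : take i st' = take i st by rewrite /st' set_nthE lt take_size_cat // size_take lt.
have Ed : drop i st' = s :: drop i.+1 st by rewrite /st' set_nthE lt drop_size_cat // size_take lt.
rewrite E in H1.
apply: (tr_seq H1 (tr_if (n := 30 * size (flat st) + 2) _ (leqnn _))) => //=; last by lia.
rewrite (_ : nb _ _ = true); last by rewrite /nb /hd /= Dh.
rewrite -E; apply: (tr_seq' H2 (tr_seq' H3 (tr_seq' H4 (tr_seq' H5 H6 _ (erefl _) (leqnn _)) _ (erefl _) (leqnn _)) _ (erefl _) (leqnn _))).
- by rewrite Dh Et EL Ed flat_cons -catA Dt.
- by rewrite E.
- by rewrite /act /= E0.
- by rewrite E0.
- by [].
- by rewrite Et; lia.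
Qed.

(** * The stack language and its cost on the tape *)

Inductive prog :=
  | PSkip
  | PPush of nat & sym
  | PPop of nat
  | PSeq of prog & prog
  | PIf of (sym -> bool) & prog & prog
  | PWhile of (sym -> bool) & prog.

Definition state := (sym * seq (seq sym))%type.

(* The number is an upper bound on the number of instructions executed. *)
Inductive hrun : prog -> state -> nat -> state -> Prop :=
  | hr_skip m n : 0 < n -> hrun PSkip m n m
  | hr_push i s x st n : i < size st -> s != B -> 0 < n ->
      hrun (PPush i s) (x, st) n (B, set_nth [::] st i (s :: nth [::] st i))
  | hr_pop i x st n : i < size st -> 0 < n ->
      hrun (PPop i) (x, st) n
        (head B (nth [::] st i), set_nth [::] st i (behead (nth [::] st i)))
  | hr_seq p q m1 n1 m2 n2 m3 n : hrun p m1 n1 m2 -> hrun q m2 n2 m3 ->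
      n1 + n2 <= n -> hrun (PSeq p q) m1 n m3
  | hr_if (c : sym -> bool) p q m n m' N :
      hrun (if c m.1 then p else q) m n m' -> n < N -> hrun (PIf c p q) m N m'
  | hr_stop (c : sym -> bool) p m N : ~~ c m.1 -> 0 < N -> hrun (PWhile c p) m N m
  | hr_go (c : sym -> bool) p m1 n1 m2 n2 m3 N : c m1.1 ->
      hrun p m1 n1 m2 -> hrun (PWhile c p) m2 n2 m3 -> n1 + n2 < N ->
      hrun (PWhile c p) m1 N m3.

Fixpoint cprog p :=
  match p with
  | PSkip => TAct (fun x h => (x, h, MStay))
  | PPush i s => push i s
  | PPop i => pop i
  | PSeq p q => TSeq (cprog p) (cprog q)
  | PIf c p q => TIf (fun x _ => c x) (cprog p) (cprog q)
  | PWhile c p => TWhile (fun x _ => c x) (cprog p)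
  end.

Definition ssz (m : state) := size (flat m.2).
Definition sok (m : state) := (0 < size m.2) && all filled m.2.
Definition tape (m : state) a r : mem := (m.1, nseq a B, flat m.2 ++ r).

Lemma sok_set x st i s : i < size st -> filled s -> sok (x, st) ->
  sok (x, set_nth [::] st i s).
Proof.
move=> lt fs /andP[_ /= f]; rewrite /sok size_set_nth /=; apply/andP; split; first by lia.
apply/(all_nthP [::]) => j _; rewrite nth_set_nth /=.
by case: eqP => // _; exact: nth_filled.
Qed.

Lemma ssz_set x y st i s : i < size st ->
  ssz (y, set_nth [::] st i s) + size (nth [::] st i) = ssz (x, st) + size s.
Proof.
by move=> lt; rewrite /ssz flat_set // [in RHS](flat_split lt) !size_cat /=; lia.
Qed.

(** An instruction adds at most one cell, so running time also bounds space. *)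
Lemma hrun_sok p m n m' : hrun p m n m' -> sok m -> sok m' /\ ssz m' <= ssz m + n.
Proof.
elim=> {p m n m'}.
- by move=> m n _; split=> //; lia.
- move=> i s x st n lt sB n0 ok; split.
    apply: (@sok_set B st) => //; rewrite /filled /= sB.
    by case/andP: ok => _ /(@nth_filled _ i).
  by have := ssz_set x B (s :: nth [::] st i) lt; rewrite /=; lia.
- move=> i x st n lt n0 ok; split.
    apply: (@sok_set _ st) => //.
    case/andP: ok => _ /(@nth_filled _ i) /=.
    by case: (nth _ _ _) => //= c s /andP[].
  have := ssz_set x (head B (nth [::] st i)) (behead (nth [::] st i)) lt.
  by rewrite size_behead; lia.
- move=> p q m1 n1 m2 n2 m3 n _ IH1 _ IH2 le ok.
  by case: (IH1 ok) => /IH2[ok3 l2] l1; split=> //; lia.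
- move=> c p q m n m' N _ IH lt ok.
  by case: (IH ok) => ok' l; split=> //; lia.
- by move=> *; split=> //; lia.
- move=> c p m1 n1 m2 n2 m3 N _ _ IH1 _ IH2 le ok.
  by case: (IH1 ok) => /IH2[ok3 l2] l1; split=> //; lia.
Qed.

(** [M] bounds the tape content throughout the run, so an instruction costs at most the [40 * M] of
    a pop; the [+ 2] pays for skips and tests. *)
Lemma hrun_trun p m n m' : hrun p m n m' -> sok m -> forall M a r, ssz m + n <= M ->
  exists a', trun (cprog p) (tape m a r) (n * (40 * M + 2)) (tape m' a' r).
Proof.
(* With at least one stack the tape holds a separator, so there is always a cell under the head. *)
have stayE m0 a r : sok m0 -> stay (tape m0 a r) = tape m0 a r.
  case: m0 => x [|[|c s] st] //= _; rewrite /stay/act/tape/=/hd /= !flat_cons //=.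
elim=> {p m n m'}.
- move=> m n n0 ok M a r le; exists a; rewrite -[in X in trun _ _ _ X]stayE //.
  by apply: (@tr_act _ (tape m a r)); lia.
- move=> i s x st n lt sB n0 /andP[_ ok] M a r le.
  have [a' H] := pushP s x a r lt ok; exists a'.
  by apply: trun_weak H _; rewrite /ssz /= in le; nia.
- move=> i x st n lt n0 /andP[_ ok] M a r le.
  have [a' H] := popP x a r lt ok; exists a'.
  by apply: trun_weak H _; rewrite /ssz /= in le; nia.
- move=> p q m1 n1 m2 n2 m3 n H1 IH1 H2 IH2 le ok M a r leM.
  have [ok2 l2] := hrun_sok H1 ok.
  have [|a1 T1] := IH1 ok M a r; first by lia.
  have [|a2 T2] := IH2 ok2 M a1 r; first by lia.
  by exists a2; apply: (tr_seq T1 T2); nia.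
- move=> c p q m n m' N _ IH lt ok M a r leM.
  have [|a1 T1] := IH ok M a r; first by lia.
  exists a1; apply: (@tr_if _ _ _ _ (n * (40 * M + 2))); last by nia.
  by move: T1; rewrite /tape /rg /=; case: (c _).
- move=> c p m N nc N0 ok M a r leM; exists a.
  rewrite -[in X in trun _ _ _ X]stayE //.
  by apply: tr_stop => //; nia.
- move=> c p m1 n1 m2 n2 m3 N cm H1 IH1 H2 IH2 le ok M a r leM.
  have [ok2 l2] := hrun_sok H1 ok.
  have [|a1 T1] := IH1 ok M a r; first by lia.
  have [|a2 T2] := IH2 ok2 M a1 r; first by lia.
  by exists a2; apply: (tr_go _ T1 T2) => //; nia.
Qed.

(** * Stack programs transforming encoded trees *)

Inductive tree := Leaf | Node of tree & tree.

(** Preorder gives a prefix code: a tree on a stack delimits itself, and arbitrary data may lie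
    below it. *)
Fixpoint code t := if t is Node a b then S1 :: code a ++ code b else [:: S0].
Definition tsz t := size (code t).

Lemma tsz_gt0 t : 0 < tsz t. Proof. by case: t. Qed.
Lemma tsz_node a b : tsz (Node a b) = (tsz a + tsz b).+1.
Proof. by rewrite /tsz /= size_cat. Qed.

Lemma hrun_weak p m n m' N : hrun p m n m' -> n <= N -> hrun p m N m'.
Proof.
case=> {p m n m'}.
- by move=> *; apply: hr_skip; lia.
- by move=> *; apply: hr_push => //; lia.
- by move=> *; apply: hr_pop => //; lia.
- by move=> p q m1 n1 m2 n2 m3 n H1 H2 le1 le2; apply: (hr_seq H1 H2); lia.
- by move=> c p q m n m' N' H l1 l2; apply: (hr_if H); lia.
- by move=> c p m N' h l1 l2; apply: hr_stop => //; lia.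
- by move=> c p m1 n1 m2 n2 m3 N' h H1 H2 l1 l2; apply: (hr_go h H1 H2); lia.
Qed.

Lemma run_seq p q m1 n1 m2 n2 m3 : hrun p m1 n1 m2 -> hrun q m2 n2 m3 ->
  hrun (PSeq p q) m1 (n1 + n2) m3.
Proof. by move=> H1 H2; exact: hr_seq H1 H2 _. Qed.

Fixpoint pseq (ps : seq prog) : prog :=
  if ps is p :: ps then PSeq p (pseq ps) else PSkip.

Definition is1 (s : sym) := if s is S1 then true else false.
Definition is0 (s : sym) := if s is S0 then true else false.
Definition notmk (s : sym) := if s is SPlus then false else true.

Lemma run_push0 s x a b c : s != B ->
  hrun (PPush 0 s) (x, [:: a; b; c]) 1 (B, [:: s :: a; b; c]).
Proof. by move=> sB; exact: (@hr_push 0 s x [:: a; b; c]). Qed.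
Lemma run_push1 s x a b c : s != B ->
  hrun (PPush 1 s) (x, [:: a; b; c]) 1 (B, [:: a; s :: b; c]).
Proof. by move=> sB; exact: (@hr_push 1 s x [:: a; b; c]). Qed.
Lemma run_push2 s x a b c : s != B ->
  hrun (PPush 2 s) (x, [:: a; b; c]) 1 (B, [:: a; b; s :: c]).
Proof. by move=> sB; exact: (@hr_push 2 s x [:: a; b; c]). Qed.
Lemma run_pop0 s x a b c :
  hrun (PPop 0) (x, [:: s :: a; b; c]) 1 (s, [:: a; b; c]).
Proof. exact: (@hr_pop 0 x [:: s :: a; b; c]). Qed.
Lemma run_pop1 s x a b c :
  hrun (PPop 1) (x, [:: a; s :: b; c]) 1 (s, [:: a; b; c]).
Proof. exact: (@hr_pop 1 x [:: a; s :: b; c]). Qed.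
Lemma run_pop2 s x a b c :
  hrun (PPop 2) (x, [:: a; b; s :: c]) 1 (s, [:: a; b; c]).
Proof. exact: (@hr_pop 2 x [:: a; b; s :: c]). Qed.
Lemma run_pop2' x a b c :
  hrun (PPop 2) (x, [:: a; b; c]) 1 (head B c, [:: a; b; behead c]).
Proof. exact: (@hr_pop 2 x [:: a; b; c]). Qed.
Lemma run_pop1' x a b c :
  hrun (PPop 1) (x, [:: a; b; c]) 1 (head B b, [:: a; behead b; c]).
Proof. exact: (@hr_pop 1 x [:: a; b; c]). Qed.
Lemma run_pop0' x a b c :
  hrun (PPop 0) (x, [:: a; b; c]) 1 (head B a, [:: behead a; b; c]).
Proof. exact: (@hr_pop 0 x [:: a; b; c]). Qed.
Lemma run_skip m : hrun PSkip m 1 m.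
Proof. exact: hr_skip. Qed.
Lemma run_if1 (c : sym -> bool) p q m n m' : c m.1 -> hrun p m n m' -> hrun (PIf c p q) m n.+1 m'.
Proof. by move=> h H; apply: (@hr_if _ _ _ _ n) => //; rewrite h. Qed.
Lemma run_if0 (c : sym -> bool) p q m n m' : ~~ c m.1 -> hrun q m n m' -> hrun (PIf c p q) m n.+1 m'.
Proof. by move=> h H; apply: (@hr_if _ _ _ _ n) => //; rewrite (negbTE h). Qed.
Lemma run_go (c : sym -> bool) p m1 n1 m2 n2 m3 : c m1.1 -> hrun p m1 n1 m2 ->
  hrun (PWhile c p) m2 n2 m3 -> hrun (PWhile c p) m1 (n1 + n2).+1 m3.
Proof. by move=> h H1 H2; apply: (hr_go h H1 H2). Qed.
Lemma run_stop (c : sym -> bool) p m : ~~ c m.1 -> hrun (PWhile c p) m 1 m.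
Proof. by move=> h; apply: hr_stop. Qed.

Ltac hstep := first
  [ exact: run_skip | exact: run_push0 | exact: run_push1 | exact: run_push2
  | exact: run_pop0 | exact: run_pop1 | exact: run_pop2 | exact: run_pop2' | exact: run_pop1' | exact: run_pop0' ].
Ltac hsteps := first [ hstep
  | apply: run_seq; [hsteps | hsteps]
  | (apply: run_if1; [by [] | hsteps])
  | (apply: run_if0; [by [] | hsteps]) | idtac ].

(** Stack 2 holds in unary the subtrees still to be read: a node opens two, and each symbol read
    closes one. The loop continues while the counter symbol popped is [S1]. *)
Definition mv_body := PSeq (PPop 0) (PSeq (PIf is0 (PPush 1 S0)
   (PSeq (PPush 1 S1) (PSeq (PPush 2 S1) (PPush 2 S1)))) (PPop 2)).

Lemma mv_loop t a b c n m' :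
  hrun (PWhile is1 mv_body) (head B c, [:: a; rev (code t) ++ b; behead c]) n m' ->
  hrun (PWhile is1 mv_body) (S1, [:: code t ++ a; b; c]) (n + 7 * tsz t) m'.
Proof.
elim: t a b c n m' => [|l IHl r IHr] a b c n m' H.
  apply: hrun_weak (run_go (m2 := (head B c, [:: a; S0 :: b; behead c])) (n1 := 6) _ _ H) _ => //.
    by apply: hrun_weak; [hsteps | ].
  by rewrite /tsz /=; lia.
rewrite /= rev_cons rev_cat cat_rcons -catA in H.
have H1 := IHl (code r ++ a) (S1 :: b) (S1 :: c) _ _ (IHr _ _ c _ _ H).
apply: hrun_weak (run_go (n1 := 6) _ _ H1) _ => //.
  by rewrite /= -catA; apply: hrun_weak; [hsteps | ].
by rewrite tsz_node; lia.
Qed.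

Definition mk := SPlus.
(** The [S0] below the counter stops the loop; [mk] marks on stack 1 where the moved tree ends. *)
Definition mvtree := pseq [:: PPush 1 mk; PPush 2 S0; PPush 2 S1; PPop 2; PWhile is1 mv_body].

Lemma mvtreeP t x a b c :
  hrun mvtree (x, [:: code t ++ a; b; c]) (7 * tsz t + 10)
    (S0, [:: a; rev (code t) ++ mk :: b; c]).
Proof.
have H := @mv_loop t a (mk :: b) (S0 :: c) 1 _ (run_stop _ _).
apply: hrun_weak; [do 4 (apply: run_seq; [hstep|]); apply: run_seq; [exact: H|hstep] | lia].
Qed.

(** A transfer reverses the word, so [mvtree] followed by one such transfer restores the order. *)
Definition drain j (ts : seq nat) := PSeq (PPop j) (PWhile notmk
   (PSeq (PIf is0 (pseq [seq PPush t S0 | t <- ts]) (pseq [seq PPush t S1 | t <- ts])) (PPop j))).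

Definition bits (w : seq sym) := all (fun s => is0 s || is1 s) w.

Lemma bits_code t : bits (code t).
Proof. by elim: t => //= l IHl r IHr; rewrite /bits all_cat; apply/andP. Qed.
Lemma bits_rev w : bits (rev w) = bits w.
Proof. by rewrite /bits all_rev. Qed.

Ltac drain_ind :=
  let s := fresh "s" in let w := fresh "w" in let IH := fresh "IH" in
  let bs := fresh "bs" in let bw := fresh "bw" in
  elim=> [|s w IH] a b c bw;
  [ exact: run_stop |
    case/andP: bw => bs bw; rewrite ?rev_cons ?cat_rcons;
    apply: hrun_weak;
      [apply: (@run_go _ _ _ 7);
        [by case: s bs | | exact: (IH _ _ _ bw)];
        case: s bs => //= _; (apply: hrun_weak; [hsteps | done])
      | rewrite /=; lia] ].

Lemma drain10 w a b c x : bits w ->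
  hrun (drain 1 [:: 0]) (x, [:: a; w ++ mk :: b; c]) (10 * size w + 2) (mk, [:: rev w ++ a; b; c]).
Proof.
move=> bw; apply: (@hrun_weak _ _ (1 + (10 * size w + 1))); last lia.
apply: run_seq; first exact: (@hr_pop 1 x [:: a; w ++ mk :: b; c]).
rewrite /=; move: w a b c bw; drain_ind.
Qed.

Lemma drain1 w a b c x : bits w ->
  hrun (drain 1 [::]) (x, [:: a; w ++ mk :: b; c]) (10 * size w + 2) (mk, [:: a; b; c]).
Proof.
move=> bw; apply: (@hrun_weak _ _ (1 + (10 * size w + 1))); last lia.
apply: run_seq; first exact: (@hr_pop 1 x [:: a; w ++ mk :: b; c]).
rewrite /=; move: w a b c bw; drain_ind.
Qed.

Lemma drain102 w a b c x : bits w ->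
  hrun (drain 1 [:: 0; 2]) (x, [:: a; w ++ mk :: b; c]) (10 * size w + 2) (mk, [:: rev w ++ a; b; rev w ++ c]).
Proof.
move=> bw; apply: (@hrun_weak _ _ (1 + (10 * size w + 1))); last lia.
apply: run_seq; first exact: (@hr_pop 1 x [:: a; w ++ mk :: b; c]).
rewrite /=; move: w a b c bw; drain_ind.
Qed.

Lemma drain12 w a b c x : bits w ->
  hrun (drain 1 [:: 2]) (x, [:: a; w ++ mk :: b; c]) (10 * size w + 2) (mk, [:: a; b; rev w ++ c]).
Proof.
move=> bw; apply: (@hrun_weak _ _ (1 + (10 * size w + 1))); last lia.
apply: run_seq; first exact: (@hr_pop 1 x [:: a; w ++ mk :: b; c]).
rewrite /=; move: w a b c bw; drain_ind.
Qed.

Lemma drain21 w a b c x : bits w ->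
  hrun (drain 2 [:: 1]) (x, [:: a; b; w ++ mk :: c]) (10 * size w + 2) (mk, [:: a; rev w ++ b; c]).
Proof.
move=> bw; apply: (@hrun_weak _ _ (1 + (10 * size w + 1))); last lia.
apply: run_seq; first exact: (@hr_pop 2 x [:: a; b; w ++ mk :: c]).
rewrite /=; move: w a b c bw; drain_ind.
Qed.

(** Quantifying over the rest [a] of the stack and over [b], [c] makes programs composable: the
    other stacks serve as scratch space but are restored. The final register is left free. *)
Definition comps p s t n := forall x a b c,
  exists x', hrun p (x, [:: code s ++ a; b; c]) n (x', [:: code t ++ a; b; c]).

Definition dropt := PSeq mvtree (drain 1 [::]).
Definition dupt := PSeq mvtree (PSeq (PPush 2 mk) (PSeq (drain 1 [:: 0; 2])
  (PSeq (PPush 1 mk) (PSeq (drain 2 [:: 1]) (drain 1 [:: 0]))))).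
Definition swapt := PSeq mvtree (PSeq mvtree (PSeq (PPush 2 mk) (PSeq (drain 1 [:: 2])
  (PSeq (drain 1 [:: 0]) (PSeq (PPush 1 mk) (PSeq (drain 2 [:: 1]) (drain 1 [:: 0]))))))).

Lemma droptP t x a b c :
  hrun dropt (x, [:: code t ++ a; b; c]) (20 * tsz t + 20) (mk, [:: a; b; c]).
Proof.
have bt : bits (rev (code t)) by rewrite bits_rev bits_code.
apply: hrun_weak; first by apply: run_seq (mvtreeP _ _ _ _ _) (drain1 _ _ _ _ bt).
by rewrite size_rev /tsz; lia.
Qed.

Lemma duptP t x a b c :
  hrun dupt (x, [:: code t ++ a; b; c]) (50 * tsz t + 50) (mk, [:: code t ++ code t ++ a; b; c]).
Proof.
have bc := bits_code t; have bt : bits (rev (code t)) by rewrite bits_rev.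
apply: hrun_weak.
  apply: run_seq (mvtreeP _ _ _ _ _) _; apply: run_seq; first hstep.
  apply: run_seq (drain102 _ _ _ _ bt) _; apply: run_seq; first hstep.
  rewrite !revK; apply: run_seq (drain21 _ _ _ _ bc) _.
  by have := @drain10 _ (code t ++ a) b c mk bt; rewrite revK; apply.
by rewrite !size_rev /tsz; lia.
Qed.

Lemma swaptP s t x a b c :
  hrun swapt (x, [:: code s ++ code t ++ a; b; c]) (50 * (tsz s + tsz t) + 50)
    (mk, [:: code t ++ code s ++ a; b; c]).
Proof.
have bcs := bits_code s; have bs : bits (rev (code s)) by rewrite bits_rev.
have bct := bits_code t; have bt : bits (rev (code t)) by rewrite bits_rev.
apply: hrun_weak.
  apply: run_seq (mvtreeP _ _ _ _ _) _; apply: run_seq (mvtreeP _ _ _ _ _) _.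
  apply: run_seq; first hstep.
  apply: run_seq (drain12 _ _ _ _ bt) _; apply: run_seq (drain10 _ _ _ _ bs) _.
  apply: run_seq; first hstep.
  rewrite !revK; apply: run_seq (drain21 _ _ _ _ bct) _.
  by have := @drain10 _ (code s ++ a) b c mk bt; rewrite revK; apply.
by rewrite !size_rev /tsz; lia.
Qed.

Lemma comps_weak p s t n N : comps p s t n -> n <= N -> comps p s t N.
Proof.
by move=> H le x a b c; have [x' H'] := H x a b c; exists x'; apply: hrun_weak H' le.
Qed.

Lemma comps_seq p q s t u n1 n2 : comps p s t n1 -> comps q t u n2 ->
  comps (PSeq p q) s u (n1 + n2).
Proof.
move=> H1 H2 x a b c; have [x1 {}H1] := H1 x a b c; have [x2 {}H2] := H2 x1 a b c.
by exists x2; exact: run_seq H1 H2.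
Qed.

(** Each instruction pushes at most one symbol, so time bounds growth. This controls the
    intermediate values of compositions. *)
Lemma comps_size p s t n : comps p s t n -> tsz t <= tsz s + n.
Proof.
move=> H; have [x' H'] := H B [::] [::] [::].
have ok : sok (B, [:: code s ++ [::]; [::]; [::]]).
  rewrite /sok /= andbT cats0; apply/allP => c /(allP (bits_code s)).
  by case: c.
have [_] := hrun_sok H' ok; rewrite /ssz /= !cats0 /flat /= !size_cat !size_rcons /= /tsz.
lia.
Qed.

Definition pushw (w : seq sym) := foldr (fun s p => PSeq p (PPush 0 s)) PSkip w.
Lemma pushwP w x a b c : bits w -> exists x',
  hrun (pushw w) (x, [:: a; b; c]) (size w + 1) (x', [:: w ++ a; b; c]).
Proof.
elim: w => [|s w IH] /=; first by exists x; exact: run_skip.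
case/andP=> bs /IH[x' H]; exists B; apply: hrun_weak (run_seq H _) _.
  by apply: run_push0; case: s bs.
by lia.
Qed.

Lemma comps_const s t : comps (PSeq dropt (pushw (code t))) s t (20 * tsz s + 20 + (tsz t + 1)).
Proof.
move=> x a b c; have [x' H] := @pushwP (code t) mk a b c (bits_code t).
by exists x'; exact: run_seq (droptP _ _ _ _ _) H.
Qed.

Lemma comps_id s : comps PSkip s s 1.
Proof. by move=> x a b c; exists x; exact: run_skip. Qed.

Definition ppair p q := PSeq dupt (PSeq q (PSeq swapt (PSeq p (PPush 0 S1)))).
Lemma comps_pair p q s t u n1 n2 : comps p s t n1 -> comps q s u n2 ->
  comps (ppair p q) s (Node t u) (200 * (tsz s + n1 + n2) + 200).
Proof.
move=> H1 H2 x a b c; have l2 := comps_size H2.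
have [x1 {}H2] := H2 mk (code s ++ a) b c; have [x2 {}H1] := H1 mk (code u ++ a) b c.
exists B; apply: hrun_weak.
  apply: run_seq (duptP _ _ _ _ _) _; apply: run_seq H2 _.
  apply: run_seq (swaptP _ _ _ _ _ _) _; apply: run_seq H1 _.
  by rewrite /= -catA; apply: run_push0.
by lia.
Qed.

Definition pfst := PSeq (PPop 0) (PSeq swapt dropt).
Definition psnd := PSeq (PPop 0) dropt.
Lemma comps_fst s t : comps pfst (Node s t) s (100 * (tsz s + tsz t) + 100).
Proof.
move=> x a b c; exists mk; rewrite /= -catA; apply: hrun_weak.
  by apply: run_seq; [hstep | apply: run_seq (swaptP _ _ _ _ _ _) (droptP _ _ _ _ _)].
by lia.
Qed.
Lemma comps_snd s t : comps psnd (Node s t) t (100 * (tsz s + tsz t) + 100).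
Proof.
move=> x a b c; exists mk; rewrite /= -catA; apply: hrun_weak.
  by apply: run_seq; [hstep | apply: droptP].
by lia.
Qed.

(** After the opening [S1] of the pair, one more symbol tells whether the first component is [Leaf].
    If so, both are dropped and [p] runs on the second component; otherwise both are pushed back. *)
Definition pcase p q := PSeq (PPop 0) (PSeq (PPop 0)
  (PIf is0 p (PSeq (PPush 0 S1) (PSeq (PPush 0 S1) q)))).
Lemma comps_case0 p q s t n : comps p s t n -> comps (pcase p q) (Node Leaf s) t (n + 10).
Proof.
move=> H x a b c; have [x' {}H] := H S0 a b c; exists x'.
by apply: hrun_weak; [apply: run_seq; [hstep|apply: run_seq; [hstep|apply: run_if1 H]] | lia].
Qed.
Lemma comps_case1 p q l r s t n : comps q (Node (Node l r) s) t n ->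
  comps (pcase p q) (Node (Node l r) s) t (n + 10).
Proof.
move=> H x a b c; have [x' {}H] := H B a b c; exists x'.
apply: hrun_weak; [apply: run_seq; [hstep|apply: run_seq; [hstep|apply: run_if0]] | ] => //.
  by apply: run_seq; [hstep|apply: run_seq; [hstep|exact: H]].
by lia.
Qed.

(** A push blanks the register, so a constant is loaded by pushing it on stack 2 and popping it
    again: [S1] to continue, [S0] to stop. *)
Definition ploop_body p := PSeq (PPop 0) (PSeq (PPop 0)
  (PIf is0 (PSeq (PPush 2 S0) (PPop 2))
    (PSeq (PPush 0 S1) (PSeq (PPush 0 S1) (PSeq p (PSeq (PPush 2 S1) (PPop 2))))))).
Definition ploop p := PSeq (PPush 2 S1) (PSeq (PPop 2) (PWhile is1 (ploop_body p))).

Lemma comps_loop p (st : nat -> tree) (x : tree) m N :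
  (forall i, i < m -> exists l r y, st i = Node (Node l r) y) ->
  (forall i, i < m -> comps p (st i) (st i.+1) N) -> st m = Node Leaf x ->
  comps (ploop p) (st 0) x ((m + 1) * (N + 20) + 3).
Proof.
move=> Hn Hs Hm y a b c; exists S0.
suff H : forall k, k <= m -> hrun (PWhile is1 (ploop_body p))
    (S1, [:: code (st (m - k)) ++ a; b; c]) ((k + 1) * (N + 20)) (S0, [:: code x ++ a; b; c]).
  have := H m (leqnn m); rewrite subnn => {}H.
  by apply: hrun_weak; [apply: run_seq; [hstep|apply: run_seq; [hstep|exact: H]] | lia].
elim=> [|k IH] le.
  rewrite subn0 Hm /=; apply: hrun_weak.
    apply: run_go => //; last exact: run_stop.
    apply: run_seq; first hstep; apply: run_seq; first hstep.
    by apply: run_if1 => //; apply: run_seq; hstep.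
  by lia.
have lt : m - k.+1 < m by lia.
have [l [r [z E]]] := Hn _ lt; have [x' H] := Hs _ lt B a b c.
rewrite (_ : (m - k.+1).+1 = m - k) ?E in H *; last by lia.
apply: hrun_weak.
  apply: run_go (IH _); [by [] | | by lia].
  apply: run_seq; first hstep; apply: run_seq; first hstep.
  apply: run_if0 => //; apply: run_seq; first hstep; apply: run_seq; first hstep.
  by apply: run_seq; [exact: H | apply: run_seq; hstep].
by nia.
Qed.

(** * Polynomial-time functions on encoded data *)

Class Enc (A : Type) := enc : A -> tree.
#[export] Hint Mode Enc ! : typeclass_instances.
#[export] Instance enc_unit : Enc unit := fun _ => Leaf.
#[export] Instance enc_bool : Enc bool := fun b => if b then Node Leaf Leaf else Leaf.
#[export] Instance enc_prod A C (eA : Enc A) (eC : Enc C) : Enc (A * C) :=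
  fun z => Node (eA z.1) (eC z.2).
#[export] Instance enc_seq A (eA : Enc A) : Enc (seq A) :=
  fix f s := if s is a :: s then Node (eA a) (f s) else Leaf.
#[export] Instance enc_nat : Enc nat :=
  fix f n := if n is n.+1 then Node Leaf (f n) else Leaf.
#[export] Instance enc_sym : Enc sym := fun s => enc_nat (sym_code s).

Arguments enc_seq {A} eA s : simpl never.
Arguments enc_nat n : simpl never.
Arguments enc_prod {A C} eA eC z : simpl never.

Definition tz A {eA : Enc A} (a : A) := tsz (eA a).
Arguments tz {A eA} a.

Lemma tz_gt0 A {eA : Enc A} (a : A) : 0 < tz a. Proof. exact: tsz_gt0. Qed.
Lemma tz_pair A C {eA : Enc A} {eC : Enc C} (z : A * C) : tz z = (tz z.1 + tz z.2).+1.
Proof. exact: tsz_node. Qed.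
Lemma tz_nil A {eA : Enc A} : tz (@nil A) = 1. Proof. by []. Qed.
Lemma tz_cons A {eA : Enc A} (a : A) s : tz (a :: s) = (tz a + tz s).+1.
Proof. exact: tsz_node. Qed.
Lemma tz_nat (n : nat) : tz n = 2 * n + 1.
Proof. by elim: n => // n IH; rewrite /tz /= tsz_node -/(tz n) IH /tsz /=; lia. Qed.

Lemma tz_drop A {eA : Enc A} n (s : seq A) : tz (drop n s) <= tz s.
Proof. by elim: s n => [|a s IH] [|n] //=; rewrite tz_cons; move: (IH n); lia. Qed.
Lemma tz_size A {eA : Enc A} (s : seq A) : size s < tz s.
Proof. by elim: s => //= a s IH; rewrite tz_cons; have := tz_gt0 a; lia. Qed.
Lemma tz_cat A {eA : Enc A} (s t : seq A) : tz (s ++ t) + 1 = tz s + tz t.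
Proof. by elim: s => [|a s IH]; rewrite ?tz_nil ?cat_cons ?tz_cons ?cat0s; lia. Qed.

Section Pb.
Context (A : Type) {eA : Enc A}.
(** The base is at least 3, so constants, sums and products are absorbed by raising the exponent. *)
Definition pb (f : A -> nat) := exists c, forall a, f a <= (tz a + 2) ^ c.

Lemma pb_le f g : (forall a, f a <= g a) -> pb g -> pb f.
Proof. by move=> le [c H]; exists c => a; exact: leq_trans (le a) (H a). Qed.
Lemma pb_const n : pb (fun=> n).
Proof.
exists n => a; apply: leq_trans (ltnW (ltn_expl n (ltnSn 1))) _.
by case: n => // n; rewrite leq_exp2r // addn2.
Qed.
Lemma pb_add f g : pb f -> pb g -> pb (fun a => f a + g a).
Proof.
move=> [c H] [d K]; exists (c + d).+1 => a; set x := tz a + 2.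
apply: (@leq_trans (x ^ (c + d) + x ^ (c + d))).
  apply: leq_add; [apply: leq_trans (H a) _|apply: leq_trans (K a) _];
  by rewrite leq_exp2l /x; lia.
by rewrite expnS addnn -mul2n leq_mul2r /x addn2 orbT.
Qed.
Lemma pb_mul f g : pb f -> pb g -> pb (fun a => f a * g a).
Proof.
by move=> [c H] [d K]; exists (c + d) => a; rewrite expnD leq_mul.
Qed.
Lemma pb_exp f n : pb f -> pb (fun a => f a ^ n).
Proof.
by move=> [c H]; exists (c * n) => a; rewrite expnM; case: n => // n; rewrite leq_exp2r.
Qed.
Lemma pb_tz : pb tz.
Proof. by exists 1 => a; lia. Qed.
End Pb.

Lemma pb_comp A C {eA : Enc A} {eC : Enc C} (g : C -> nat) (h : A -> C) :
  pb g -> pb (fun a => tz (h a)) -> pb (fun a => g (h a)).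
Proof.
move=> [c H] K; apply: (@pb_le _ _ _ (fun a => (tz (h a) + 2) ^ c)) => //.
by apply: pb_exp; apply: pb_add => //; apply: pb_const.
Qed.

(* An inductive wrapper, so that unification cannot confuse types whose encodings agree. *)
Variant FP A C {eA : Enc A} {eC : Enc C} (f : A -> C) : Prop :=
  FPI of exists p, exists2 T, pb T & forall a, comps p (eA a) (eC (f a)) (T a).
Arguments FP {A C eA eC} f.

Section FPcore.
Context (A C D E : Type) {eA : Enc A} {eC : Enc C} {eD : Enc D} {eE : Enc E}.

Lemma FP_ext (f g : A -> C) : f =1 g -> FP f -> FP g.
Proof. by move=> e [[p [T H K]]]; constructor; exists p, T => // a; rewrite -e. Qed.

Lemma FP_size (f : A -> C) : FP f -> pb (fun a => tz (f a)).
Proof.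
move=> [[p [T H K]]]; apply: (@pb_le _ _ _ (fun a => tz a + T a)).
  by move=> a; exact: comps_size (K a).
by apply: pb_add => //; exact: pb_tz.
Qed.

Lemma FP_id : FP (fun a : A => a).
Proof. by constructor; exists PSkip, (fun=> 1) => [|a]; [exact: pb_const | exact: comps_id]. Qed.

Lemma FP_const (c : C) : FP (fun _ : A => c).
Proof.
constructor; exists (PSeq dropt (pushw (code (eC c)))); eexists; last by move=> a; exact: comps_const.
by apply: pb_add; [apply: pb_add; [apply: pb_mul; [|exact: pb_tz]|]|]; apply: pb_const.
Qed.

Lemma FP_comp (f : A -> C) (g : C -> D) : FP f -> FP g -> FP (fun a => g (f a)).
Proof.
move=> Hf [[q [U L M]]]; have Sf := FP_size Hf; case: Hf => [[p [T H K]]].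
constructor; exists (PSeq p q); eexists; last by move=> a; exact: comps_seq (K a) (M (f a)).
by apply: pb_add => //; exact: pb_comp.
Qed.

Lemma FP_pair (f : A -> C) (g : A -> D) : FP f -> FP g -> FP (fun a => (f a, g a)).
Proof.
move=> [[p [T H K]]] [[q [U L M]]]; constructor; exists (ppair p q); eexists.
  2: by move=> a; exact: comps_pair (K a) (M a).
apply: pb_add; last exact: pb_const; apply: pb_mul; first exact: pb_const.
by apply: pb_add => //; apply: pb_add => //; exact: pb_tz.
Qed.

Let pfst_T : pb (fun z : C * D => 100 * tz z + 100).
Proof.
by apply: pb_add; last exact: pb_const; apply: pb_mul; [exact: pb_const|exact: pb_tz].
Qed.

Lemma FP_fst0 : FP (fun z : C * D => z.1).
Proof.
constructor; exists pfst; eexists; first exact: pfst_T.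
by move=> [c d]; apply: comps_weak (comps_fst _ _) _; rewrite tz_pair /tz /=; lia.
Qed.
Lemma FP_snd0 : FP (fun z : C * D => z.2).
Proof.
constructor; exists psnd; eexists; first exact: pfst_T.
by move=> [c d]; apply: comps_weak (comps_snd _ _) _; rewrite tz_pair /tz /=; lia.
Qed.

End FPcore.

Lemma FP_fst A C D {eA : Enc A} {eC : Enc C} {eD : Enc D} (f : A -> C * D) :
  FP f -> FP (fun a => (f a).1).
Proof. by move=> H; exact: (FP_comp H (@FP_fst0 C D eC eD)). Qed.
Lemma FP_snd A C D {eA : Enc A} {eC : Enc C} {eD : Enc D} (f : A -> C * D) :
  FP f -> FP (fun a => (f a).2).
Proof. by move=> H; exact: (FP_comp H (@FP_snd0 C D eC eD)). Qed.

Lemma FP_app2 A C D E {eA : Enc A} {eC : Enc C} {eD : Enc D} {eE : Enc E}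
    (g : C -> D -> E) (f : A -> C) (h : A -> D) :
  FP (fun z => g z.1 z.2) -> FP f -> FP h -> FP (fun a => g (f a) (h a)).
Proof. by move=> Hg Hf Hh; exact: FP_comp (FP_pair Hf Hh) Hg. Qed.

Lemma FP_app3 A C D E F {eA : Enc A} {eC : Enc C} {eD : Enc D} {eE : Enc E} {eF : Enc F}
    (g : C -> D -> E -> F) (f : A -> C) (h : A -> D) (k : A -> E) :
  FP (fun z => g z.1.1 z.1.2 z.2) -> FP f -> FP h -> FP k -> FP (fun a => g (f a) (h a) (k a)).
Proof. by move=> Hg Hf Hh Hk; exact: FP_comp (FP_pair (FP_pair Hf Hh) Hk) Hg. Qed.

(* Retyping an argument or a result along a map that preserves encodings. *)
Lemma FP_recast A A' C C' {eA : Enc A} {eA' : Enc A'} {eC : Enc C} {eC' : Enc C'}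
   (f : A -> C) (g : A' -> C') (i : A' -> A) :
  (forall a, eA (i a) = eA' a) -> (forall a, eC (f (i a)) = eC' (g a)) -> FP f -> FP g.
Proof.
move=> H K [[p [T [c Tc] R]]]; constructor; exists p, (fun a => T (i a)).
  by exists c => a; have := Tc (i a); rewrite /tz H.
by move=> a; rewrite -H -K.
Qed.

(** One rule for all case distinctions: booleans, numbers and lists differ only in what a non-leaf
    encodes, so branching on [Leaf] serves them all. *)
Lemma FP_case A C D N {eA : Enc A} {eC : Enc C} {eD : Enc D} {eN : Enc N}
    (f : A -> C) (h0 : A -> D) (h1 : N * A -> D) (r : A -> D) :
  FP f -> FP h0 -> FP h1 ->
  (forall a, (eC (f a) = Leaf /\ r a = h0 a) \/
     exists n, [/\ eC (f a) = eN n, eN n <> Leaf & r a = h1 (n, a)]) ->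
  FP r.
Proof.
move=> Hf [[p0 [T0 P0 K0]]] [[p1 [T1 [c P1] K1]]] H.
have [[p [T [d P] K]]] := FP_pair Hf (@FP_id A eA); have Sf := FP_size Hf.
constructor; exists (PSeq p (pcase p0 p1)).
exists (fun a => T a + (T0 a + (tz (f a) + tz a + 3) ^ c + 10)).
  apply: pb_add; first by exists d.
  apply: pb_add; last exact: pb_const; apply: pb_add => //; apply: pb_exp.
  by apply: pb_add; last exact: pb_const; apply: pb_add => //; exact: pb_tz.
move=> a; apply: comps_seq (K a) _; rewrite {1}/enc_prod /=.
case: (H a) => [[-> ->]|[n [E nL ->]]].
  by apply: comps_weak (comps_case0 _ (K0 a)) _; lia.
have K' := K1 (n, a); have := P1 (n, a).
rewrite tz_pair /= (_ : tz n = tz (f a)); last by rewrite /tz E.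
rewrite (_ : enc_prod eN eA (n, a) = Node (eC (f a)) (eA a)) in K'; last by rewrite E.
rewrite (_ : (tz (f a) + tz a).+1 + 2 = tz (f a) + tz a + 3); last by lia.
case: (eC (f a)) E K' => [E|l s _ K' le]; first by rewrite -E in nL.
by apply: comps_weak (comps_case1 _ K') _; lia.
Qed.

Ltac pbt := repeat first
  [ exact: pb_const | exact: pb_tz | assumption | apply: pb_add | apply: pb_mul | apply: pb_exp
  | apply: FP_size; assumption ].

(** The loop state is the remaining list with the parameter and the accumulator. A round is
    polynomial in the accumulator, which would compound over the rounds; [S] bounds all intermediate
    accumulators to prevent this. *)
Lemma FP_fold A R E {eA : Enc A} {eR : Enc R} {eE : Enc E}
    (l : A -> seq E) (r0 : A -> R) (F : A -> R -> E -> R) (S : A -> nat) :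
  FP l -> FP r0 -> FP (fun z : A * R * E => F z.1.1 z.1.2 z.2) -> pb S ->
  (forall a k, tz (foldl (F a) (r0 a) (take k (l a))) <= S a) ->
  FP (fun a => foldl (F a) (r0 a) (l a)).
Proof.
move=> Hl Hr HF PS HS.
have Z : FP (fun z : (E * seq E) * (A * R) => z) by exact: FP_id.
have HG : FP (fun z : (E * seq E) * (A * R) => (z.1.2, (z.2.1, F z.2.1 z.2.2 z.1.1))).
  apply: FP_pair; first exact: FP_snd (FP_fst Z).
  apply: FP_pair; first exact: FP_fst (FP_snd Z).
  apply: (FP_app3 HF (FP_fst (FP_snd Z)) (FP_snd (FP_snd Z)) (FP_fst (FP_fst Z))).
have [[pG [TG [c PG] KG]]] := HG.
have Hi : FP (fun a => (l a, (a, r0 a))).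
  by apply: FP_pair => //; apply: FP_pair => //; exact: FP_id.
have Sl := FP_size Hl; case: Hi => [[p0 [T0 P0 K0]]].
(* Time of one round: remaining list, parameter and accumulator all stay within the base of this
   power. *)
have [N NE] : {N | forall a, N a = (tz (l a) + tz a + S a + 4) ^ c} by eexists.
constructor; exists (PSeq p0 (PSeq (ploop pG) psnd)).
exists (fun a => T0 a + ((tz (l a) + 1) * (N a + 20) + 3 + (100 * (tz a + S a) + 100))).
  have PN : pb N by apply: (pb_le (g := fun a => (tz (l a) + tz a + S a + 4) ^ c)) => [a|]; [rewrite NE | pbt].
  by pbt.
move=> a; apply: comps_seq (K0 a) _.
pose st i := enc_prod (enc_seq eE) (enc_prod eA eR)
  (drop i (l a), (a, foldl (F a) (r0 a) (take i (l a)))).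
have L : comps (ploop pG) (st 0) (enc_prod eA eR (a, foldl (F a) (r0 a) (l a)))
   ((size (l a) + 1) * (N a + 20) + 3).
  apply: (comps_loop (st := st)).
  - move=> i lt; case D : (drop i (l a)) => [|e s].
      by have := congr1 size D; rewrite size_drop /=; lia.
    by rewrite /st D; do 3 eexists.
  - move=> i lt; case D : (drop i (l a)) => [|e s].
      by have := congr1 size D; rewrite size_drop /=; lia.
    set r := foldl (F a) (r0 a) (take i (l a)).
    have E0 : st i = enc_prod (enc_prod eE (enc_seq eE)) (enc_prod eA eR) ((e, s), (a, r)).
      by rewrite /st D.
    have E1 : st i.+1 = enc_prod (enc_seq eE) (enc_prod eA eR) (s, (a, F a r e)).
      have -> : s = drop i.+1 (l a) by rewrite -add1n -drop_drop D /= drop0.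
      have -> : e = nth e (l a) i by rewrite -[X in nth _ _ X]addn0 -nth_drop D.
      by rewrite /st (take_nth e lt) foldl_rcons.
    rewrite E0 E1; apply: comps_weak (KG ((e, s), (a, r))) _.
    apply: leq_trans (PG _) _; rewrite NE; case: (posnP c) => [->//|c0].
    rewrite leq_exp2r // !tz_pair /=.
    have := HS a i; have := @tz_drop _ eE i (l a); rewrite D tz_cons -/r; lia.
  by rewrite /st drop_size take_size.
rewrite -[X in comps _ X](_ : st 0 = _); last by rewrite /st drop0 take0.
apply: comps_weak (comps_seq L (comps_snd _ _)) _.
have := HS a (size (l a)); rewrite take_size /tz => h.
have lt := @tz_size _ eE (l a); rewrite /tz in lt; rewrite /= leq_add //; last by lia.
by rewrite leq_add2r leq_mul2r; apply/orP; right; lia.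
Qed.

(** If a round adds an amount depending only on the parameter and the element, sizes form a sum
    instead of an iterated composition, which yields a polynomial [S]. *)
Lemma FP_fold_add A R E {eA : Enc A} {eR : Enc R} {eE : Enc E}
    (l : A -> seq E) (r0 : A -> R) (F : A -> R -> E -> R) (q : A * E -> nat) :
  FP l -> FP r0 -> FP (fun z : A * R * E => F z.1.1 z.1.2 z.2) -> pb q ->
  (forall a r e, tz (F a r e) <= tz r + q (a, e)) ->
  FP (fun a => foldl (F a) (r0 a) (l a)).
Proof.
move=> Hl Hr HF [c Pq] H.
apply: (@FP_fold _ _ _ _ _ _ l r0 F
   (fun a => tz (r0 a) + tz (l a) * (tz a + tz (l a) + 3) ^ c)) => //.
  by pbt.
move=> a k.
have {H}H r e : tz (F a r e) <= tz r + (tz a + tz e + 3) ^ c.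
  apply: leq_trans (H a r e) _; rewrite leq_add2l; apply: leq_trans (Pq _) _.
  by case: (posnP c) => [->//|c0]; rewrite leq_exp2r // tz_pair /=; lia.
have G : forall s r, tz (foldl (F a) r s) <= tz r + size s * (tz a + tz s + 3) ^ c.
  elim=> [|e s IH] r /=; first lia.
  have := IH (F a r e); have := H r e; rewrite tz_cons mulSn.
  have : (tz a + tz e + 3) ^ c <= (tz a + (tz e + tz s).+1 + 3) ^ c.
    by case: (posnP c) => [->//|c0]; rewrite leq_exp2r //; lia.
  have : (tz a + tz s + 3) ^ c <= (tz a + (tz e + tz s).+1 + 3) ^ c.
    by case: (posnP c) => [->//|c0]; rewrite leq_exp2r //; lia.
  set X := (tz a + tz s + 3) ^ c; set Y := (tz a + tz e + 3) ^ c.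
  move=> XW YW H1 H2; apply: leq_trans H2 _.
  have := leq_mul (leqnn (size s)) XW; move: YW H1; lia.
have tt : tz (take k (l a)) <= tz (l a).
  rewrite -{2}(cat_take_drop k (l a)).
  have := @tz_cat _ eE (take k (l a)) (drop k (l a)).
  by have := @tz_gt0 _ (enc_seq eE) (drop k (l a)); lia.
apply: leq_trans (G _ _) _; rewrite leq_add2l leq_mul //.
  by rewrite size_take_min; have := @tz_size _ eE (l a); lia.
by case: (posnP c) => [->//|c0]; rewrite leq_exp2r //; lia.
Qed.

Ltac fpp := solve [repeat first
  [ exact: FP_id | exact: FP_fst0 | exact: FP_snd0 | exact: FP_const | assumption
  | apply: FP_pair | apply: FP_fst | apply: FP_snd ]].

(** * Case analysis, lists and unary arithmetic *)

Section Cases.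
Context (A C : Type) {eA : Enc A} {eC : Enc C}.

Lemma FP_if (b : A -> bool) (f g : A -> C) :
  FP b -> FP f -> FP g -> FP (fun a => if b a then f a else g a).
Proof.
move=> Hb Hf Hg.
have H1 : FP (fun z : bool * A => f z.2) by apply: FP_comp Hf; fpp.
apply: (FP_case Hb Hg H1) => a.
case: (b a); [right; exists true | left] => //.
Qed.

Lemma FP_match_seq E {eE : Enc E} (l : A -> seq E) (f0 : A -> C) (f1 : A -> E -> seq E -> C) :
  FP l -> FP f0 -> FP (fun z : A * E * seq E => f1 z.1.1 z.1.2 z.2) ->
  FP (fun a => if l a is e :: s then f1 a e s else f0 a).
Proof.
move=> Hl H0 H1.
have I : FP (fun z : (E * seq E) * A => z) by exact: FP_id.
have H2 : FP (fun z : (E * seq E) * A => f1 z.2 z.1.1 z.1.2).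
  exact: (FP_app3 H1 (FP_snd I) (FP_fst (FP_fst I)) (FP_snd (FP_fst I))).
apply: (FP_case Hl H0 H2) => a.
by case: (l a) => [|e s]; [left | right; exists (e, s)].
Qed.

Lemma FP_match_nat (l : A -> nat) (f0 : A -> C) (f1 : A -> nat -> C) :
  FP l -> FP f0 -> FP (fun z : A * nat => f1 z.1 z.2) ->
  FP (fun a => if l a is n.+1 then f1 a n else f0 a).
Proof.
move=> Hl H0 H1.
have I : FP (fun z : (unit * nat) * A => z) by exact: FP_id.
have H2 : FP (fun z : (unit * nat) * A => f1 z.2 z.1.2).
  exact: (FP_app2 H1 (FP_snd I) (FP_snd (FP_fst I))).
apply: (FP_case Hl H0 H2) => a.
by case: (l a) => [|e]; [left | right; exists (tt, e)].
Qed.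

(** A unary number and a list of [tt] have the same code, so iteration becomes a fold over such a
    list. *)
Lemma FP_units (l : A -> nat) : FP l -> FP (fun a => nseq (l a) tt).
Proof.
apply: (FP_recast (i := id)) => // a /=.
by elim: (l a) => // n IH; exact: (congr1 (Node Leaf) IH).
Qed.

Lemma FP_iter (n : A -> nat) (r0 : A -> C) (F : A -> C -> C) (S : A -> nat) :
  FP n -> FP r0 -> FP (fun z : A * C => F z.1 z.2) -> pb S ->
  (forall a k, k <= n a -> tz (iter k (F a) (r0 a)) <= S a) ->
  FP (fun a => iter (n a) (F a) (r0 a)).
Proof.
move=> Hn H0 HF PS HS.
have E : forall a k r, foldl (fun r (_ : unit) => F a r) r (nseq k tt) = iter k (F a) r.
  by move=> a; elim=> // k IH r; rewrite iterSr -IH.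
apply: (FP_ext (f := fun a => foldl (fun r (_ : unit) => F a r) (r0 a) (nseq (n a) tt))).
  by move=> a; rewrite E.
apply: (@FP_fold _ _ _ _ _ _ _ _ (fun a r _ => F a r) S) => //.
- exact: FP_units.
- by apply: (FP_app2 HF); fpp.
- move=> a k; have -> : take k (nseq (n a) tt) = nseq (minn k (n a)) tt.
    by elim: k (n a) => [|k IH] [|m] //=; rewrite IH minnSS.
  by rewrite E; apply: HS; lia.
Qed.

Lemma FP_iter_add (n : A -> nat) (r0 : A -> C) (F : A -> C -> C) (q : A -> nat) :
  FP n -> FP r0 -> FP (fun z : A * C => F z.1 z.2) -> pb q ->
  (forall a r, tz (F a r) <= tz r + q a) ->
  FP (fun a => iter (n a) (F a) (r0 a)).
Proof.
move=> Hn H0 HF Pq H; apply: (FP_iter (S := fun a => tz (r0 a) + tz (n a) * q a)) => //.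
  by pbt.
move=> a k le; apply: (@leq_trans (tz (r0 a) + k * q a)).
  by elim: k {le} => [|k IH]; rewrite ?addn0 //= mulSn; have := H a (iter k (F a) (r0 a)); lia.
by rewrite leq_add2l leq_mul2r; apply/orP; right; rewrite tz_nat; lia.
Qed.
End Cases.

Section L1.
Context (A E R : Type) {eA : Enc A} {eE : Enc E} {eR : Enc R}.

Lemma FP_cons (e : A -> E) (s : A -> seq E) : FP e -> FP s -> FP (fun a => e a :: s a).
Proof. by move=> He Hs; apply: (FP_recast (i := id)) (FP_pair He Hs). Qed.

Lemma FP_succ (n : A -> nat) : FP n -> FP (fun a => (n a).+1).
Proof. by move=> Hn; apply: (FP_recast (i := id)) (FP_pair (FP_const tt) Hn). Qed.

Lemma FP_pred (n : A -> nat) : FP n -> FP (fun a => (n a).-1).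
Proof.
move=> Hn; apply: (FP_ext (f := fun a => if n a is m.+1 then m else 0)).
  by move=> a; case: (n a).
by apply: (FP_match_nat (f1 := fun _ m => m)) => //; fpp.
Qed.

Lemma FP_behead (s : A -> seq E) : FP s -> FP (fun a => behead (s a)).
Proof.
move=> Hs; apply: (FP_ext (f := fun a => if s a is e :: t then t else [::])).
  by move=> a; case: (s a).
by apply: (FP_match_seq (f1 := fun _ _ t => t)) => //; fpp.
Qed.

Lemma FP_head (d : A -> E) (s : A -> seq E) : FP d -> FP s -> FP (fun a => head (d a) (s a)).
Proof.
move=> Hd Hs; apply: (FP_ext (f := fun a => if s a is e :: t then e else d a)).
  by move=> a; case: (s a).
by apply: (FP_match_seq (f1 := fun _ e _ => e)) => //; fpp.
Qed.

End L1.

Section L1b.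
Context (A E : Type) {eA : Enc A} {eE : Enc E}.

Lemma FP_nth (d : A -> E) (s : A -> seq E) (n : A -> nat) :
  FP d -> FP s -> FP n -> FP (fun a => nth (d a) (s a) (n a)).
Proof.
move=> Hd Hs Hn.
apply: (FP_ext (f := fun a => head (d a) (iter (n a) behead (s a)))).
  move=> a; rewrite -nth0 -[n a in RHS]addn0.
  elim: (n a) (s a) => // k IH [|e t]; rewrite iterSr IH //=.
  by rewrite !nth_nil.
apply: FP_head => //.
apply: (FP_iter_add (F := fun _ s => behead s) (q := fun=> 0)) => //.
- by apply: FP_behead; fpp.
- exact: pb_const.
- by move=> a [|e r] //=; rewrite tz_cons; lia.
Qed.

Lemma FP_rev (s : A -> seq E) : FP s -> FP (fun a => rev (s a)).
Proof.
move=> Hs; apply: (FP_ext (f := fun a => foldl (fun r e => e :: r) [::] (s a))).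
  move=> a; rewrite /rev; elim: (s a) [::] => //= e t IH u; exact: IH.
apply: (FP_fold_add (F := fun _ r e => e :: r) (q := fun z => tz z)) => //; try by fpp.
- by apply: FP_cons; fpp.
- exact: pb_tz.
- by move=> a r e; rewrite tz_pair tz_cons /=; lia.
Qed.
End L1b.

Section L2.
Context (A E R : Type) {eA : Enc A} {eE : Enc E} {eR : Enc R}.

Lemma FP_foldr_add (F : A -> E -> R -> R) (l : A -> seq E) (r0 : A -> R) (q : A * E -> nat) :
  FP l -> FP r0 -> FP (fun z : A * E * R => F z.1.1 z.1.2 z.2) -> pb q ->
  (forall a e r, tz (F a e r) <= tz r + q (a, e)) ->
  FP (fun a => foldr (F a) (r0 a) (l a)).
Proof.
move=> Hl Hr HF Pq H.
apply: (FP_ext (f := fun a => foldl (fun r e => F a e r) (r0 a) (rev (l a)))).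
  by move=> a; rewrite foldl_rev.
apply: (FP_fold_add (F := fun a r e => F a e r) (q := q)) => //; first exact: FP_rev.
by apply: (FP_app3 HF); fpp.
Qed.

End L2.

Section L2b.
Context (A E R : Type) {eA : Enc A} {eE : Enc E} {eR : Enc R}.

Lemma FP_map (f : A -> E -> R) (l : A -> seq E) :
  FP l -> FP (fun z : A * E => f z.1 z.2) -> FP (fun a => [seq f a e | e <- l a]).
Proof.
move=> Hl Hf; apply: (FP_ext (f := fun a => foldr (fun e r => f a e :: r) [::] (l a))).
  by move=> a.
apply: (FP_foldr_add (F := fun a e r => f a e :: r) (q := fun z => tz (f z.1 z.2) + 1)); try fpp.
- by apply: FP_cons; [apply: FP_comp Hf; fpp | fpp].
- by apply: pb_add; [exact: FP_size | exact: pb_const].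
- by move=> a e r; rewrite tz_cons /=; lia.
Qed.

Lemma FP_filter (p : A -> E -> bool) (l : A -> seq E) :
  FP l -> FP (fun z : A * E => p z.1 z.2) -> FP (fun a => [seq e <- l a | p a e]).
Proof.
move=> Hl Hf.
apply: (FP_ext (f := fun a => foldr (fun e r => if p a e then e :: r else r) [::] (l a))).
  by move=> a.
apply: (FP_foldr_add (F := fun a e r => if p a e then e :: r else r) (q := fun z => tz z)); try fpp.
- by apply: FP_if; [apply: FP_comp Hf; fpp | apply: FP_cons; fpp | fpp].
- exact: pb_tz.
- by move=> a e r; rewrite tz_pair /=; case: (p _ _); rewrite ?tz_cons; lia.
Qed.

Lemma FP_cat (s t : A -> seq E) : FP s -> FP t -> FP (fun a => s a ++ t a).
Proof.
move=> Hs Ht; apply: (FP_ext (f := fun a => foldr cons (t a) (s a))).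
  by move=> a; elim: (s a) => //= e u ->.
apply: (FP_foldr_add (F := fun _ => cons) (q := fun z => tz z)); try fpp.
- by apply: FP_cons; fpp.
- exact: pb_tz.
- by move=> a e r; rewrite tz_pair tz_cons /=; lia.
Qed.

Lemma FP_sizes (s : A -> seq E) : FP s -> FP (fun a => size (s a)).
Proof.
move=> Hs; apply: (FP_ext (f := fun a => foldr (fun _ n => n.+1) 0 (s a))).
  by move=> a; elim: (s a) => //= e u ->.
apply: (FP_foldr_add (F := fun _ _ n => n.+1) (q := fun=> 2)); try fpp.
- by apply: FP_succ; fpp.
- exact: pb_const.
- by move=> a e r; rewrite !tz_nat; lia.
Qed.
End L2b.

Section L3.
Context (A E R : Type) {eA : Enc A} {eE : Enc E} {eR : Enc R}.

Lemma FP_flatten (s : A -> seq (seq E)) : FP s -> FP (fun a => flatten (s a)).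
Proof.
move=> Hs; apply: (FP_foldr_add (F := fun _ => cat) (q := fun z => tz z)); try fpp.
- by apply: FP_cat; fpp.
- exact: pb_tz.
- by move=> a e r; have := @tz_cat _ eE e r; rewrite tz_pair /=; lia.
Qed.

Lemma FP_addn (m n : A -> nat) : FP m -> FP n -> FP (fun a => m a + n a).
Proof.
move=> Hm Hn; apply: (FP_ext (f := fun a => iter (m a) S (n a))).
  by move=> a; elim: (m a) => //= k ->.
apply: (FP_iter_add (F := fun _ n => n.+1) (q := fun=> 2)); try fpp.
- by apply: FP_succ; fpp.
- exact: pb_const.
- by move=> a r; rewrite !tz_nat; lia.
Qed.

Lemma FP_subn (m n : A -> nat) : FP m -> FP n -> FP (fun a => m a - n a).
Proof.
move=> Hm Hn; apply: (FP_ext (f := fun a => iter (n a) predn (m a))).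
  by move=> a; rewrite -subn_pred_iter || (elim: (n a) => [|k IH]; rewrite ?subn0 ?subnS //= IH).
apply: (FP_iter_add (F := fun _ n => n.-1) (q := fun=> 0)); try fpp.
- by apply: FP_pred; fpp.
- exact: pb_const.
- by move=> a r; rewrite !tz_nat; lia.
Qed.

Lemma FP_eq0 (n : A -> nat) : FP n -> FP (fun a => n a == 0).
Proof.
move=> Hn; apply: (FP_ext (f := fun a => if n a is m.+1 then false else true)).
  by move=> a; case: (n a).
by apply: (FP_match_nat (f1 := fun _ _ => false)) => //; fpp.
Qed.

Lemma FP_andb (b c : A -> bool) : FP b -> FP c -> FP (fun a => b a && c a).
Proof. by move=> Hb Hc; apply: FP_if => //; fpp. Qed.
Lemma FP_negb (b : A -> bool) : FP b -> FP (fun a => ~~ b a).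
Proof. by move=> Hb; apply: FP_if => //; fpp. Qed.
End L3.

Section L4.
Context (A : Type) {eA : Enc A}.

Lemma FP_muln (m n : A -> nat) : FP m -> FP n -> FP (fun a => m a * n a).
Proof.
move=> Hm Hn; apply: (FP_ext (f := fun a => iter (m a) (addn (n a)) 0)).
  by move=> a; rewrite iter_addn addn0 mulnC.
have Hn' : FP (fun z : A * nat => n z.1) by apply: FP_comp Hn; fpp.
apply: (FP_iter_add (F := fun a r => n a + r) (q := fun a => tz (n a))); try fpp.
- by apply: FP_addn; fpp.
- exact: FP_size.
- by move=> a r; rewrite !tz_nat; lia.
Qed.

Lemma FP_expn (m : A -> nat) (k : nat) : FP m -> FP (fun a => m a ^ k).
Proof.
move=> Hm; elim: k => [|k IH]; first exact: FP_const.
by apply: (FP_ext (f := fun a => m a * m a ^ k)) => [a|]; [rewrite expnS | apply: FP_muln].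
Qed.

End L4.

Section L5.
Context (A : Type) {eA : Enc A}.

Lemma FP_leq (m n : A -> nat) : FP m -> FP n -> FP (fun a => m a <= n a).
Proof. by move=> Hm Hn; apply: FP_eq0; apply: FP_subn. Qed.

Lemma FP_eqn (m n : A -> nat) : FP m -> FP n -> FP (fun a => m a == n a).
Proof.
move=> Hm Hn; apply: (FP_ext (f := fun a => (m a <= n a) && (n a <= m a))).
  by move=> a; rewrite eqn_leq.
by apply: FP_andb; apply: FP_leq.
Qed.

End L5.

(** * Binary arithmetic *)

Lemma FP_foldr A E R {eA : Enc A} {eE : Enc E} {eR : Enc R}
    (F : A -> E -> R -> R) (l : A -> seq E) (r0 : A -> R) (S : A -> nat) :
  FP l -> FP r0 -> FP (fun z : A * E * R => F z.1.1 z.1.2 z.2) -> pb S ->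
  (forall a k, tz (foldr (F a) (r0 a) (drop k (l a))) <= S a) ->
  FP (fun a => foldr (F a) (r0 a) (l a)).
Proof.
move=> Hl Hr HF PS H.
apply: (FP_ext (f := fun a => foldl (fun r e => F a e r) (r0 a) (rev (l a)))).
  by move=> a; rewrite foldl_rev.
apply: (FP_fold (F := fun a r e => F a e r) (S := S)) => //; first exact: FP_rev.
  by apply: (FP_app3 HF); fpp.
by move=> a k; rewrite take_rev foldl_rev.
Qed.

Lemma FP_bool1 T {eT : Enc T} (f : bool -> T) : FP f.
Proof.
apply: (FP_ext (f := fun b => if b then f true else f false)); first by case.
by apply: FP_if; fpp.
Qed.
Lemma FP_bool2 T {eT : Enc T} (f : bool * bool -> T) : FP f.
Proof.
apply: (FP_ext (f := fun z => if z.1 then (if z.2 then f (true, true) else f (true, false))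
   else (if z.2 then f (false, true) else f (false, false)))); first by case=> [[] []].
by do ![apply: FP_if]; fpp.
Qed.
Lemma FP_bool3 T {eT : Enc T} (f : bool * (bool * bool) -> T) : FP f.
Proof.
have H b : FP (fun z : bool * (bool * bool) => f (b, z.2)).
  by apply: FP_comp (FP_bool2 (fun z => f (b, z))); fpp.
apply: (FP_ext (f := fun z => if z.1 then f (true, z.2) else f (false, z.2))); first by case=> [[]].
by apply: FP_if => //; fpp.
Qed.

Lemma FP_iota A {eA : Enc A} (n : A -> nat) : FP n -> FP (fun a => iota 0 (n a)).
Proof.
move=> Hn; apply: (FP_ext (f := fun a => rev (iter (n a) (fun s : seq nat => size s :: s) [::]))).
  move=> a; elim: (n a) => // k IH.
  rewrite -[in RHS]addn1 iotaD /= cats1 rev_cons IH; congr rcons.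
  by rewrite -(size_rev (iter _ _ _)) IH size_iota.
apply: FP_rev; apply: (FP_iter (F := fun _ (s : seq nat) => size s :: s) (S := fun a => n a * (2 * n a + 3) + 1)) => //; try fpp.
- by apply: FP_cons; [apply: FP_sizes|]; fpp.
- have Pn : pb n by apply: (pb_le (g := fun a => tz (n a))) => [a|]; [rewrite tz_nat; lia | exact: FP_size].
  by pbt.
- move=> a k le; have [s1 s2] : size (iter k (fun s : seq nat => size s :: s) [::]) = k /\
     tz (iter k (fun s : seq nat => size s :: s) [::]) <= k * (2 * k + 3) + 1.
    elim: k {le} => // k [IH1 IH2] /=; rewrite IH1; split=> //.
    by rewrite tz_cons tz_nat; nia.
  by apply: leq_trans s2 _; nia.
Qed.

(** Little-endian, with high zeros allowed; they are stripped only where the length or the exact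
    digits matter. *)
Definition bv (s : seq bool) : nat := foldr (fun (b : bool) n => b + n.*2) 0 s.

Lemma bv_nseq n : bv (nseq n false) = 0.
Proof. by elim: n => //= n ->. Qed.
Lemma bv_cat s t : bv (s ++ t) = bv s + 2 ^ size s * bv t.
Proof. by elim: s => [|b s IH] /=; rewrite ?mul1n // IH expnS; lia. Qed.
Lemma bv_lt s : bv s < 2 ^ size s.
Proof. by elim: s => //= b s IH; rewrite expnS; case: b; lia. Qed.

Lemma tz_bool (b : bool) : tz b = 1 + 2 * b. Proof. by case: b. Qed.
Lemma tz_bits (s : seq bool) : tz s <= 4 * size s + 1.
Proof. elim: s => [|b s IH]; rewrite ?tz_nil ?tz_cons //=; by rewrite tz_bool; case: b; lia. Qed.

Definition padzip (x y : seq bool) : seq (bool * bool) :=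
  [seq (nth false x i, nth false y i) | i <- iota 0 (maxn (size x) (size y))].

Lemma bv_nth x n : size x <= n -> bv [seq nth false x i | i <- iota 0 n] = bv x.
Proof.
move=> le; rewrite -(subnKC le) iotaD map_cat -/(mkseq _ _) mkseq_nth bv_cat.
rewrite (_ : [seq _ | i <- _] = nseq (n - size x) false) ?bv_nseq ?muln0 ?addn0 //.
apply: (@eq_from_nth _ false); rewrite size_map size_iota ?size_nseq // => i lt.
by rewrite (nth_map 0) ?size_iota // nth_iota // nth_nseq lt nth_default //; lia.
Qed.

Lemma padzipP x y : [/\ bv (unzip1 (padzip x y)) = bv x, bv (unzip2 (padzip x y)) = bv y
  & size (padzip x y) = maxn (size x) (size y)].
Proof.
by rewrite /unzip1 /unzip2 -!map_comp size_map size_iota !bv_nth //; lia.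
Qed.

Lemma FP_maxn A {eA : Enc A} (m n : A -> nat) : FP m -> FP n -> FP (fun a => maxn (m a) (n a)).
Proof.
move=> Hm Hn; apply: (FP_ext (f := fun a => m a + (n a - m a))) => [a|]; first lia.
by apply: FP_addn => //; exact: FP_subn.
Qed.

Lemma FP_padzip A {eA : Enc A} (x y : A -> seq bool) : FP x -> FP y ->
  FP (fun a => padzip (x a) (y a)).
Proof.
move=> Hx Hy.
apply: (FP_map (f := fun a i => (nth false (x a) i, nth false (y a) i))).
  by apply: FP_iota; apply: FP_maxn; apply: FP_sizes.
have H (s : A -> seq bool) : FP s -> FP (fun z : A * nat => nth false (s z.1) z.2).
  by move=> Hs; apply: FP_nth; [fpp | apply: FP_comp Hs; fpp | fpp].
by apply: FP_pair; exact: H.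
Qed.

(** An automaton with one bit of state reading two words at once; the bit is the carry of an
    addition or the borrow of a subtraction. *)
Fixpoint scan (f : bool -> bool * bool -> bool * bool) c p : bool * seq bool :=
  if p is x :: p then
    let: (c', b) := f c x in let: (c'', s) := scan f c' p in (c'', b :: s)
  else (c, [::]).

Lemma FP_scan A {eA : Enc A} f c (p : A -> seq (bool * bool)) :
  FP p -> FP (fun a => scan f c (p a)).
Proof.
move=> Hp.
pose g := fun (r : bool * seq bool) x => ((f r.1 x).1, (f r.1 x).2 :: r.2).
have E : forall l r, foldl g r l = ((scan f r.1 l).1, catrev (scan f r.1 l).2 r.2).
  elim=> [|x l IH] [c0 s] //=; rewrite IH /=.
  by case: (f c0 x) => c1 b /=; case: (scan f c1 l).
apply: (FP_ext (f := fun a => ((foldl g (c, [::]) (p a)).1, rev (foldl g (c, [::]) (p a)).2))).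
  by move=> a; rewrite E /= -/(rev _) revK; case: (scan _ _ _).
have H : FP (fun a => foldl g (c, [::]) (p a)).
  apply: (FP_fold_add (F := fun _ => g) (q := fun=> 10)) => //; try fpp.
  - have H3 : FP (fun z : A * (bool * seq bool) * (bool * bool) => f z.1.2.1 z.2).
      by apply: (FP_app2 (FP_bool3 (fun z => f z.1 z.2))); fpp.
    apply: FP_pair; first exact: (FP_fst H3).
    by apply: FP_cons; [exact: (FP_snd H3) | fpp].
  - exact: pb_const.
  - move=> a [c0 s] x; rewrite !tz_pair tz_cons /=.
    by rewrite !tz_bool; case: (f c0 x) => [[] []] /=; lia.
apply: FP_pair; first exact: FP_fst H.
by apply: FP_rev; exact: FP_snd H.
Qed.

Lemma size_scan f c p : size (scan f c p).2 = size p.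
Proof.
elim: p c => //= x p IH c; case: (f c x) => c' b; have := IH c'.
by case: (scan f c' p) => c'' s /= ->.
Qed.

Definition addf c (z : bool * bool) : bool * bool :=
  ((z.1 && z.2) || (c && (z.1 || z.2)), z.1 (+) z.2 (+) c).
Definition subf c (z : bool * bool) : bool * bool :=
  ((~~ z.1 && z.2) || (c && (~~ z.1 || z.2)), z.1 (+) z.2 (+) c).

Definition badd x y := let: (c, s) := scan addf false (padzip x y) in rcons s c.
Definition bsub x y := scan subf false (padzip x y).

Lemma scan_addf c p : bv (scan addf c p).2 + 2 ^ size p * (scan addf c p).1 =
  bv (unzip1 p) + bv (unzip2 p) + c.
Proof.
elim: p c => [|[a b] p IH] c /=; first by rewrite mul1n.
set c' := (_ || _); have := IH c'; case: (scan addf c' p) => c'' s /= H.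
rewrite expnS.
move: H {IH}.
rewrite {}/c'; case: a; case: b; case: c; rewrite /= ?addn0; lia.
Qed.

Lemma scan_subf c p : bv (scan subf c p).2 + bv (unzip2 p) + c =
  bv (unzip1 p) + 2 ^ size p * (scan subf c p).1.
Proof.
elim: p c => [|[a b] p IH] c /=; first by rewrite mul1n.
set c' := (_ || _); have := IH c'; case: (scan subf c' p) => c'' s /= H.
rewrite expnS.
move: H {IH}.
rewrite {}/c'; case: a; case: b; case: c; rewrite /= ?addn0; lia.
Qed.

Lemma bv_rcons s b : bv (rcons s b) = bv s + 2 ^ size s * b.
Proof. by rewrite -cats1 bv_cat /= addn0. Qed.

Lemma baddP x y : bv (badd x y) = bv x + bv y.
Proof.
have [E1 E2 E3] := padzipP x y.
have := scan_addf false (padzip x y); have := size_scan addf false (padzip x y).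
rewrite /badd; case: (scan _ _ _) => c s /= ss; rewrite bv_rcons ss E1 E2; lia.
Qed.
Lemma size_badd x y : size (badd x y) = (maxn (size x) (size y)).+1.
Proof.
have [_ _ E3] := padzipP x y; have := size_scan addf false (padzip x y).
by rewrite /badd; case: (scan _ _ _) => c s /= ss; rewrite size_rcons ss E3.
Qed.

(** The final borrow doubles as the order test. *)
Lemma bsubP x y : (bsub x y).1 = (bv x < bv y) /\
  (bv y <= bv x -> bv (bsub x y).2 = bv x - bv y).
Proof.
have [E1 E2 E3] := padzipP x y.
have := scan_subf false (padzip x y); have := size_scan subf false (padzip x y).
rewrite /bsub; case: (scan _ _ _) => c s /= ss; rewrite E1 E2 -ss => e.
have := bv_lt s; case: c e => e; split; lia.
Qed.
Lemma size_bsub x y : size (bsub x y).2 = maxn (size x) (size y).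
Proof. by have [_ _ E3] := padzipP x y; rewrite size_scan. Qed.

Section FPadd.
Context (A : Type) {eA : Enc A}.
Lemma FP_badd (x y : A -> seq bool) : FP x -> FP y -> FP (fun a => badd (x a) (y a)).
Proof.
move=> Hx Hy; have H := FP_scan addf false (FP_padzip Hx Hy).
apply: (FP_ext (f := fun a => (scan addf false (padzip (x a) (y a))).2 ++
  [:: (scan addf false (padzip (x a) (y a))).1])).
  by move=> a; rewrite /badd; case: (scan _ _ _) => c s; rewrite cats1.
by apply: FP_cat; [exact: FP_snd H | apply: FP_cons; [exact: FP_fst H | fpp]].
Qed.
Lemma FP_bsub (x y : A -> seq bool) : FP x -> FP y -> FP (fun a => bsub (x a) (y a)).
Proof. by move=> Hx Hy; apply: FP_scan; apply: FP_padzip. Qed.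
End FPadd.

Definition bmul x y :=
  foldr (fun (b : bool) acc => if b then badd (false :: acc) y else false :: acc) [::] x.

Lemma bmulP x y : bv (bmul x y) = bv x * bv y.
Proof.
elim: x => //= b x IH; rewrite /bmul /= -/(bmul x y).
by case: b; rewrite ?baddP /= IH; lia.
Qed.
(** Each bit of [x] costs a shift and possibly a carry, while [y] enters once. Hence repeated
    multiplication by short left factors lengthens the result only linearly. *)
Lemma size_bmul x y : size (bmul x y) <= 2 * size x + size y.
Proof.
elim: x => //= b x IH; rewrite /bmul /= -/(bmul x y).
by case: b; rewrite ?size_badd /=; lia.
Qed.

Lemma pb_size A E {eA : Enc A} {eE : Enc E} (x : A -> seq E) : FP x -> pb (fun a => size (x a)).
Proof.
move=> Hx; apply: (pb_le (g := fun a => tz (x a))) => [a|]; last exact: FP_size.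
exact: ltnW (tz_size _).
Qed.

Lemma FP_bmul A {eA : Enc A} (x y : A -> seq bool) : FP x -> FP y -> FP (fun a => bmul (x a) (y a)).
Proof.
move=> Hx Hy; have Sx := pb_size Hx; have Sy := pb_size Hy.
apply: (FP_foldr (F := fun a b acc => if b then badd (false :: acc) (y a) else false :: acc)
   (S := fun a => 4 * (2 * size (x a) + size (y a)) + 1)) => //; try fpp.
- have H : FP (fun z : A * bool * seq bool => false :: z.2) by apply: FP_cons; fpp.
  apply: FP_if; [fpp | | exact: H]; apply: FP_badd => //.
  by apply: FP_comp Hy; fpp.
- by pbt.
- move=> a k; apply: leq_trans (tz_bits _) _; have := size_bmul (drop k (x a)) (y a).
  by rewrite /bmul size_drop; lia.
Qed.

Definition bnorm (x : seq bool) :=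
  foldr (fun (b : bool) s => if s is _ :: _ then b :: s else if b then [:: true] else [::]) [::] x.

Arguments bnorm : simpl never.
Lemma bnorm_cons b x : bnorm (b :: x) =
  if bnorm x is _ :: _ then b :: bnorm x else if b then [:: true] else [::].
Proof. by []. Qed.

Lemma bnormP x : bv (bnorm x) = bv x.
Proof.
elim: x => //= b x; rewrite /bnorm /= -/(bnorm x).
by case: (bnorm x) => [|c s] <- //; case: b.
Qed.
Lemma bnorm_eq0 x : nilp (bnorm x) = (bv x == 0).
Proof.
elim: x => //= b x; rewrite /bnorm /= -/(bnorm x).
by case: (bnorm x) => [|c s] /=; case: b; case: (bv x).
Qed.
(** Without high zeros [2 ^ size] is at most twice the value, unless the word is empty; so no word
    of at least that value is shorter. *)
Lemma bnorm_size x y : bv x <= bv y -> size (bnorm x) <= size y.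
Proof.
move=> le; have {le} lt := leq_ltn_trans le (bv_lt y).
have : 2 ^ size (bnorm x) <= (bv x).*2 + nilp (bnorm x).
  elim: x {lt} => [|b x] //; rewrite bnorm_cons /=.
  by case E: (bnorm x) => [|c s] /=; case: b; rewrite /= ?expnS; lia.
case E: (nilp _); first by move: E => /nilP->.
move=> h; rewrite -ltnS -(ltn_exp2l (m := 2)) // expnS; lia.
Qed.

Lemma FP_bnorm A {eA : Enc A} (x : A -> seq bool) : FP x -> FP (fun a => bnorm (x a)).
Proof.
move=> Hx; apply: (FP_foldr_add (F := fun _ (b : bool) s => if s is _ :: _ then b :: s
   else if b then [:: true] else [::]) (q := fun=> 10)) => //; try fpp.
- apply: (FP_match_seq (l := fun z : A * bool * seq bool => z.2)
    (f0 := fun z => if z.1.2 then [:: true] else [::])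
    (f1 := fun z _ _ => z.1.2 :: z.2)); try fpp.
    by apply: FP_if; fpp.
  by apply: FP_cons; fpp.
- exact: pb_const.
- by move=> a b [|c s]; case: b; rewrite ?tz_cons ?tz_nil ?tz_bool; lia.
Qed.

(** Long division: [foldr] meets the last, most significant bit first. Normalising the remainder
    after every bit keeps its length bounded. *)
Definition bstep (d : seq bool) (b : bool) (z : seq bool * seq bool) :=
  let s := bsub (b :: z.2) d in
  if s.1 then (false :: z.1, bnorm (b :: z.2)) else (true :: z.1, bnorm s.2).
Definition bdivmod x d := foldr (bstep d) ([::], [::]) x.

Lemma bdivmodP x d : 0 < bv d ->
  bv x = bv (bdivmod x d).1 * bv d + bv (bdivmod x d).2 /\ bv (bdivmod x d).2 < bv d.
Proof.
move=> d0; elim: x => [|b x [IH1 IH2]] //=; rewrite -/(bdivmod x d).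
set z := bdivmod x d in IH1 IH2 *; have [e1 e2] := bsubP (b :: z.2) d.
rewrite /bstep e1; case: ltnP => h; rewrite /= bnormP.
  split=> //=; rewrite IH1 doubleD doubleMl; lia.
rewrite e2 //=; split; last by move: h => /=; lia.
by move: h => /=; rewrite IH1 doubleD doubleMl mulnDl mul1n; lia.
Qed.

Lemma bdivmod_size x d : size (bdivmod x d).1 = size x /\
  size (bdivmod x d).2 <= size x + size d.
Proof.
elim: x => [|b x [IH1 IH2]] //=; rewrite -/(bdivmod x d) /bstep.
case: ifP => _ /=; rewrite IH1; split=> //.
  by apply: leq_trans (bnorm_size (y := b :: (bdivmod x d).2) (leqnn _)) _ => /=; lia.
by apply: leq_trans (bnorm_size (leqnn _)) _; rewrite size_bsub /=; lia.
Qed.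

Lemma FP_bdivmod A {eA : Enc A} (x y : A -> seq bool) : FP x -> FP y ->
  FP (fun a => bdivmod (x a) (y a)).
Proof.
move=> Hx Hy; have Sx := pb_size Hx; have Sy := pb_size Hy.
apply: (FP_foldr (F := fun a => bstep (y a))
   (S := fun a => 8 * (size (x a) + size (y a)) + 5)) => //; try fpp.
- have H1 : FP (fun z : A * bool * (seq bool * seq bool) => z.1.2 :: z.2.2) by apply: FP_cons; fpp.
  have H2 : FP (fun z : A * bool * (seq bool * seq bool) => y z.1.1) by apply: FP_comp Hy; fpp.
  have H := FP_bsub H1 H2.
  apply: FP_if; first exact: FP_fst H.
    by apply: FP_pair; [apply: FP_cons; fpp | exact: FP_bnorm].
  by apply: FP_pair; [apply: FP_cons; fpp | apply: FP_bnorm; exact: FP_snd H].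
- by pbt.
- move=> a k; have [] := bdivmod_size (drop k (x a)) (y a).
  rewrite tz_pair -/(bdivmod _ _); have := tz_bits (bdivmod (drop k (x a)) (y a)).1.
  have := tz_bits (bdivmod (drop k (x a)) (y a)).2; rewrite size_drop; lia.
Qed.

Definition gstep (z : seq bool * seq bool) :=
  if nilp (bnorm z.2) then z else (z.2, (bdivmod z.1 z.2).2).
Definition bgcd x y := (iter (size x + size y).+2 gstep (x, y)).1.

Lemma bmod_size x d : 0 < bv d -> size (bdivmod x d).2 <= size d.
Proof.
move=> d0; case: x => [|b x] //=; rewrite /bstep -/(bdivmod x d).
have [_ lt] := bdivmodP (b :: x) d0; rewrite /= /bstep -/(bdivmod x d) in lt.
case: ifP lt => /= _; rewrite bnormP => lt; exact: bnorm_size (ltnW lt).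
Qed.

Lemma gstep_size z k : size z.1 <= k -> size z.2 <= k ->
  size (gstep z).1 <= k /\ size (gstep z).2 <= k.
Proof.
move=> h1 h2; rewrite /gstep bnorm_eq0; case: eqP => //= /eqP; rewrite -lt0n => d0; split=> //.
exact: leq_trans (bmod_size _ d0) h2.
Qed.

Lemma gstepP z : gcdn (bv (gstep z).1) (bv (gstep z).2) = gcdn (bv z.1) (bv z.2).
Proof.
rewrite /gstep bnorm_eq0; case: eqP => //= /eqP; rewrite -lt0n => d0.
have [E lt] := bdivmodP z.1 d0.
by rewrite [in RHS]E [RHS]gcdnC gcdnMDl.
Qed.

(** On an ordered pair [x >= y + x %% y > 2 * (x %% y)], so a Euclidean step at least halves the
    product of the pair, and linearly many steps in the lengths suffice. *)
Lemma bgcdP x y : bv (bgcd x y) = gcdn (bv x) (bv y).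
Proof.
have inv n z : gcdn (bv (iter n gstep z).1) (bv (iter n gstep z).2) = gcdn (bv z.1) (bv z.2).
  by elim: n => //= n <-; rewrite gstepP.
have fin t z : bv z.2 <= bv z.1 -> bv z.1 * bv z.2 < 2 ^ t -> bv (iter t gstep z).2 = 0.
  elim: t z => [|t IH] z le lt.
    by rewrite /=; move: lt; rewrite expn0; case: (bv z.2) le => // m; nia.
  rewrite iterSr; rewrite /gstep bnorm_eq0; case: eqP => /= [e0|/eqP].
    by apply: IH => //; rewrite e0 muln0 expn_gt0.
  rewrite -lt0n => d0; have [E lt2] := bdivmodP z.1 d0; apply: IH => /=; first exact: ltnW.
  rewrite expnS in lt; rewrite E in lt le.
  move: (bv (bdivmod _ _).1) (bv (bdivmod _ _).2) (bv z.2) lt le d0 lt2 {E} => q r d lt le d0 lt2.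
  case: q lt le => [|q] lt le; first by move: le; rewrite mul0n; lia.
  rewrite -(ltn_pmul2l (m := 2)) //; apply: leq_ltn_trans lt.
  rewrite mulnCA mulnC leq_mul2r; apply/orP; right; rewrite mulSn; lia.
rewrite /bgcd -[RHS](inv (size x + size y).+2 (x, y)).
rewrite (_ : bv (iter _ _ _).2 = 0) ?gcdn0 // iterSr.
(* The first step orders the pair, which the halving argument presupposes. *)
suff [h1 h2] : bv (gstep (x, y)).2 <= bv (gstep (x, y)).1 /\
  bv (gstep (x, y)).1 * bv (gstep (x, y)).2 < 2 ^ (size x + size y).+1 by exact: fin.
rewrite /gstep bnorm_eq0 /=; case: eqP => [y0|/eqP]; first by rewrite /= y0 muln0 expn_gt0.
rewrite -lt0n => y0; have [E lt] := bdivmodP x y0; split=> /=; first exact: ltnW.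
have lx := bv_lt x; have ly := bv_lt y.
rewrite expnS expnD; apply: (@leq_ltn_trans (bv y * bv x)).
  by rewrite leq_mul2l; apply/orP; right; rewrite [leqRHS]E leq_addl.
apply: (@leq_ltn_trans (bv x * 2 ^ size y)).
  by rewrite mulnC leq_mul2l ltnW ?orbT.
have : bv x * 2 ^ size y < 2 ^ size x * 2 ^ size y by rewrite ltn_pmul2r ?expn_gt0.
lia.
Qed.

Lemma FP_bgcd A {eA : Enc A} (x y : A -> seq bool) : FP x -> FP y ->
  FP (fun a => bgcd (x a) (y a)).
Proof.
move=> Hx Hy; have Sx := pb_size Hx; have Sy := pb_size Hy.
have H : FP (fun a => iter (size (x a) + size (y a)).+2 gstep (x a, y a)); last exact: FP_fst H.
apply: (FP_iter (F := fun _ => gstep) (S := fun a => 8 * (size (x a) + size (y a)) + 5)).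
- by do 2 apply: FP_succ; apply: FP_addn; apply: FP_sizes.
- by fpp.
- apply: FP_if; [|fpp|].
    apply: (FP_ext (f := fun z : A * (seq bool * seq bool) => size (bnorm z.2.2) == 0)) => //.
    by apply: FP_eq0; apply: FP_sizes; apply: FP_bnorm; fpp.
  apply: FP_pair; first by fpp.
  have H : FP (fun z : A * (seq bool * seq bool) => bdivmod z.2.1 z.2.2) by apply: FP_bdivmod; fpp.
  exact: FP_snd H.
- by pbt.
- move=> a k _.
  have [] : size (iter k gstep (x a, y a)).1 <= size (x a) + size (y a) /\
     size (iter k gstep (x a, y a)).2 <= size (x a) + size (y a).
    by elim: k => [|k [IH1 IH2]] /=; [split=> /=; lia | exact: gstep_size].
  set z := iter _ _ _ => h1 h2; rewrite tz_pair.
  by have := tz_bits z.1; have := tz_bits z.2; lia.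
Qed.

(** * Dynamic programming over integer weights *)

Import GRing.Theory.

(** Integers are differences of naturals, so sums and products need no sign cases; the sign is
    decided once, on output. *)
Definition bint := (seq bool * seq bool)%type.
Definition vval (z : bint) : rat := ((bv z.1)%:R - (bv z.2)%:R)%R.
Definition vadd (z w : bint) : bint := (badd z.1 w.1, badd z.2 w.2).
Definition vmul (z w : bint) : bint :=
  (badd (bmul z.1 w.1) (bmul z.2 w.2), badd (bmul z.1 w.2) (bmul z.2 w.1)).
Definition vsz (z : bint) := maxn (size z.1) (size z.2).
Definition vzero : bint := ([::], [::]).
Definition vone : bint := ([:: true], [::]).

Lemma vvalD z w : vval (vadd z w) = (vval z + vval w)%R.
Proof. by rewrite /vval /vadd /= !baddP !natrD; ring. Qed.
Lemma vvalM z w : vval (vmul z w) = (vval z * vval w)%R.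
Proof. by rewrite /vval /vmul /= !baddP !bmulP !natrD !natrM; ring. Qed.
Lemma vval0 : vval vzero = 0%R. Proof. by rewrite /vval /= subrr. Qed.
Lemma vval1 : vval vone = 1%R. Proof. by rewrite /vval /= subr0. Qed.

Lemma vsz_add z w : vsz (vadd z w) = (maxn (vsz z) (vsz w)).+1.
Proof. by rewrite /vsz /= !size_badd; lia. Qed.
Lemma vsz_mul z w : vsz (vmul z w) <= 2 * vsz z + vsz w + 1.
Proof.
rewrite /vsz /= !size_badd.
have := size_bmul z.1 w.1; have := size_bmul z.1 w.2.
have := size_bmul z.2 w.1; have := size_bmul z.2 w.2; lia.
Qed.
Lemma tz_vsz (z : bint) : tz z <= 8 * vsz z + 3.
Proof. by rewrite tz_pair /vsz; have := tz_bits z.1; have := tz_bits z.2; lia. Qed.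
Lemma vsz_tz (z : bint) : vsz z <= tz z.
Proof.
rewrite tz_pair /vsz; have := @tz_size _ enc_bool z.1; have := @tz_size _ enc_bool z.2; lia.
Qed.

Section FPv.
Context (A : Type) {eA : Enc A}.
Lemma FP_vadd (x y : A -> bint) : FP x -> FP y -> FP (fun a => vadd (x a) (y a)).
Proof. by move=> Hx Hy; apply: FP_pair; apply: FP_badd; fpp. Qed.
Lemma FP_vmul (x y : A -> bint) : FP x -> FP y -> FP (fun a => vmul (x a) (y a)).
Proof. by move=> Hx Hy; apply: FP_pair; apply: FP_badd; apply: FP_bmul; fpp. Qed.
End FPv.

Lemma tz_mem (E : eqType) {eE : Enc E} (e : E) (s : seq E) : e \in s -> tz e < tz s.
Proof.
elim: s => // f s IH; rewrite inE tz_cons => /orP[/eqP<-|/IH]; last lia.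
by have := @tz_gt0 _ (enc_seq eE) s; lia.
Qed.
Section DP.
Context (X : Type) {eX : Enc X} (S : eqType) {eS : Enc S}.
Variables (step : S -> seq (nat * S)) (term : S -> bool) (b : nat).
Variables (states : X -> seq S) (W : X -> seq bint).
Let eb : Enc bint := enc_prod (enc_seq enc_bool) (enc_seq enc_bool).
Hypothesis FPstep : FP step.
Hypothesis FPterm : FP term.
Hypothesis FPeq : FP (fun z : S * S => z.1 == z.2).
Hypothesis FPstates : FP states.
Hypothesis FPW : FP W.
Hypothesis size_step : forall s, size (step s) <= b.

Definition lookup (s : S) (tab : seq (S * bint)) : bint :=
  foldr (fun e r => if s == e.1 then e.2 else r) vzero tab.
Definition term_sum (w : seq bint) tab (l : seq (nat * S)) : bint :=
  foldr (fun e acc => vadd (vmul (nth vzero w e.1) (lookup e.2 tab)) acc) vzero l.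
Definition entry (w : seq bint) tab s : bint :=
  if term s then vone else term_sum w tab (step s).
Definition newtab x tab := [seq (s, entry (W x) tab s) | s <- states x].
(** Each round recomputes the table of all states from the previous one, so shared states are
    evaluated once per round and recursion does not branch. *)
Definition dp x (t : nat) s := lookup s (iter t (newtab x) [::]).

Fixpoint dpval (w : nat -> rat) (t : nat) (s : S) : rat :=
  if t is t'.+1 then
    if term s then 1%R else (\sum_(e <- step s) w e.1 * dpval w t' e.2)%R
  else 0%R.

(** [inv] is preserved by moves and confines runs to [states x], so after the first round [lookup]
    does not fall back on its default zero. *)
Lemma dpP (inv : S -> Prop) x w :
  (forall i, w i = vval (nth vzero (W x) i)) ->
  (forall s, inv s -> s \in states x) ->
  (forall s e, inv s -> ~~ term s -> e \in step s -> inv e.2) ->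
  forall t s, inv s -> vval (dp x t s) = dpval w t s.
Proof.
move=> Hw Hs Hi; elim=> [|t IH] s inv_s; first by rewrite /dp /= vval0.
rewrite /dp iterS; set tab := iter t _ _.
have L : lookup s (newtab x tab) = entry (W x) tab s.
  rewrite /newtab; elim: (states x) (Hs s inv_s) => // u l IHl; rewrite inE /=.
  by case: eqP => [->|_ /= /IHl].
rewrite L /entry /=; case: ifP => [_|/negbT nt]; first exact: vval1.
have : forall e, e \in step s -> inv e.2 by move=> e; exact: Hi.
rewrite /term_sum; elim: (step s) => [|e l IHl] H; first by rewrite big_nil vval0.
rewrite big_cons /= vvalD vvalM -Hw -IH ?IHl //; last by apply: H; rewrite mem_head.
by move=> f fl; apply: H; rewrite inE fl orbT.
Qed.

Lemma vsz_lookup s tab M : (forall e : S * bint, e \in tab -> vsz e.2 <= M) -> vsz (lookup s tab) <= M.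
Proof.
elim: tab => [|e l IH] H //=; case: eqP => _; first by apply: H; rewrite mem_head.
by apply: IH => f fl; apply: H; rewrite inE fl orbT.
Qed.

Lemma vsz_sum w tab l M N : (forall e : S * bint, e \in tab -> vsz e.2 <= M) ->
  (forall z : bint, z \in w -> vsz z <= N) ->
  vsz (term_sum w tab l) <= 2 * N + M + 1 + size l.
Proof.
move=> HM HN; elim: l => [|e l IH] //=; rewrite vsz_add.
have := vsz_mul (nth vzero w e.1) (lookup e.2 tab); have := vsz_lookup e.2 HM.
have : vsz (nth vzero w e.1) <= N.
  by case: (ltnP e.1 (size w)) => [/(mem_nth vzero)/HN|/(nth_default vzero)->].
move: IH; rewrite /term_sum; lia.
Qed.

Lemma FP_lookup A {eA : Enc A} (s : A -> S) (tab : A -> seq (S * bint)) :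
  FP s -> FP tab -> FP (fun a => lookup (s a) (tab a)).
Proof.
move=> Hs Ht.
apply: (FP_foldr_add (F := fun a e r => if s a == e.1 then e.2 else r) (q := fun z => tz z)); try fpp.
- apply: FP_if; [|fpp|fpp].
  apply: (FP_app2 (g := fun u v => u == v)); [fpp | apply: FP_comp Hs; fpp | fpp].
- exact: pb_tz.
- move=> a [u v] r; rewrite (tz_pair (a, _)) (tz_pair (u, v)) /=.
  by case: eqP => _; lia.
Qed.

Lemma FP_entry A {eA : Enc A} (w : A -> seq bint) (tab : A -> seq (S * bint)) (s : A -> S) :
  FP w -> FP tab -> FP s -> FP (fun a => entry (w a) (tab a) (s a)).
Proof.
move=> Hw Ht Hs; have Hst : FP (fun a => step (s a)) by exact: FP_comp Hs FPstep.
apply: FP_if; [exact: FP_comp Hs FPterm | fpp |].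
apply: (FP_foldr (F := fun a e acc => vadd (vmul (nth vzero (w a) e.1) (lookup e.2 (tab a))) acc)
  (S := fun a => 8 * (2 * tz (w a) + tz (tab a) + 1 + size (step (s a))) + 3)) => //; try fpp.
- apply: FP_vadd; last by fpp.
  apply: FP_vmul; first by apply: FP_nth; [fpp | apply: FP_comp Hw; fpp | fpp].
  by apply: FP_lookup; [fpp | apply: FP_comp Ht; fpp].
- have P1 := FP_size Hw; have P2 := FP_size Ht; have P3 := pb_size Hst; by pbt.
- move=> a k; apply: leq_trans (tz_vsz _) _; rewrite leq_add2r leq_mul2l /=.
  apply: leq_trans (@vsz_sum (w a) (tab a) (drop k (step (s a))) (tz (tab a)) (tz (w a)) _ _) _.
  + move=> e h; apply: leq_trans (vsz_tz _) _.
    apply: leq_trans (ltnW (tz_mem h)); rewrite [leqRHS]tz_pair -addnS.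
    exact: leq_trans (leqnSn _) (leq_addl _ _).
  + by move=> z h; apply: leq_trans (vsz_tz _) (ltnW (tz_mem h)).
  + by rewrite leq_add2l size_drop; lia.
Qed.

(** Bits gained per round: a weight, as left factor, counts twice, and each of the at most [b]
    summands costs a carry. *)
Definition dp_size x t := t * (2 * tz (W x) + b + 2) + 1.

Lemma vsz_table x t e : e \in iter t (newtab x) [::] -> vsz e.2 <= dp_size x t.
Proof.
elim: t e => // t IH e /mapP[s _ ->] /=; rewrite /entry.
case: ifP => _; first by rewrite /vsz /dp_size /=; lia.
apply: leq_trans (vsz_sum _ IH _) _.
  by move=> z h; apply: leq_trans (vsz_tz _) (ltnW (tz_mem h)).
by have := size_step s; rewrite /dp_size mulSn; lia.
Qed.

Lemma tz_table (f : S -> bint) (l : seq S) M : (forall s, s \in l -> vsz (f s) <= M) ->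
  tz [seq (s, f s) | s <- l] <= tz l + size l * (8 * M + 4).
Proof.
elim: l => [|s l IH] H //=; rewrite !tz_cons tz_pair /=.
have h1 := H s (mem_head _ _); have h2 := tz_vsz (f s).
have h3 : tz [seq (s, f s) | s <- l] <= tz l + size l * (8 * M + 4).
  by apply: IH => u ul; apply: H; rewrite inE ul orbT.
by rewrite mulSn; move: h3; lia.
Qed.

Lemma FP_dp (t : X -> nat) (s0 : X -> S) : FP t -> FP s0 -> FP (fun x => dp x (t x) (s0 x)).
Proof.
move=> Ht Hs; apply: FP_lookup => //.
apply: (FP_iter (F := newtab)
  (S := fun x => tz (states x) + size (states x) * (8 * dp_size x (t x) + 4) + 1)) => //.
- by fpp.
- apply: (FP_map (f := fun z s => (s, entry (W z.1) z.2 s))).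
    by apply: FP_comp FPstates; fpp.
  apply: FP_pair; first by fpp.
  by apply: FP_entry; [apply: FP_comp FPW; fpp | fpp | fpp].
- rewrite /dp_size; have P1 := pb_size FPstates; have P2 := FP_size FPstates.
  have P3 := FP_size FPW.
  have Pt : pb t by apply: (pb_le (g := fun x => tz (t x))) => [x|]; [rewrite tz_nat; lia | exact: FP_size].
  by pbt.
- move=> x [|k] le; first by rewrite tz_nil; lia.
  have H : forall s, s \in states x -> vsz (entry (W x) (iter k (newtab x) [::]) s) <= dp_size x (t x).
    move=> s sx; have h : (s, entry (W x) (iter k (newtab x) [::]) s) \in iter k.+1 (newtab x) [::].
      by apply/mapP; exists s.
    have := vsz_table h; rewrite /dp_size /= => h'; apply: leq_trans h' _.
    by rewrite leq_add2r leq_mul2r; apply/orP; right; lia.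
  have := tz_table H; rewrite iterS /newtab; set X1 := tz _; set X2 := tz (states x).
  by set D := dp_size _ _; lia.
Qed.
End DP.

(** * The counting automaton *)

Definition inc q (u : seq nat) := [seq nth 0 u i + (i == q) | i <- iota 0 (size u)].
Definition decr q (u : seq nat) := [seq nth 0 u i - (i == q) | i <- iota 0 (size u)].
(** When all entries are zero this is the length, which serves as the test for an empty
    histogram. *)
Definition first_pos (u : seq nat) := find (fun n => 0 < n) u.

Lemma size_inc q u : size (inc q u) = size u. Proof. by rewrite size_map size_iota. Qed.
Lemma size_dec q u : size (decr q u) = size u. Proof. by rewrite size_map size_iota. Qed.
Lemma nth_inc q u i : i < size u -> nth 0 (inc q u) i = nth 0 u i + (i == q).
Proof. by move=> lt; rewrite (nth_map 0) ?size_iota // nth_iota. Qed.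
Lemma nth_dec q u i : i < size u -> nth 0 (decr q u) i = nth 0 u i - (i == q).
Proof. by move=> lt; rewrite (nth_map 0) ?size_iota // nth_iota. Qed.

Lemma FP_nat_of_bool A {eA : Enc A} (b : A -> bool) : FP b -> FP (fun a => nat_of_bool (b a)).
Proof. by move=> Hb; apply: FP_comp Hb (FP_bool1 nat_of_bool). Qed.

Section FPvec.
Context (A : Type) {eA : Enc A}.
Variables (q : A -> nat) (u : A -> seq nat).
Hypotheses (Hq : FP q) (Hu : FP u).

Lemma FP_inc : FP (fun a => inc (q a) (u a)).
Proof.
apply: (FP_map (f := fun a i => nth 0 (u a) i + (i == q a))).
  by apply: FP_iota; apply: FP_sizes.
have Hu' : FP (fun z : A * nat => u z.1) by apply: FP_comp Hu; fpp.
have Hq' : FP (fun z : A * nat => q z.1) by apply: FP_comp Hq; fpp.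
by apply: FP_addn; [apply: FP_nth; fpp | apply: FP_nat_of_bool; apply: FP_eqn; fpp].
Qed.

Lemma FP_dec : FP (fun a => decr (q a) (u a)).
Proof.
apply: (FP_map (f := fun a i => nth 0 (u a) i - (i == q a))).
  by apply: FP_iota; apply: FP_sizes.
have Hu' : FP (fun z : A * nat => u z.1) by apply: FP_comp Hu; fpp.
have Hq' : FP (fun z : A * nat => q z.1) by apply: FP_comp Hq; fpp.
by apply: FP_subn; [apply: FP_nth; fpp | apply: FP_nat_of_bool; apply: FP_eqn; fpp].
Qed.

Lemma FP_first_pos : FP (fun a => first_pos (u a)).
Proof.
apply: (FP_ext (f := fun a => foldr (fun n k => if 0 < n then 0 else k.+1) 0 (u a))).
  by move=> a; rewrite /first_pos; elim: (u a) => //= n s ->.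
apply: (FP_foldr_add (F := fun _ n k => if 0 < n then 0 else k.+1) (q := fun=> 2)); try fpp.
- by apply: FP_if; [apply: FP_leq; fpp | fpp | apply: FP_succ; fpp].
- exact: pb_const.
- by move=> a n k; case: ifP => _; rewrite !tz_nat; lia.
Qed.
End FPvec.

Lemma FP_eqseqn A {eA : Enc A} (s t : A -> seq nat) : FP s -> FP t -> FP (fun a => s a == t a).
Proof.
move=> Hs Ht.
apply: (FP_ext (f := fun a => (size (s a) == size (t a)) &&
   nilp [seq i <- iota 0 (size (s a)) | nth 0 (s a) i != nth 0 (t a) i])).
  move=> a; apply/andP/eqP => [[/eqP e n]|->]; last first.
    split=> //; rewrite (eq_filter (a2 := pred0)) ?filter_pred0 // => i.
    by rewrite /= eqxx.
  apply: (@eq_from_nth _ 0) => // i lt; apply/eqP; apply: contraTT n => ne.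
  by rewrite /nilp size_filter -lt0n -has_count; apply/hasP; exists i; rewrite ?mem_iota.
apply: FP_andb; first by apply: FP_eqn; apply: FP_sizes.
apply: FP_eq0; apply: FP_sizes.
apply: (FP_filter (p := fun a i => nth 0 (s a) i != nth 0 (t a) i)).
  by apply: FP_iota; apply: FP_sizes.
have Hs' : FP (fun z : A * nat => s z.1) by apply: FP_comp Hs; fpp.
have Ht' : FP (fun z : A * nat => t z.1) by apply: FP_comp Ht; fpp.
by apply: FP_negb; apply: FP_eqn; apply: FP_nth; fpp.
Qed.

(** For fixed [k] there are [(n + 1) ^ k] of them. Hence [k], the number of classes, is built into
    the program, and only [n] is input. *)
Fixpoint vecs (n k : nat) : seq (seq nat) :=
  if k is k'.+1 then flatten [seq [seq i :: v | v <- vecs n k'] | i <- iota 0 n.+1] else [:: [::]].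

Lemma FP_vecs k : FP (fun n => vecs n k).
Proof.
elim: k => [|k IH]; first exact: FP_const.
apply: FP_flatten; apply: (FP_map (f := fun n i => [seq i :: v | v <- vecs n k])).
  by apply: FP_iota; apply: FP_succ; fpp.
apply: (FP_map (f := fun (z : nat * nat) v => z.2 :: v)).
  by apply: FP_comp IH; fpp.
by apply: FP_cons; fpp.
Qed.

Lemma mem_vecs n k v : size v = k -> all (fun i => i <= n) v -> v \in vecs n k.
Proof.
elim: k v => [|k IH] [|i v] // [sz] /andP[le al].
rewrite /vecs -/vecs; apply/flatten_mapP; exists i; first by rewrite mem_iota.
by apply/mapP; exists v => //; exact: IH.
Qed.

Section Machine.
Variables (K : nat) (ini : seq (nat * nat)).
Variables (tab : seq (seq (seq (nat * (nat * nat))))) (okt : seq bool).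

Definition mst := (nat * nat * (seq nat * seq nat))%type.

(* Phase A: [r] vertices still have to choose a class.  Phase B: [p = 0], pick a
   vertex of [u].  Phase C: the picked vertex has class [p.-1]; it meets the
   vertices of [u], which then move to [w]. *)
Definition mstep (s : mst) : seq (nat * mst) :=
  let: (r, p, (u, w)) := s in
  let q := first_pos u in
  if r is r'.+1 then [seq (e.1, ((r', 0), (inc e.2 u, w))) | e <- ini]
  else if p is p'.+1 then
    if q < size u then
      [seq (e.1, ((0, e.2.1.+1), (decr q u, inc e.2.2 w))) | e <- nth [::] (nth [::] tab p') q]
    else if nth false okt p' then [:: (0, ((0, 0), (w, u)))] else [::]
  else [:: (0, ((0, q.+1), (decr q u, w)))].
Definition mterm (s : mst) : bool :=
  (s.1.1 == 0) && (s.1.2 == 0) && (size s.2.1 <= first_pos s.2.1).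
Definition mstates (n : nat) : seq mst :=
  flatten [seq flatten [seq flatten [seq [seq ((r, p), (u, w)) | w <- vecs n K] | u <- vecs n K]
    | p <- iota 0 K.+1] | r <- iota 0 n.+1].

Lemma FP_mstates : FP mstates.
Proof.
apply: FP_flatten; apply: (FP_map (f := fun n r => _)); first by apply: FP_iota; apply: FP_succ; fpp.
apply: FP_flatten; apply: (FP_map (f := fun z p => _)); first by fpp.
apply: FP_flatten; apply: (FP_map (f := fun z u => _)).
  by apply: FP_comp (FP_vecs K); fpp.
apply: (FP_map (f := fun z w => _)); first by apply: FP_comp (FP_vecs K); fpp.
by fpp.
Qed.

Lemma FP_mterm : FP mterm.
Proof.
apply: FP_andb; first by apply: FP_andb; apply: FP_eq0; fpp.
by apply: FP_leq; [apply: FP_sizes | apply: FP_first_pos]; fpp.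
Qed.

Lemma FP_mst_eq : FP (fun z : mst * mst => z.1 == z.2).
Proof.
apply: (FP_ext (f := fun z : mst * mst => ((z.1.1.1 == z.2.1.1) && (z.1.1.2 == z.2.1.2)) &&
   ((z.1.2.1 == z.2.2.1) && (z.1.2.2 == z.2.2.2)))).
  by move=> [[[a b] [c d]] [[a' b'] [c' d']]] /=; rewrite !xpair_eqE.
by do ![apply: FP_andb | apply: FP_eqn | apply: FP_eqseqn]; fpp.
Qed.

Lemma FP_mstep : FP mstep.
Proof.
pose r (s : mst) := s.1.1; pose p (s : mst) := s.1.2; pose u (s : mst) := s.2.1; pose w (s : mst) := s.2.2.
have Hq : FP (fun s => first_pos (u s)) by apply: FP_first_pos; fpp.
apply: (FP_ext (f := fun s => if r s is r'.+1 then [seq (e.1, ((r', 0), (inc e.2 (u s), w s))) | e <- ini]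
   else if p s is p'.+1 then
    if first_pos (u s) < size (u s) then
      [seq (e.1, ((0, e.2.1.+1), (decr (first_pos (u s)) (u s), inc e.2.2 (w s)))) |
        e <- nth [::] (nth [::] tab p') (first_pos (u s))]
    else if nth false okt p' then [:: (0, ((0, 0), (w s, u s)))] else [::]
  else [:: (0, ((0, (first_pos (u s)).+1), (decr (first_pos (u s)) (u s), w s)))])).
  by move=> [[r0 p0] [u0 w0]].
apply: (FP_match_nat (f1 := fun s r' => [seq (e.1, ((r', 0), (inc e.2 (u s), w s))) | e <- ini])).
- by fpp.
- apply: (FP_match_nat (f1 := fun s p' => if first_pos (u s) < size (u s) then
      [seq (e.1, ((0, e.2.1.+1), (decr (first_pos (u s)) (u s), inc e.2.2 (w s)))) |
        e <- nth [::] (nth [::] tab p') (first_pos (u s))]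
    else if nth false okt p' then [:: (0, ((0, 0), (w s, u s)))] else [::])).
  + by fpp.
  + apply: FP_cons; last by fpp.
    apply: FP_pair; first by fpp.
    apply: FP_pair; first by apply: FP_pair; [fpp | apply: FP_succ].
    by apply: FP_pair; [apply: FP_dec; fpp | fpp].
  + have Hq' : FP (fun z : mst * nat => first_pos (u z.1)) by apply: FP_comp Hq; fpp.
    apply: FP_if; first by apply: FP_leq; [apply: FP_succ | apply: FP_sizes; fpp].
      apply: (FP_map (f := fun (z : mst * nat) e => (e.1, ((0, e.2.1.+1),
         (decr (first_pos (u z.1)) (u z.1), inc e.2.2 (w z.1)))))).
        by apply: FP_nth; [fpp | apply: FP_nth; fpp | fpp].
      apply: FP_pair; first by fpp.
      apply: FP_pair; first by apply: FP_pair; [fpp | apply: FP_succ; fpp].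
      apply: FP_pair; last by apply: FP_inc; fpp.
      by apply: FP_dec; [apply: FP_comp Hq'|]; fpp.
    by apply: FP_if; [apply: FP_nth; fpp | apply: FP_cons; fpp | fpp].
- apply: (FP_map (f := fun (z : mst * nat) e => (e.1, ((z.2, 0), (inc e.2 (u z.1), w z.1))))).
    by fpp.
  by apply: FP_pair; [fpp | apply: FP_pair; [fpp | apply: FP_pair; [apply: FP_inc; fpp | fpp]]].
Qed.

(** A choice moves an element from the first count into [u], a pick removes it, and a meeting moves
    one from [u] to [w]; the picked element is in neither. So the sum never grows. *)
Definition minv n (s : mst) := [/\ size s.2.1 = K, size s.2.2 = K, s.1.2 <= K &
  s.1.1 + sumn s.2.1 + sumn s.2.2 <= n].

Lemma sumn_mkseq k (f : nat -> nat) : sumn [seq f i | i <- iota 0 k] = \sum_(i < k) f i.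
Proof. by rewrite sumnE big_map -{1}[k]subn0 -/(index_iota 0 k) big_mkord. Qed.
Lemma sumn_nth u : sumn u = \sum_(i < size u) nth 0 u i.
Proof. by rewrite -{1}(mkseq_nth 0 u) /mkseq sumn_mkseq. Qed.

Lemma sumn_inc q u : sumn (inc q u) = sumn u + (q < size u).
Proof.
rewrite /inc sumn_mkseq big_split /= -sumn_nth; congr (_ + _).
case: ltnP => lt.
  by rewrite (bigD1 (Ordinal lt)) //= eqxx big1 ?addn0 // => i; rewrite -val_eqE /= => /negbTE->.
by rewrite big1 // => i _; case: eqP => // e; have := ltn_ord i; rewrite e; lia.
Qed.

Lemma sumn_inc_le q u : sumn (inc q u) <= (sumn u).+1.
Proof. by rewrite sumn_inc; case: (q < size u); lia. Qed.

Lemma inc_dec q u : 0 < nth 0 u q -> inc q (decr q u) = u.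
Proof.
move=> h; apply: (@eq_from_nth _ 0); rewrite ?size_inc ?size_dec // => i lt.
by rewrite nth_inc ?size_dec // nth_dec //; case: eqP => [->|_]; lia.
Qed.

Lemma sumn_dec q u : q < size u -> 0 < nth 0 u q -> sumn u = (sumn (decr q u)).+1.
Proof. by move=> lt h; rewrite -{1}(inc_dec h) sumn_inc size_dec lt addn1. Qed.

Lemma first_posP u : first_pos u < size u -> 0 < nth 0 u (first_pos u).
Proof. by move=> lt; apply: (nth_find 0 (a := fun n => 0 < n)); rewrite has_find. Qed.

Hypothesis tabK : forall p q e, e \in nth [::] (nth [::] tab p) q -> e.2.1 < K.

Lemma mstep_inv n s (e : nat * mst) : minv n s -> ~~ mterm s -> e \in mstep s -> minv n e.2.
Proof.
move: s => [[r p] [u w]] [/= su sw pK le]; rewrite /mterm /= => nt.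
case: r le nt => [|r] le nt /=.
  case: p pK nt => [|p] pK nt.
    move: nt => /=; rewrite -ltnNge => lt; rewrite inE => /eqP-> /=.
    have := sumn_dec lt (first_posP lt); split; rewrite /= ?size_inc ?size_dec //; lia.
  case: ltnP => lt; last first.
    by case: (nth _ _ _) => //; rewrite inE => /eqP-> /=; split=> //=; lia.
  case/mapP=> -[i [c1 c2]] /tabK /= fK -> /=.
  have := sumn_dec lt (first_posP lt); have h2 := sumn_inc_le c2 w => h1.
  by split; rewrite /= ?size_inc ?size_dec //; lia.
case/mapP=> -[i c] _ -> /=; have h2 := sumn_inc_le c u.
by split; rewrite /= ?size_inc ?size_dec //; lia.
Qed.

Lemma minv_states n s : minv n s -> s \in mstates n.
Proof.
have le_sumn (u : seq nat) : all (fun i => i <= sumn u) u.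
  elim: u => //= i u IH; rewrite leq_addr /=; apply/allP => j /(allP IH); lia.
have vm u : size u = K -> sumn u <= n -> u \in vecs n K.
  move=> su le; apply: mem_vecs => //; apply/allP => i /(allP (le_sumn u)); lia.
move: s => [[r p] [u w]] [/= su sw pK le].
apply/flatten_mapP; exists r; first by rewrite mem_iota; lia.
apply/flatten_mapP; exists p; first by rewrite mem_iota; lia.
apply/flatten_mapP; exists u; first by apply: vm => //; lia.
by apply/mapP; exists w => //; apply: vm => //; lia.
Qed.

Definition mbound := size ini + sumn [seq sumn [seq size c | c <- row] | row <- tab] + 1.

Lemma nth_sumn T (f : T -> nat) d l p : f d = 0 -> f (nth d l p) <= sumn [seq f x | x <- l].
Proof.
move=> fd; elim: l p => [|x l IH] [|p] /=; rewrite ?fd ?leq_addr //.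
exact: leq_trans (IH p) (leq_addl _ _).
Qed.

Lemma size_mstep s : size (mstep s) <= mbound.
Proof.
move: s => [[[|r] [|p]] [u w]] /=; rewrite /mbound ?size_map; try lia.
case: ifP => _; last by case: (nth _ _ _) => /=; lia.
rewrite size_map; set c := nth _ _ _.
have : size c <= sumn [seq sumn [seq size c | c <- row] | row <- tab]; last lia.
apply: leq_trans (@nth_sumn _ size [::] (nth [::] tab p) (first_pos u) (erefl _)) _.
exact: (@nth_sumn _ (fun row => sumn [seq size c | c <- row]) [::]).
Qed.

(** There are [n] choices of a class. Then each round on [k] remaining elements takes one pick,
    [k - 1] meetings and one final test, which the square covers in total. *)
Definition mfuel n := n + n.+1 ^ 2.
Definition mstart n : mst := ((n, 0), (nseq K 0, nseq K 0)).

Section Run.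
Context (X : Type) {eX : Enc X}.
Variables (n : X -> nat) (W : X -> seq bint).

Definition mrun (x : X) : bint :=
  dp mstep mterm (fun x => mstates (n x)) W x (mfuel (n x)) (mstart (n x)).

Lemma FP_mrun : FP n -> FP W -> FP mrun.
Proof.
move=> Hn HW; apply: (FP_dp FP_mstep FP_mterm FP_mst_eq _ HW size_mstep).
- exact: FP_comp Hn FP_mstates.
- by apply: FP_addn => //; apply: FP_expn; apply: FP_succ.
- by apply: FP_pair; [apply: FP_pair; fpp | fpp].
Qed.

Lemma mrunP x w : (forall i, w i = vval (nth vzero (W x) i)) ->
  vval (mrun x) = dpval mstep mterm w (mfuel (n x)) (mstart (n x)).
Proof.
move=> Hw; apply: (dpP (inv := minv (n x)) Hw).
- exact: minv_states.
- by move=> s e; exact: mstep_inv.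
- by split; rewrite /= ?size_nseq // !sumn_nseq; lia.
Qed.
End Run.
End Machine.

(** * Products, powers and parsing *)

Import GRing.Theory Num.Theory.

Section Prod.
Context (A : Type) {eA : Enc A}.

(** The index list is fixed: the induction takes place while the program is built, not while it
    runs. *)
Lemma FP_list C {eC : Enc C} I (s : seq I) (h : I -> A -> C) :
  (forall i, FP (h i)) -> FP (fun a => [seq h i a | i <- s]).
Proof. by move=> H; elim: s => [|i s IH] /=; [exact: FP_const | exact: FP_cons]. Qed.

Definition vprod (z : seq bint) := foldr vmul vone z.
Definition vsum (z : seq bint) := foldr vadd vzero z.

Lemma vprodE z : vval (vprod z) = (\prod_(v <- z) vval v)%R.
Proof. by elim: z => [|v z IH]; rewrite ?big_nil ?vval1 // big_cons -IH -vvalM. Qed.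
Lemma vsumE z : vval (vsum z) = (\sum_(v <- z) vval v)%R.
Proof. by elim: z => [|v z IH]; rewrite ?big_nil ?vval0 // big_cons -IH -vvalD. Qed.

Lemma FP_vprod I (s : seq I) (h : I -> A -> bint) :
  (forall i, FP (h i)) -> FP (fun a => vprod [seq h i a | i <- s]).
Proof. by move=> H; elim: s => [|i s IH] /=; [exact: FP_const | exact: FP_vmul]. Qed.
Lemma FP_vsum I (s : seq I) (h : I -> A -> bint) :
  (forall i, FP (h i)) -> FP (fun a => vsum [seq h i a | i <- s]).
Proof. by move=> H; elim: s => [|i s IH] /=; [exact: FP_const | exact: FP_vadd]. Qed.

Definition bprod (z : seq (seq bool)) := foldr bmul [:: true] z.
Lemma bprodE z : bv (bprod z) = \prod_(v <- z) bv v.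
Proof. by elim: z => [|v z IH]; rewrite ?big_nil // big_cons -IH -bmulP. Qed.
Lemma FP_bprod I (s : seq I) (h : I -> A -> seq bool) :
  (forall i, FP (h i)) -> FP (fun a => bprod [seq h i a | i <- s]).
Proof. by move=> H; elim: s => [|i s IH] /=; [exact: FP_const | exact: FP_bmul]. Qed.

Lemma pb_nat (n : A -> nat) : FP n -> pb n.
Proof.
by move=> Hn; apply: (pb_le (g := fun a => tz (n a))) => [a|]; [rewrite tz_nat; lia | exact: FP_size].
Qed.

Definition vpow (z : bint) k := iter k (vmul z) vone.
Lemma vpowE z k : vval (vpow z k) = (vval z ^+ k)%R.
Proof. by elim: k => [|k IH]; rewrite ?vval1 // exprS -IH -vvalM. Qed.
Lemma FP_vpow (z : A -> bint) (k : A -> nat) : FP z -> FP k -> FP (fun a => vpow (z a) (k a)).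
Proof.
move=> Hz Hk.
apply: (FP_iter (F := fun a => vmul (z a)) (S := fun a => 8 * (k a * (2 * tz (z a) + 1) + 1) + 3)) => //.
- exact: FP_const.
- by apply: FP_vmul; [apply: FP_comp Hz; fpp | fpp].
- by have P1 := pb_nat Hk; have P2 := FP_size Hz; pbt.
- move=> a i le; apply: leq_trans (tz_vsz _) _; rewrite leq_add2r leq_mul2l /=.
  apply: (@leq_trans (i * (2 * tz (z a) + 1) + 1)); last by rewrite leq_add2r leq_mul2r le orbT.
  elim: i {le} => [|i IH] //=; apply: leq_trans (vsz_mul _ _) _.
  by have := vsz_tz (z a); rewrite mulSn; lia.
Qed.

Definition bpow (z : seq bool) k := iter k (bmul z) [:: true].
Lemma bpowE z k : bv (bpow z k) = bv z ^ k.
Proof. by elim: k => [|k IH] //; rewrite expnS -IH -bmulP. Qed.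
Lemma FP_bpow (z : A -> seq bool) (k : A -> nat) : FP z -> FP k -> FP (fun a => bpow (z a) (k a)).
Proof.
move=> Hz Hk; have P1 := pb_nat Hk; have P2 := pb_size Hz.
apply: (FP_iter (F := fun a => bmul (z a)) (S := fun a => 4 * (k a * (2 * size (z a)) + 1) + 1)) => //.
- exact: FP_const.
- by apply: FP_bmul; [apply: FP_comp Hz; fpp | fpp].
- by pbt.
- move=> a i le; apply: leq_trans (tz_bits _) _; rewrite leq_add2r leq_mul2l /=.
  apply: (@leq_trans (i * (2 * size (z a)) + 1)); last by rewrite leq_add2r leq_mul2r le orbT.
  elim: i {le} => [|i IH] //=; apply: leq_trans (size_bmul _ _) _.
  by rewrite mulSn; lia.
Qed.
End Prod.

(** Any function on a finite alphabet is a look-up in a constant list. *)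
Lemma FP_sym T {eT : Enc T} (f : sym -> T) : FP f.
Proof.
have Hc : FP sym_code by apply: (FP_recast (i := sym_code)) (@FP_id nat _).
have H : FP (fun n => nth (f SBlank) [seq f s | s <- syms] n) by apply: FP_nth; fpp.
by apply: FP_ext (FP_comp Hc H); case.
Qed.

Section Split.
Context (A : Type) {eA : Enc A}.

Definition split_step (sep c : sym) (acc : seq (seq sym)) :=
  if c == sep then [::] :: acc else (c :: head [::] acc) :: behead acc.
Definition split (sep : sym) (s : seq sym) := foldr (split_step sep) [:: [::]] s.

Lemma split_cat sep s t : sep \notin s -> split sep (s ++ sep :: t) = s :: split sep t.
Proof.
elim: s => [|c s IH] /=; first by rewrite /split_step eqxx.
rewrite inE negb_or => /andP[cs /IH ->]; rewrite /split_step eq_sym (negbTE cs) //.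
Qed.

Lemma split_id sep s : sep \notin s -> split sep s = [:: s].
Proof.
elim: s => //= c s IH; rewrite inE negb_or => /andP[cs /IH ->].
by rewrite /split_step eq_sym (negbTE cs).
Qed.

Lemma FP_split sep (s : A -> seq sym) : FP s -> FP (fun a => split sep (s a)).
Proof.
move=> Hs; apply: (FP_foldr_add (F := fun _ => split_step sep) (q := fun z => tz z + 5)) => //; try fpp.
- apply: FP_if; first by apply: FP_comp (FP_sym (fun c => c == sep)); fpp.
    by apply: FP_cons; fpp.
  apply: FP_cons; last by apply: FP_behead; fpp.
  by apply: FP_cons; [fpp | apply: FP_head; fpp].
- by pbt.
- move=> a c acc; rewrite tz_pair /split_step; case: ifP => _.
    by rewrite tz_cons tz_nil; lia.
  case: acc => [|h t]; rewrite /= ?tz_cons ?tz_nil; lia.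
Qed.
End Split.

Definition sym_bit (b : bool) := if b then S1 else S0.
Definition bit_sym (s : sym) := s == S1.
Lemma sym_bitK : cancel sym_bit bit_sym. Proof. by case. Qed.

Lemma bin_fuel_ge f k : k <= f -> bin_fuel f k = bin k.
Proof.
suff H g : k <= f -> k <= g -> bin_fuel f k = bin_fuel g k by move=> le; exact: H.
elim: f g k => [|f IH] [|g] k //=; rewrite ?leqn0; try by [move=> /eqP-> | move=> _ /eqP->].
move=> kf kg; case: (posnP k) => // k0; congr cons.
by apply: IH; lia.
Qed.

(** Stripping high zeros leaves exactly the digits of [bin], so output words are canonical. *)
Lemma bin_bits (x : seq bool) : [seq sym_bit b | b <- bnorm x] = bin (bv x).
Proof.
elim: x => // b x IH; rewrite bnorm_cons.
have E k : 0 < k -> bin k = sym_bit (odd k) :: bin k./2.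
  by case: k => // k _; rewrite {1}/bin /= bin_fuel_ge //; lia.
have := bnorm_eq0 x; case: (bnorm x) IH => [|c s] IH /= /esym z.
  by rewrite (eqP z) /= addn0; case: b.
have x0 : 0 < bv x by case: (bv x) z.
rewrite E; last by lia.
by rewrite oddD odd_double addbF half_bit_double -IH; case: b.
Qed.

Lemma bin_bv k : exists2 x, bin k = [seq sym_bit b | b <- x] & bv x = k.
Proof.
have [n le] := ubnP k; elim: n k le => // n IH k lek.
case: (posnP k) => [->|k0]; first by exists [::].
have [|x e ex] := IH k./2; first by lia.
exists (odd k :: x); last by rewrite /= ex odd_double_half.
rewrite {1}/bin; case: k k0 {lek} e ex => // k _ e ex; rewrite [LHS]/= bin_fuel_ge; last by lia.
by rewrite e.
Qed.

(** * From polynomial-time functions to machines *)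

(** The input arrives without separators. Running past its end materialises three blanks, which turn
    it into a first stack followed by two empty ones. *)
Definition prelude := TSeq (TWhile nb tR) (TSeq tR (TSeq tR (TSeq (TAct (fun x h => (x, h, MStay)))
  (TSeq tL home1)))).

Lemma preludeP (s : seq sym) : filled s ->
  trun prelude (B, [::], s) (8 * size s + 20) (B, [:: B], flat [:: s; [::]; [::]]).
Proof.
move=> fs.
have W : forall t l, filled t -> trun (TWhile nb tR) (B, l, t) (2 * size t + 1) (B, rev t ++ l, [:: B]).
  elim=> [|c t IH] l; first by move=> _; exact: (@tr_stop nb tR (B, l, [::])).
  case/andP=> cB ft; rewrite rev_cons cat_rcons.
  apply: (@tr_go nb tR (B, l, c :: t)) (IH _ ft) _ => //; first exact: trun_R (ltnSn 0).
  by rewrite /=; lia.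
have H1 := W s [::] fs; rewrite cats0 in H1.
have H2 := @trun_R B (rev s) B [::] 1 isT.
have H3 := @tr_act (fun x h => (x, h, MRight)) (B, B :: rev s, [::]) 1 isT.
have H4 := @tr_act (fun x h => (x, h, MStay)) (B, B :: B :: rev s, [::]) 1 isT.
have H5 := @trun_L B (B :: B :: rev s) B [::] 1 isT.
have H6 := @home1P B s [::] B [:: B] fs (erefl _); rewrite rev_rcons cats0 in H6.
rewrite !flat_cons /=.
apply: (tr_seq H1 (tr_seq H2 (tr_seq H3 (tr_seq H4 (tr_seq H5 H6 (leqnn _)) (leqnn _)) (leqnn _)) (leqnn _))); lia.
Qed.

Definition switch (f : sym -> prog) := foldr (fun s p => PIf (fun x => x == s) (f s) p) PSkip syms.

Lemma switchP f x st n m : hrun (f x) (x, st) n m -> hrun (switch f) (x, st) (n + 8) m.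
Proof.
move=> H; rewrite /switch.
suff : forall l, x \in l -> hrun (foldr (fun s p => PIf (fun x => x == s) (f s) p) PSkip l) (x, st) (n + size l) m.
  by move=> /(_ syms) h; apply: hrun_weak (h _) _; [case: (x) | rewrite /=; lia].
elim=> // s l IH; rewrite inE /=; have [e _|ne /= /IH h] := eqVneq x s.
  rewrite -e; apply: hrun_weak (run_if1 (c := fun y => y == x) (m := (x, st)) _ (eqxx x) H) _.
  by lia.
by rewrite addnS; apply: (run_if0 (c := fun x => x == s)).
Qed.

Definition notB (s : sym) := s != B.

(** A list code has its first element on top, so it is built from the last symbol backwards; hence
    the input is first reversed onto stack 1. *)
Definition load := PSeq (PPop 0) (PSeq (PWhile notB (PSeq (switch (fun s => PPush 1 s)) (PPop 0)))
  (PSeq (PPush 0 S0) (PSeq (PPop 1)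
  (PWhile notB (PSeq (switch (fun s => pushw (S1 :: code (enc_sym s)))) (PPop 1)))))).

Lemma load1 s b c : filled s ->
  hrun (PWhile notB (PSeq (switch (fun s => PPush 1 s)) (PPop 0)))
    (head B s, [:: behead s; b; c]) (12 * size s + 1) (B, [:: [::]; rev s ++ b; c]).
Proof.
elim: s b => [|x s IH] b; first by move=> _; exact: run_stop.
case/andP=> xB fs; rewrite rev_cons cat_rcons.
apply: hrun_weak (run_go (n1 := 10) _ _ (IH (x :: b) fs)) _ => //; last by rewrite /=; lia.
apply: hrun_weak (run_seq (switchP (f := fun s => PPush 1 s) (run_push1 _ _ _ _ _)) _) _ => //.
  exact: run_pop0'.
by lia.
Qed.

Lemma code_cons (x : sym) (s : seq sym) :
  code (enc_seq enc_sym (x :: s)) = S1 :: code (enc_sym x) ++ code (enc_seq enc_sym s).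
Proof. by []. Qed.

Lemma size_enc_sym x : size (code (enc_sym x)) <= 13.
Proof. by case: x. Qed.

Lemma load2 s t c : filled s ->
  hrun (PWhile notB (PSeq (switch (fun s => pushw (S1 :: code (enc_sym s)))) (PPop 1)))
    (head B s, [:: code (enc_seq enc_sym t); behead s; c]) (30 * size s + 1)
    (B, [:: code (enc_seq enc_sym (rev s ++ t)); [::]; c]).
Proof.
elim: s t => [|x s IH] t; first by move=> _; exact: run_stop.
case/andP=> xB fs; rewrite rev_cons cat_rcons.
apply: hrun_weak (run_go (n1 := 28) _ _ (IH (x :: t) fs)) _ => //; last by rewrite /=; lia.
have bw : bits (S1 :: code (enc_sym x)) by rewrite /bits /=; exact: bits_code.
have [x' H] := @pushwP _ x (code (enc_seq enc_sym t)) s c bw.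
apply: hrun_weak (run_seq (switchP (f := fun s => pushw (S1 :: code (enc_sym s))) H) _) _.
- by rewrite code_cons; exact: run_pop1'.
- by rewrite /=; have := size_enc_sym x; lia.
Qed.

Lemma loadP s x : filled s -> hrun load (x, [:: s; [::]; [::]]) (50 * size s + 20)
  (B, [:: code (enc_seq enc_sym s); [::]; [::]]).
Proof.
move=> fs; have H1 := @load1 s [::] [::] fs; rewrite cats0 in H1.
have H2 := @load2 (rev s) [::] [::]; rewrite revK cats0 in H2.
apply: hrun_weak (run_seq (run_pop0' _ _ _ _) (run_seq H1 (run_seq (run_push0 _ _ _ _ _) (run_seq (run_pop1' _ _ _ _) (H2 _))))) _ => //.
  by rewrite /filled all_rev.
by rewrite size_rev; lia.
Qed.

(** A symbol is coded by [k] pairs [S1], [S0] closed by a final [S0]; at most 6 pairs occur, hence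
    fuel 7 at its use. A blank cannot be pushed, so [k = 0] pushes nothing. *)
Fixpoint decode (k fuel : nat) : prog :=
  if fuel is f.+1 then
    PSeq (PPop 0) (PIf is1 (PSeq (PPop 0) (decode k.+1 f)) (if nth B syms k == B then PSkip else PPush 1 (nth B syms k)))
  else PSkip.

Definition unload := PSeq (PPop 0) (PSeq (PWhile is1 (PSeq (decode 0 7) (PPop 0)))
  (PSeq (PPop 1) (PWhile notB (PSeq (switch (fun s => PPush 0 s)) (PPop 1))))).

Lemma decodeP x y a b c : x != B -> exists y',
  hrun (decode 0 7) (y, [:: code (enc_sym x) ++ a; b; c]) 40 (y', [:: a; x :: b; c]).
Proof.
move=> xB; exists B; rewrite /decode /=; case: x xB => //= _.
all: apply: hrun_weak; [hsteps | done].
Qed.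

Lemma unload1 s b : filled s ->
  hrun (PWhile is1 (PSeq (decode 0 7) (PPop 0)))
    (head B (code (enc_seq enc_sym s)), [:: behead (code (enc_seq enc_sym s)); b; [::]]) (50 * size s + 1)
    (S0, [:: [::]; rev s ++ b; [::]]).
Proof.
elim: s b => [|x s IH] b; first by move=> _; exact: run_stop.
case/andP=> xB fs; rewrite rev_cons cat_rcons code_cons.
apply: hrun_weak (run_go (n1 := 41) _ _ (IH (x :: b) fs)) _ => //; last by rewrite /=; lia.
have [y' H] := @decodeP x S1 (code (enc_seq enc_sym s)) b [::] xB.
by apply: hrun_weak (run_seq H (run_pop0' _ _ _ _)) _.
Qed.

Lemma unload2 s a : filled s ->
  hrun (PWhile notB (PSeq (switch (fun s => PPush 0 s)) (PPop 1)))
    (head B s, [:: a; behead s; [::]]) (12 * size s + 1) (B, [:: rev s ++ a; [::]; [::]]).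
Proof.
elim: s a => [|x s IH] a; first by move=> _; exact: run_stop.
case/andP=> xB fs; rewrite rev_cons cat_rcons.
apply: hrun_weak (run_go (n1 := 10) _ _ (IH (x :: a) fs)) _ => //; last by rewrite /=; lia.
apply: hrun_weak (run_seq (switchP (f := fun s => PPush 0 s) (run_push0 _ _ _ _ _)) _) _ => //.
  exact: run_pop1'.
by lia.
Qed.

Lemma unloadP s x : filled s ->
  hrun unload (x, [:: code (enc_seq enc_sym s); [::]; [::]]) (80 * size s + 20)
    (B, [:: s; [::]; [::]]).
Proof.
move=> fs; have H1 := @unload1 s [::] fs; rewrite cats0 in H1.
have H2 := @unload2 (rev s) [::]; rewrite revK cats0 in H2.
apply: hrun_weak (run_seq (run_pop0' _ _ _ _) (run_seq H1 (run_seq (run_pop1' _ _ _ _) (H2 _)))) _ => //.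
  by rewrite /filled all_rev.
by rewrite size_rev; lia.
Qed.

Lemma tz_syms (s : seq sym) : tz s <= 14 * size s + 1.
Proof.
elim: s => [|x s IH]; rewrite ?tz_nil ?tz_cons //=.
by have := size_enc_sym x; rewrite /tz /tsz in IH *; lia.
Qed.

(** Arguments are encoded through the string the machine receives, so a polynomial in the size of
    the code is one in the input length. *)
Theorem FP_TM X (inp out : X -> seq sym) :
  FP (eA := fun x => enc_seq enc_sym (inp x)) out ->
  (forall x, filled (inp x)) -> (forall x, filled (out x)) ->
  exists (M : TM) (c : nat), forall x, exists t : nat,
    t <= c * (size (inp x)).+1 ^ c /\
    exists cfg : config M, exec t (init M (inp x)) = Some cfg /\
      exists a b, tape_contents cfg = nseq a B ++ out x ++ nseq b B.
Proof.
pose eX : Enc X := fun x => enc_seq enc_sym (inp x).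
move=> H Hi Ho; have Po : pb (eA := eX) (fun x => size (out x)) by exact: pb_size H.
case: H => [[p [T PT K]]].
pose n x := 50 * size (inp x) + 20 + (T x + (80 * size (out x) + 20)).
pose time x := 8 * size (inp x) + 20 + n x * (40 * (size (inp x) + 3 + n x) + 2).
have Pi : pb (eA := eX) (fun x => size (inp x)).
  apply: (pb_le (g := tz (eA := eX))) => [x|]; last exact: pb_tz.
  exact: ltnW (@tz_size _ enc_sym _).
have [c Hc] : pb (eA := eX) time by rewrite /time /n; pbt.
pose prg := TSeq prelude (cprog (PSeq load (PSeq p unload))).
(* One constant serves as factor and exponent. The [20] absorbs the at most 14 cells of code per
   input symbol and the additive constants. *)
exists (toTM (comp prg)), (20 ^ c + c) => x.
have [y HK] := K x B [::] [::] [::]; rewrite !cats0 in HK.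
have HR : hrun (PSeq load (PSeq p unload)) (B, [:: inp x; [::]; [::]]) (n x) (B, [:: out x; [::]; [::]]).
  exact: run_seq (loadP _ (Hi x)) (run_seq HK (unloadP _ (Ho x))).
have ok : sok (B, [:: inp x; [::]; [::]]) by rewrite /sok /= Hi.
have [|a' HT] := hrun_trun HR ok (M := size (inp x) + 3 + n x) 1 [::].
  by rewrite /ssz /flat /= !size_cat size_rcons /=; lia.
rewrite /tape cats0 in HT.
have HT' := trun_weak (tr_seq (preludeP (Hi x)) HT (leqnn _)) (leqnn (time x)).
have [t lt [q E]] := trun_exec HT'.
exists t; split.
  apply: leq_trans lt _; apply: leq_trans (Hc x) _.
  have tzi : tz (eA := eX) x + 2 <= 20 * (size (inp x)).+1.
    by have := tz_syms (inp x); rewrite /tz /eX /=; lia.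
  apply: (@leq_trans ((20 * (size (inp x)).+1) ^ c)).
    by case: (c) => // c'; rewrite leq_exp2r.
  rewrite expnMn; apply: leq_mul; first exact: leq_addr.
  by rewrite leq_pexp2l // leq_addl.
eexists; split; first exact: E.
(* One separator ends the output, and two more stand for the empty stacks. *)
exists a', 3; rewrite /tape_contents /conf /= cats0 flat_cons /=.
rewrite (_ : rev (nseq a' B) = nseq a' B); last by elim: (a') => // k IH; rewrite rev_cons IH -cats1 -(nseqD k 1) addn1.
by congr (_ ++ _); case: (out x).
Qed.

(** * Counting pairwise interactions by class histograms *)

Fixpoint prs (V : Type) (s : seq V) : seq (V * V) :=
  if s is i :: s' then [seq (i, j) | j <- s'] ++ prs s' else [::].

Section Interaction.
Variables (n : nat) (P : finType) (T Th : eqType).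
Notation V := 'I_n.
Variables (Ts : seq T) (Ths : seq Th) (wt1 : Th -> rat) (wt2 : T -> rat).
Variables (inP : Th -> P) (up : P -> P -> T -> P) (op : T -> T) (ok : P -> bool).
Hypothesis opK : involutive op.
Hypothesis sum_op : forall f : T -> rat, (\sum_(t <- Ts) f (op t) = \sum_(t <- Ts) f t)%R.
Hypothesis wt_op : forall t, wt2 (op t) = wt2 t.
Hypothesis up_static : forall p q r t u, up p (up q r u) t = up p q t.
Hypothesis up_comm : forall p q r t u, up (up p q t) r u = up (up p r u) q t.

Implicit Types (s : {ffun V -> P}) (l : seq (V * V)) (vs : seq V).

(** Both classes are updated from the old state; the second element reads the label with the roles
    exchanged. *)
Definition meet s (ij : V * V) (t : T) : {ffun V -> P} :=
  [ffun v => if v == ij.1 then up (s v) (s ij.2) t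
             else if v == ij.2 then up (s v) (s ij.1) (op t) else s v].

(** Labels are summed pair by pair while the state is carried along: the form that a dynamic program
    evaluates. *)
Fixpoint F l vs s : rat :=
  if l is ij :: l then (\sum_(t <- Ts) wt2 t * F l vs (meet s ij t))%R
  else (\prod_(v <- vs) (ok (s v))%:R)%R.

Definition proper ij := (ij : V * V).1 != ij.2.

Lemma up_meet p s a t v u : up p (meet s a t v) u = up p (s v) u.
Proof. by rewrite ffunE; do 2?case: ifP => _; rewrite ?up_static. Qed.

(** By [up_static] an element's other meetings are invisible to its partner; by [up_comm] its own
    updates commute. *)
Lemma meet_comm s a b t u : meet (meet s a t) b u = meet (meet s b u) a t.
Proof.
apply/ffunP => v; rewrite [LHS]ffunE [RHS]ffunE !up_meet !ffunE.
by do 4?case: ifP => _; rewrite // up_comm.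
Qed.

Lemma meet_flip s i j t : i != j -> meet s (j, i) t = meet s (i, j) (op t).
Proof.
move=> ij; apply/ffunP => v; rewrite !ffunE /= opK.
by case: (eqVneq v j) => [->|//]; rewrite eq_sym (negbTE ij).
Qed.

Lemma F_mid l1 a l2 vs s : F (l1 ++ a :: l2) vs s = F (a :: l1 ++ l2) vs s.
Proof.
elim: l1 s => [|b l IH] s //.
transitivity (\sum_(t <- Ts) \sum_(u <- Ts) wt2 t * (wt2 u * F (l ++ l2) vs (meet (meet s b t) a u)))%R.
  by apply: eq_bigr => t _; rewrite -/F IH /= big_distrr.
rewrite exchange_big /=; apply: eq_bigr => t _; rewrite big_distrr; apply: eq_bigr => u _.
by rewrite (meet_comm s b a) mulrCA.
Qed.

Lemma F_perm l l' vs s : perm_eq l l' -> F l vs s = F l' vs s.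
Proof.
elim: l l' s => [|a l IH] l' s; first by rewrite perm_sym => /perm_nilP->.
move=> pl; have al : a \in l' by rewrite -(perm_mem pl) mem_head.
case/splitPr: al pl => l1 l2 pl; rewrite F_mid.
apply: eq_bigr => t _; congr (_ * _)%R; apply: IH.
by rewrite -(perm_cons a); apply: perm_trans pl _; rewrite -[a :: l2]cat1s perm_catCA.
Qed.

Definition orient (ij : V * V) := if ij.1 < ij.2 then ij else (ij.2, ij.1).

(** Reversing a pair amounts to applying [op] to its label, which permutes the labels and keeps
    their weights. *)
Lemma F_orient l vs s : all proper l -> F (map orient l) vs s = F l vs s.
Proof.
elim: l s => // -[i j] l IH s /= /andP[ij pl].
transitivity (\sum_(t <- Ts) wt2 t * F l vs (meet s (orient (i, j)) t))%R.
  by apply: eq_bigr => t _; rewrite IH.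
rewrite /orient /=; case: ifP => // _.
rewrite -[LHS]sum_op; apply: eq_bigr => t _.
by rewrite wt_op (meet_flip _ _ ij) opK.
Qed.

Lemma prs_proper (r : seq V) : uniq r -> all proper (prs r).
Proof.
elim: r => // i r IH /= /andP[ir ur]; rewrite all_cat IH // andbT.
by apply/allP => _ /mapP[j jr ->]; rewrite /proper /=; apply: contraNneq ir => ->.
Qed.

Lemma mem_orient (r : seq V) i j : uniq r ->
  ((i, j) \in map orient (prs r)) = [&& i < j, i \in r & j \in r].
Proof.
elim: r => [|k r IH] /=; first by rewrite andbF.
case/andP=> kr ur; rewrite map_cat mem_cat IH // !inE.
have -> : ((i, j) \in [seq orient x | x <- [seq (k, j0) | j0 <- r]]) =
    (i < j) && ((i == k) && (j \in r) || (j == k) && (i \in r)).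
  apply/mapP/andP => [[_ /mapP[j0 j0r ->]]|[ij]].
    rewrite /orient /=; have [lt|le] := ltnP k j0 => -[-> ->].
      by rewrite lt eqxx j0r.
    rewrite ltn_neqAle le andbT eqxx j0r orbT; split=> //.
    by apply: contraNneq kr => e; rewrite -(val_inj e).
  case/orP=> /andP[/eqP e r0].
    by exists (k, j); [apply/mapP; exists j | rewrite /orient -e ij].
  exists (k, i); first by apply/mapP; exists i.
  by rewrite /orient /= -e ltnNge ltnW.
have [->|ik] := eqVneq i k; have [->|jk] := eqVneq j k; rewrite ?ltnn ?(negbTE kr) //=;
by rewrite ?andbF ?orbF ?andbT.
Qed.

Lemma uniq_orient (r : seq V) : uniq r -> uniq (map orient (prs r)).
Proof.
elim: r => //= k r IH /andP[kr ur]; rewrite map_cat cat_uniq IH // andbT.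
apply/andP; split.
  rewrite -map_comp map_inj_in_uniq // => i j ir jr /=.
  by rewrite /orient /=; do 2!case: ifP => _; case; congruence.
apply/hasPn => -[i j]; rewrite mem_orient // => /and3P[ij ir jr].
apply/mapP => -[_ /mapP[j0 j0r ->]]; rewrite /orient /=.
by case: ifP => _ [e1 e2]; move: kr; rewrite -?e1 -?e2 ?ir ?jr.
Qed.

(** Reordering the elements only reorders and flips pairs. This frees the automaton to take any
    element next. *)
Lemma F_prs l r r' vs s : perm_eq r r' -> uniq r -> all proper l ->
  F (l ++ prs r) vs s = F (l ++ prs r') vs s.
Proof.
move=> pr ur pl; have ur' : uniq r' by rewrite -(perm_uniq pr).
rewrite -F_orient ?all_cat ?pl ?prs_proper // -[RHS]F_orient ?all_cat ?pl ?prs_proper //.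
apply: F_perm; rewrite !map_cat perm_cat2l; apply: uniq_perm; rewrite ?uniq_orient //.
by move=> [i j]; rewrite !mem_orient // !(perm_mem pr).
Qed.

Lemma F_vs l vs vs' s : perm_eq vs vs' -> F l vs s = F l vs' s.
Proof.
by move=> pv; elim: l s => [|a l IH] s; [exact: perm_big | apply: eq_bigr => t _; rewrite -/F IH].
Qed.

(** Without meetings left, an element has reached its final class; its factor leaves the sum, so the
    automaton may test and forget it. *)
Lemma F_out l i vs s : all (fun a : V * V => (i != a.1) && (i != a.2)) l ->
  F l (i :: vs) s = ((ok (s i))%:R * F l vs s)%R.
Proof.
elim: l s => [|a l IH] s /=; first by rewrite big_cons.
case/andP=> /andP[i1 i2] al; rewrite big_distrr; apply: eq_bigr => t _ /=.
by rewrite IH // ffunE (negbTE i1) (negbTE i2) mulrCA.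
Qed.

Definition rk (p : P) : nat := enum_rank p.
Definition hist (r : seq V) s : seq nat := [seq count (fun v => s v == p) r | p <- enum P].

Lemma rk_lt p : rk p < #|P|. Proof. exact: ltn_ord. Qed.
Lemma nth_rk p p0 : nth p0 (enum P) (rk p) = p. Proof. by rewrite /rk nth_enum_rank. Qed.
Lemma size_hist r s : size (hist r s) = #|P|.
Proof. by rewrite size_map -cardE. Qed.
Lemma nth_hist r s p : nth 0 (hist r s) (rk p) = count (fun v => s v == p) r.
Proof. by rewrite (nth_map p) ?nth_rk // -cardE rk_lt. Qed.

Lemma rk_ind i : i < #|P| -> exists p, i = rk p.
Proof. by move=> lt; exists (enum_val (Ordinal lt)); rewrite /rk enum_valK. Qed.

Lemma rk_inj : injective rk.
Proof. by move=> p q /val_inj /enum_rank_inj. Qed.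

Lemma hist_eq r s (u : seq nat) : size u = #|P| ->
  (forall p, nth 0 u (rk p) = count (fun v => s v == p) r) -> hist r s = u.
Proof.
move=> su H; apply: (@eq_from_nth _ 0); rewrite size_hist // => i /rk_ind[p ->].
by rewrite nth_hist H.
Qed.

Lemma hist_cons v r s : hist (v :: r) s = inc (rk (s v)) (hist r s).
Proof.
apply: hist_eq; rewrite ?size_inc ?size_hist // => p.
by rewrite nth_inc ?size_hist ?rk_lt // nth_hist /= addnC (inj_eq rk_inj) eq_sym.
Qed.

Lemma hist_behead v r s : decr (rk (s v)) (hist (v :: r) s) = hist r s.
Proof.
apply/esym/hist_eq; rewrite ?size_dec ?size_hist // => p.
rewrite nth_dec ?size_hist ?rk_lt // nth_hist /= (inj_eq rk_inj) eq_sym; lia.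
Qed.

Lemma hist_perm r r' s : perm_eq r r' -> hist r s = hist r' s.
Proof. by move=> pr; apply: eq_map => p; apply/permP. Qed.

Lemma hist_in r s s' : {in r, s =1 s'} -> hist r s = hist r s'.
Proof.
move=> e; apply: eq_map => p; apply: eq_in_count => v vr; rewrite e //.
Qed.

Lemma hist_nil s : hist [::] s = nseq #|P| 0.
Proof. by apply: hist_eq; rewrite ?size_nseq // => p; rewrite nth_nseq rk_lt. Qed.

Lemma first_hist0 s : first_pos (hist [::] s) = #|P|.
Proof.
by rewrite hist_nil /first_pos hasNfind ?size_nseq //; apply/hasPn => i /nseqP[->].
Qed.

Lemma first_hist r s : r != [::] -> exists2 j, rk (s j) = first_pos (hist r s) &
  exists r', perm_eq r (j :: r').
Proof.
move=> r0; have h : has (fun n => 0 < n) (hist r s).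
  case: r r0 => // v r _; apply/(has_nthP 0); exists (rk (s v)); first by rewrite size_hist rk_lt.
  by rewrite nth_hist /= eqxx.
have lt := h; rewrite has_find size_hist in lt; have [p ep] := rk_ind lt.
have := nth_find 0 h; rewrite ep nth_hist -has_count => /hasP[j jr /eqP jp].
by exists j; [rewrite jp /first_pos ep | exists (rem j r); exact: perm_to_rem].
Qed.

Variables (i1 : Th -> nat) (i2 : T -> nat) (w : nat -> rat).
Hypothesis w0 : w 0 = 1%R.
Hypothesis w1 : forall t, w (i1 t) = wt1 t.
Hypothesis w2 : forall t, w (i2 t) = wt2 t.

Definition ini_tab := [seq (i1 t, rk (inP t)) | t <- Ths].
Definition up_tab := [seq [seq [seq (i2 t, (rk (up p q t), rk (up q p (op t)))) | t <- Ts]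
  | q <- enum P] | p <- enum P].
Definition ok_tab := [seq ok p | p <- enum P].

Notation mval := (dpval (mstep ini_tab up_tab ok_tab) mterm w).

Lemma up_tabE p q : nth [::] (nth [::] up_tab (rk p)) (rk q) =
  [seq (i2 t, (rk (up p q t), rk (up q p (op t)))) | t <- Ts].
Proof.
have lt r : rk r < size (enum P) by rewrite -cardE rk_lt.
by rewrite /up_tab (nth_map p) // nth_rk (nth_map p) // nth_rk.
Qed.
Lemma ok_tabE p : nth false ok_tab (rk p) = ok p.
Proof. by rewrite (nth_map p) ?nth_rk // -cardE rk_lt. Qed.

Lemma rem_pairs_out (i : V) r : i \notin r -> all (fun a : V * V => (i != a.1) && (i != a.2)) (prs r).
Proof.
elim: r => //= j r IH; rewrite inE negb_or => /andP[ij ir]; rewrite all_cat IH // andbT.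
by apply/allP => _ /mapP[k kr ->] /=; rewrite ij; apply: contraNneq ir => ->.
Qed.

(** Inner loop: [i] has met [r'] and still has to meet [r], and all pairs among the others wait. The
    claim for the [k] others is assumed and applies once [r] is exhausted. *)
Lemma F_mvalC k : (forall r s t, size r = k -> uniq r -> k.+1 ^ 2 <= t ->
    F (prs r) r s = mval t ((0, 0), (hist r s, nseq #|P| 0))) ->
  forall u r r' i s t, size r = u -> size r + size r' = k -> uniq (i :: r ++ r') ->
    u.+1 + k.+1 ^ 2 <= t ->
    F ([seq (i, j) | j <- r] ++ prs (r' ++ r)) (i :: r' ++ r) s =
    mval t ((0, (rk (s i)).+1), (hist r s, hist r' s)).
Proof.
move: (k.+1 ^ 2) => c HB; elim=> [|u IH] r r' i s [|t] // su sk un le.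
  move/size0nil: su => r0; subst r; rewrite /= in un sk *; rewrite cats0.
  have /andP[ir ur] := un.
  (* [i] is finished: its factor [ok] is tested, and a failed test makes both sides zero. *)
  rewrite F_out ?rem_pairs_out // first_hist0 size_hist ltnn ok_tabE.
  rewrite (HB r' s t) //.
  case: (ok _); rewrite ?big_cons big_nil ?mul0r // w0 /= mul1r addr0 hist_nil mul1r //.
have r0 : r != [::] by case: r su {sk un}.
(* The automaton takes the first occupied class; [j] is an element of it, and reordering lets it be
   met first. *)
have [j ej [r1 pr]] := first_hist s r0.
have urr := un; rewrite /= mem_cat negb_or cat_uniq in urr.
case/and3P: urr => /andP[ir ir'] ur /andP[dis ur'].
have sr1 : size r1 = u by have := perm_size pr; rewrite su => -[].
have un1 : uniq (i :: r1 ++ j :: r').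
  rewrite -(perm_uniq (s1 := i :: r ++ r')) // perm_cons.
  apply: perm_trans (_ : perm_eq ((j :: r1) ++ r') _); first by rewrite perm_cat2r.
  by rewrite perm_sym -[j :: r']cat1s perm_catCA.
have prr : perm_eq (r' ++ r) ((j :: r') ++ r1).
  apply: perm_trans (_ : perm_eq (r' ++ j :: r1) _); first by rewrite perm_cat2l.
  by rewrite -[j :: r1]cat1s perm_catCA.
have urr : uniq (r' ++ r) by move: un; rewrite /= uniq_catC => /andP[].
have prop_i (z : seq V) : i \notin z -> all proper [seq (i, j) | j <- z].
  by move=> iz; apply/allP => _ /mapP[v vz ->]; rewrite /proper /=; apply: contraNneq iz => ->.
rewrite (F_prs _ _ prr) ?prop_i // (F_vs _ _ (vs' := i :: (j :: r') ++ r1)) ?perm_cons //.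
rewrite (F_perm (l' := [seq (i, j) | j <- j :: r1] ++ prs ((j :: r') ++ r1))); last first.
  by rewrite perm_cat2r; apply: perm_map.
rewrite [LHS]/= [RHS]/= size_hist -ej rk_lt up_tabE !big_map; apply: eq_bigr => x _ /=.
rewrite w2; congr (_ * _)%R.
have ij : i != j by have := un1; rewrite /= mem_cat inE; case: (eqVneq i j); rewrite ?orbT.
transitivity (mval t ((0, (rk (meet s (i, j) x i)).+1),
    (hist r1 (meet s (i, j) x), hist (j :: r') (meet s (i, j) x)))).
  by apply: (IH r1 (j :: r')) => //; rewrite sr1 /= addnS -addSn -su.
rewrite {2}/meet ffunE /= eqxx.
have [jr1 jr'] : j \notin r1 /\ j \notin r'.
  have := un1; rewrite /= cat_uniq /= => /and3P[_ _ /and3P[]]; rewrite negb_or => /andP[-> _ ->] //.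
have [ir1 _] : i \notin r1 /\ True.
  by have := un1; rewrite /= mem_cat negb_or => /andP[/andP[]].
rewrite (hist_perm s pr) hist_behead hist_cons ffunE /= eq_sym (negbTE ij) eqxx.
have out z : i \notin z -> j \notin z -> hist z (meet s (i, j) x) = hist z s.
  move=> iz jz; apply: hist_in => v vz; rewrite ffunE /=.
  by rewrite (memPn iz v vz) (memPn jz v vz) || (rewrite !ifN //; [apply: contraNneq jz => <- | apply: contraNneq iz => <-]).
by rewrite !out.
Qed.

Lemma F_mvalB k r s t : size r = k -> uniq r -> k.+1 ^ 2 <= t ->
  F (prs r) r s = mval t ((0, 0), (hist r s, nseq #|P| 0)).
Proof.
elim: k r s t => [|k IH] r s t sr ur le.
  move/size0nil: sr => ->; case: t le => // t _.
  by rewrite [RHS]/= /mterm /= first_hist0 size_hist leqnn /= big_nil.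
have r0 : r != [::] by case: r sr {ur}.
have [j ej [r1 pr]] := first_hist s r0.
have sr1 : size r1 = k by have := perm_size pr; rewrite sr => -[].
(* The fuel grows by [2 * k + 3] from [k] to [k + 1] elements, enough for one pick, [k] meetings and
   one test. *)
have {}le : (k.+1 + k.+1 ^ 2).+1 <= t.
  by apply: leq_trans le; rewrite (_ : k.+2 ^ 2 = k.+1 ^ 2 + k.+1 + k.+2) //; [lia | rewrite -!mulnn; lia].
case: t le => // t; rewrite ltnS => le.
rewrite -[prs r]cat0s (F_prs _ _ pr) // (F_vs _ _ pr) cat0s.
rewrite [RHS]/= /mterm /= size_hist -ej leqNgt rk_lt big_cons big_nil addr0 w0 mul1r.
rewrite (hist_perm s pr) hist_behead -(hist_nil s).
have := @F_mvalC k IH _ r1 [::] j s t (erefl _); rewrite cats0 addn0 sr1; apply=> //.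
by rewrite -(perm_uniq pr).
Qed.

Variable all_v : seq V.
Hypothesis uniq_all : uniq all_v.

Definition setv s (v : V) p : {ffun V -> P} := [ffun u => if u == v then p else s u].
Fixpoint F1 (todo : seq V) s : rat :=
  if todo is v :: l then (\sum_(t <- Ths) wt1 t * F1 l (setv s v (inP t)))%R
  else F (prs all_v) all_v s.

(** The histogram records only the elements [r] already labelled; the others enter one at a time. *)
Lemma F1_mval_aux (l r : seq V) s t : perm_eq (l ++ r) all_v -> size l + (size all_v).+1 ^ 2 <= t ->
  F1 l s = mval t ((size l, 0), (hist r s, nseq #|P| 0)).
Proof.
elim: l r s t => [|v l IH] r s t pr le.
  have pr' : perm_eq r all_v := pr.
  by rewrite /= (F_mvalB _ (erefl _) uniq_all le) (hist_perm s pr').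
case: t le => // t le.
rewrite [LHS]/= [RHS]/= !big_map; apply: eq_bigr => x _ /=; rewrite w1; congr (_ * _)%R.
have vr : v \notin r.
  by have := uniq_all; rewrite -(perm_uniq pr) /= mem_cat negb_or => /andP[/andP[]].
rewrite (IH (v :: r) _ t) //; last first.
  by apply: perm_trans pr; rewrite -[v :: r]cat1s perm_catCA.
rewrite hist_cons ffunE eqxx (hist_in (s' := s)) // => u ur; rewrite ffunE.
by case: eqP ur vr => // -> ->.
Qed.

Theorem F1_mval s : F1 all_v s = mval (mfuel (size all_v)) (mstart #|P| (size all_v)).
Proof. by rewrite (@F1_mval_aux _ [::] s _ _ (leqnn _)) ?cats0 // hist_nil. Qed.

Lemma up_tabK p q e : e \in nth [::] (nth [::] up_tab p) q -> e.2.1 < #|P|.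
Proof.
have [lp|] := ltnP p #|P|; last first.
  by move=> le; rewrite [nth [::] up_tab p]nth_default ?nth_nil // size_map -cardE.
have [lq|le] := ltnP q #|P|; last first.
  have [p' ->] := rk_ind lp.
  rewrite [X in nth _ X q](_ : _ = [seq [seq (i2 t, (rk (up p' q t), rk (up q p' (op t)))) | t <- Ts]
     | q <- enum P]).
    by rewrite nth_default // size_map -cardE.
  by rewrite /up_tab (nth_map p') ?nth_rk // -cardE rk_lt.
have [p' ->] := rk_ind lp; have [q' ->] := rk_ind lq; rewrite up_tabE.
by case/mapP=> t _ ->; exact: rk_lt.
Qed.
End Interaction.

(** * Naming quantified subformulas by bits *)

Definition var_code (v : var) : bool := if v is Vx then true else false.
Definition code_var (b : bool) : var := if b then Vx else Vy.
Lemma var_codeK : cancel var_code code_var. Proof. by case. Qed.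
HB.instance Definition _ := Countable.copy var (can_type var_codeK).
Lemma var_enumP : Finite.axiom [:: Vx; Vy]. Proof. by case. Qed.
HB.instance Definition _ := isFinite.Build var var_enumP.

Definition other (v : var) := if v is Vx then Vy else Vx.
Lemma otherK : involutive other. Proof. by case. Qed.

Section Compile.
Variables (m : nat) (ar : 'I_m -> nat).

Definition gpat := {r : 'I_m & (ar r).-tuple var}.

(* Quantifier-free formulas over the atoms and over extra unary predicates
   ("bits"), which will name the quantified subformulas. *)
Inductive qf :=
  | QAtom of gpat
  | QBit of nat & var
  | QNot of qf
  | QAnd of qf & qf.

Fixpoint qev (at_ : gpat -> bool) (bt : nat -> var -> bool) (q : qf) : bool :=
  match q with
  | QAtom p => at_ p
  | QBit j u => bt j u
  | QNot q => ~~ qev at_ bt q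
  | QAnd q r => qev at_ bt q && qev at_ bt r
  end.

Definition mapp (T U : Type) (f : T -> U) (p : {r : 'I_m & (ar r).-tuple T}) :
    {r : 'I_m & (ar r).-tuple U} :=
  Tagged (fun r => (ar r).-tuple U) (map_tuple f (tagged p)).

Lemma mapp_comp (T U W : Type) (f : T -> U) (g : U -> W) p : mapp g (mapp f p) = mapp (g \o f) p.
Proof.
by case: p => r t; rewrite /mapp /=; congr (Tagged _ _); apply: val_inj; rewrite /= -map_comp.
Qed.
Lemma eq_mapp (T U : Type) (f g : T -> U) : f =1 g -> mapp f =1 mapp g.
Proof.
by move=> e [r t]; rewrite /mapp /=; congr (Tagged _ _); apply: val_inj; apply: eq_map.
Qed.
Lemma mapp_id (T : Type) (p : {r : 'I_m & (ar r).-tuple T}) : mapp id p = p.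
Proof. by case: p => r t; rewrite /mapp /=; congr (Tagged _ _); apply: val_inj; rewrite /= map_id. Qed.

Fixpoint swapq (q : qf) : qf :=
  match q with
  | QAtom p => QAtom (mapp other p)
  | QBit j u => QBit j (other u)
  | QNot q => QNot (swapq q)
  | QAnd q r => QAnd (swapq q) (swapq r)
  end.

Lemma eq_qev a1 b1 a2 b2 : a1 =1 a2 -> b1 =2 b2 -> qev a1 b1 =1 qev a2 b2.
Proof. by move=> ea eb; elim=> //= [q ->|q -> r ->]. Qed.

Lemma qev_swap at_ bt q :
  qev at_ bt (swapq q) = qev (fun p => at_ (mapp other p)) (fun j u => bt j (other u)) q.
Proof. by elim: q => //= [q ->|q -> r ->]. Qed.

(* Threshold, body with [y] counted and [x] free, and the formula it names. *)
Definition qdef := (nat * qf * c2form ar)%type.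
Definition mkdef t v q g : qdef := (t, if v is Vy then q else swapq q, FCntGe t v g).

(** [k] is the next free bit. A quantifier over [v] leaves at most [other v] free and becomes a bit
    at that variable. Inner definitions precede outer ones; exact counting takes two bits, for [t]
    and [t + 1]. *)
Fixpoint cmp (f : c2form ar) (k : nat) : qf * seq qdef :=
  match f with
  | FAtom r t => (QAtom (Tagged (fun r => (ar r).-tuple var) t), [::])
  | FNot g => let: (q, D) := cmp g k in (QNot q, D)
  | FAnd g h => let: (q, D) := cmp g k in
      let: (q', D') := cmp h (k + size D) in (QAnd q q', D ++ D')
  | FOr g h => let: (q, D) := cmp g k in
      let: (q', D') := cmp h (k + size D) in (QNot (QAnd (QNot q) (QNot q')), D ++ D')
  | FImp g h => let: (q, D) := cmp g k in
      let: (q', D') := cmp h (k + size D) in (QNot (QAnd q (QNot q')), D ++ D')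
  | FIff g h => let: (q, D) := cmp g k in
      let: (q', D') := cmp h (k + size D) in
      (QAnd (QNot (QAnd q (QNot q'))) (QNot (QAnd q' (QNot q))), D ++ D')
  | FAll v g => let: (q, D) := cmp g k in
      (QNot (QBit (k + size D) (other v)), rcons D (mkdef 1 v (QNot q) (FNot g)))
  | FEx v g => let: (q, D) := cmp g k in
      (QBit (k + size D) (other v), rcons D (mkdef 1 v q g))
  | FCntGe t v g => let: (q, D) := cmp g k in
      (QBit (k + size D) (other v), rcons D (mkdef t v q g))
  | FCntLe t v g => let: (q, D) := cmp g k in
      (QNot (QBit (k + size D) (other v)), rcons D (mkdef t.+1 v q g))
  | FCntEq t v g => let: (q, D) := cmp g k in
      (QAnd (QBit (k + size D) (other v)) (QNot (QBit (k + size D).+1 (other v))),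
       rcons (rcons D (mkdef t v q g)) (mkdef t.+1 v q g))
  end.

Section Semantics.
Variables (n : nat) (om : world ar n) (bt : nat -> 'I_n -> bool).
Implicit Types (a : var -> 'I_n).

Definition inst a (p : gpat) : gatom ar n := mapp a p.
Definition qevw a q := qev (fun p => inst a p \in om) (fun j u => bt j (a u)) q.
Definition asg (e d : 'I_n) (v : var) := if v is Vx then e else d.
Definition tholds a f := holds om (fun v => Some (a v)) f.

Lemma eq_holds f (a b : var -> option 'I_n) : a =1 b -> holds om a f = holds om b f.
Proof.
have U (a' b' : var -> option 'I_n) : a' =1 b' -> forall v d, upd a' v d =1 upd b' v d.
  by move=> e v d u; rewrite /upd e.
elim: f a b => //=.
- by move=> r t a b e; apply: eq_existsb => tt; congr (_ && _); apply: eq_forallb => i; rewrite e.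
- by move=> g IH a b e; rewrite (IH _ _ e).
- by move=> g IH h IH' a b e; rewrite (IH _ _ e) (IH' _ _ e).
- by move=> g IH h IH' a b e; rewrite (IH _ _ e) (IH' _ _ e).
- by move=> g IH h IH' a b e; rewrite (IH _ _ e) (IH' _ _ e).
- by move=> g IH h IH' a b e; rewrite (IH _ _ e) (IH' _ _ e).
- by move=> v g IH a b e; apply: eq_forallb => d; apply: IH; exact: U.
- by move=> v g IH a b e; apply: eq_existsb => d; apply: IH; exact: U.
- by move=> k v g IH a b e; congr (_ <= _); apply: eq_card => d; apply: IH; exact: U.
- by move=> k v g IH a b e; congr (_ <= _); apply: eq_card => d; apply: IH; exact: U.
- by move=> k v g IH a b e; congr (_ == _); apply: eq_card => d; apply: IH; exact: U.
Qed.

Definition count_sat a v g := #|[pred d : 'I_n | tholds (fun u => if var_eqb u v then d else a u) g]|.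

Lemma count_satE a v g :
  #|[pred d : 'I_n | holds om (upd (fun u => Some (a u)) v d) g]| = count_sat a v g.
Proof. by apply: eq_card => d; apply: eq_holds => u; rewrite /upd; case: ifP. Qed.

Lemma tholds_ge a k v g : tholds a (FCntGe k v g) = (k <= count_sat a v g).
Proof. by rewrite /tholds /= count_satE. Qed.
Lemma tholds_le a k v g : tholds a (FCntLe k v g) = ~~ tholds a (FCntGe k.+1 v g).
Proof. by rewrite tholds_ge /tholds /= count_satE -leqNgt. Qed.
Lemma tholds_eq a k v g : tholds a (FCntEq k v g) =
  tholds a (FCntGe k v g) && ~~ tholds a (FCntGe k.+1 v g).
Proof. by rewrite !tholds_ge /tholds /= count_satE -leqNgt andbC -eqn_leq. Qed.
Lemma tholds_ex a v g : tholds a (FEx v g) = tholds a (FCntGe 1 v g).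
Proof.
by rewrite /tholds /= lt0n; apply/existsP/pred0Pn => -[d]; exists d.
Qed.
Lemma tholds_all a v g : tholds a (FAll v g) = ~~ tholds a (FCntGe 1 v (FNot g)).
Proof.
rewrite /tholds /= -leqNgt leqn0; apply/forallP/eqP => [H|/eqP/pred0P H d].
  by apply/eqP/pred0P => d; rewrite /= H.
by have := H d; rewrite /= => /negbFE.
Qed.

Lemma tholds_atom a r (t : (ar r).-tuple var) :
  tholds a (FAtom t) = (inst a (Tagged (fun r => (ar r).-tuple var) t) \in om).
Proof.
rewrite /tholds /=; apply/existsP/idP => [[tt /andP[ttom /forallP E]]|H].
  rewrite /inst /mapp /= (_ : map_tuple a t = tt) //.
  by apply: eq_from_tnth => i; rewrite tnth_map; have /eqP[] := E i.
exists (map_tuple a t); rewrite H; apply/forallP => i; by rewrite tnth_map.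
Qed.

(* Bit [k] of element [e] must agree with the formula it names, resp. satisfy
   its definition. *)
Fixpoint sem (k : nat) (D : seq qdef) : Prop :=
  if D is d :: D then (forall e, bt k e = tholds (fun=> e) d.2) /\ sem k.+1 D else True.
Definition def_val (d : qdef) e := d.1.1 <= #|[pred d' : 'I_n | qevw (asg e d') d.1.2]|.
Fixpoint cons_bits (k : nat) (D : seq qdef) : Prop :=
  if D is d :: D then (forall e, bt k e = def_val d e) /\ cons_bits k.+1 D else True.

Lemma sem_cat k D D' : sem k (D ++ D') <-> sem k D /\ sem (k + size D) D'.
Proof. by elim: D k => [|d D IH] k /=; rewrite ?addn0 ?addnS ?IH ?addSn; tauto. Qed.
Lemma cons_cat k D D' : cons_bits k (D ++ D') <-> cons_bits k D /\ cons_bits (k + size D) D'.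
Proof. by elim: D k => [|d D IH] k /=; rewrite ?addn0 ?addnS ?IH ?addSn; tauto. Qed.

(** The counted variable is overwritten and there is no third one, so the truth value is a property
    of a single element, as a bit must be. *)
Lemma ge_const a t v g : tholds (fun=> a (other v)) (FCntGe t v g) = tholds a (FCntGe t v g).
Proof.
rewrite !tholds_ge; congr (_ <= _); apply: eq_card => d; apply: eq_holds.
by case: v => [] [].
Qed.

Lemma def_valP t v q g e : (forall a, qevw a q = tholds a g) ->
  def_val (mkdef t v q g) e = tholds (fun=> e) (FCntGe t v g).
Proof.
move=> H; rewrite tholds_ge /def_val /mkdef /=; congr (_ <= _); apply: eq_card => d.
rewrite !inE; case: v => /=.
  rewrite /qevw qev_swap -H /qevw; apply: eq_qev => [p|j []] //=.
  by rewrite /inst mapp_comp; congr (_ \in om); apply: eq_mapp => -[].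
by rewrite H; apply: eq_holds => -[].
Qed.

Lemma quantP k D t v q g : (sem k D -> forall a, qevw a q = tholds a g) ->
  (cons_bits k D <-> sem k D) ->
  (sem k (rcons D (mkdef t v q g)) -> forall a,
     bt (k + size D) (a (other v)) = tholds a (FCntGe t v g)) /\
  (cons_bits k (rcons D (mkdef t v q g)) <-> sem k (rcons D (mkdef t v q g))).
Proof.
move=> H E; rewrite -cats1 sem_cat cons_cat /=; split.
  by case=> _ [H2 _] a; rewrite H2 ge_const.
rewrite E; split=> -[S [H2 _]]; split=> //; split=> // e.
  by rewrite H2 (def_valP _ _ _ (H S)).
by rewrite H2 -(def_valP _ _ _ (H S)).
Qed.

(** A body mentions only earlier bits. Inductively, the defining equations therefore have the truth
    values of the named formulas as their only solution. *)
Lemma cmpP f k : (sem k (cmp f k).2 -> forall a, qevw a (cmp f k).1 = tholds a f) /\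
  (cons_bits k (cmp f k).2 <-> sem k (cmp f k).2).
Proof.
elim: f k => /=.
- by move=> r t k; split=> // _ a; rewrite tholds_atom.
- by move=> g IH k; have [] := IH k; case: (cmp g k) => q D /= H E; split=> // S a; rewrite /qevw /= -/(qevw a q) H.
- move=> g IHg h IHh k; have [] := IHg k; case: (cmp g k) => q D /= H E.
  have [] := IHh (k + size D); case: (cmp h _) => q' D' /= H' E'.
  split; last by rewrite sem_cat cons_cat E E'.
  by case/sem_cat=> S S' a; rewrite /qevw /= -!/(qevw a _) H ?H'.
- move=> g IHg h IHh k; have [] := IHg k; case: (cmp g k) => q D /= H E.
  have [] := IHh (k + size D); case: (cmp h _) => q' D' /= H' E'.
  split; last by rewrite sem_cat cons_cat E E'.
  by case/sem_cat=> S S' a; rewrite /qevw /= -!/(qevw a _) H ?H' // negb_and !negbK.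
- move=> g IHg h IHh k; have [] := IHg k; case: (cmp g k) => q D /= H E.
  have [] := IHh (k + size D); case: (cmp h _) => q' D' /= H' E'.
  split; last by rewrite sem_cat cons_cat E E'.
  case/sem_cat=> S S' a; rewrite /qevw /= -!/(qevw a _) H ?H' // negb_and negbK.
  by rewrite /tholds /= implybE.
- move=> g IHg h IHh k; have [] := IHg k; case: (cmp g k) => q D /= H E.
  have [] := IHh (k + size D); case: (cmp h _) => q' D' /= H' E'.
  split; last by rewrite sem_cat cons_cat E E'.
  case/sem_cat=> S S' a; rewrite /qevw /= -!/(qevw a _) H ?H' //.
  by rewrite /tholds /=; do 2!case: (holds _ _ _).
- move=> v g IH k; have [] := IH k; case: (cmp g k) => q D /= H E.
  have [|H1 H2] := @quantP k D 1 v (QNot q) (FNot g) _ E.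
    by move=> S a; rewrite /qevw /= -/(qevw a q) H.
  by split=> // S a; rewrite tholds_all -H1.
- move=> v g IH k; have [] := IH k; case: (cmp g k) => q D /= H E.
  have [H1 H2] := @quantP k D 1 v q g H E.
  by split=> // S a; rewrite tholds_ex -H1.
- move=> t v g IH k; have [] := IH k; case: (cmp g k) => q D /= H E.
  have [H1 H2] := @quantP k D t v q g H E.
  by split=> // S a; rewrite -H1.
- move=> t v g IH k; have [] := IH k; case: (cmp g k) => q D /= H E.
  have [H1 H2] := @quantP k D t.+1 v q g H E.
  by split=> // S a; rewrite tholds_le -H1.
- move=> t v g IH k; have [] := IH k; case: (cmp g k) => q D /= H E.
  have [H1 H2] := @quantP k D t v q g H E.
  have SD d : sem k (rcons D d) -> sem k D by rewrite -cats1 sem_cat => -[].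
  have [H3 H4] := @quantP k (rcons D (mkdef t v q g)) t.+1 v q g (fun S => H (SD _ S)) H2.
  split=> // S a; rewrite tholds_eq -H1 -?H3 ?size_rcons ?addnS //.
  by move: S; rewrite -cats1 sem_cat => -[].
Qed.

End Semantics.
End Compile.

(** * Weighted sums over sets of atoms *)

Section Subsets.
Variables (E : finType) (wE : bool -> E -> rat).
Implicit Types (A B X Y : {set E}) (H : {set E} -> rat).

Definition Ssum A H : rat :=
  (\sum_(X : {set E} | X \subset A) (\prod_(a in A) wE (a \in X) a) * H X)%R.

Lemma Ssum_ext A H H' : (forall X, X \subset A -> H X = H' X) -> Ssum A H = Ssum A H'.
Proof. by move=> e; apply: eq_bigr => X /e->. Qed.

(** Distributivity: subsets of a disjoint union are pairs of subsets, and weights multiply. This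
    splits a sum over worlds into nested sums over cells. *)
Lemma Ssum_union A B (G : {set E} -> {set E} -> rat) : [disjoint A & B] ->
  Ssum (A :|: B) (fun Z => G (Z :&: A) (Z :&: B)) = Ssum A (fun X => Ssum B (fun Y => G X Y)).
Proof.
move=> dis; transitivity (\sum_(X : {set E} | X \subset A) \sum_(Y : {set E} | Y \subset B)
  (\prod_(a in A) wE (a \in X) a) * ((\prod_(a in B) wE (a \in Y) a) * G X Y))%R; last first.
  by apply: eq_bigr => X _; rewrite big_distrr.
have capA (X Y : {set E}) : X \subset A -> Y \subset B -> (X :|: Y) :&: A = X.
  move=> XA YB; apply/setP => a; rewrite !inE.
  have [aX|aX] /= := boolP (a \in X); first exact: (subsetP XA).
  by apply/negP => /andP[/(subsetP YB) aB aA]; move/pred0P/(_ a): dis; rewrite /= aA aB.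
have capB (X Y : {set E}) : X \subset A -> Y \subset B -> (X :|: Y) :&: B = Y.
  move=> XA YB; apply/setP => a; rewrite !inE orbC.
  have [aY|aY] /= := boolP (a \in Y); first exact: (subsetP YB).
  by apply/negP => /andP[/(subsetP XA) aA aB]; move/pred0P/(_ a): dis; rewrite /= aA aB.
rewrite pair_big /Ssum (reindex_onto (fun XY : {set E} * {set E} => XY.1 :|: XY.2)
  (fun Z => (Z :&: A, Z :&: B))) /=; last first.
  by move=> Z ZAB; rewrite -setIUr; apply/setIidPl.
apply: eq_big => [[X Y] /=|[X Y] /= /andP[_ /eqP[e1 e2]]].
  apply/andP/andP => [[_ /eqP[<- <-]]|[XA YB]]; first by rewrite !subsetIr.
  by rewrite capA // capB //; split; first exact: setUSS.
rewrite e1 e2 mulrA; congr (_ * _)%R.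
rewrite (eq_bigl [predU A & B]) => [|a]; last by rewrite !inE.
rewrite bigU //=; congr (_ * _)%R; apply: eq_bigr => a aA; congr (wE _ _).
  by rewrite -{2}e1 !inE aA andbT.
by rewrite -{2}e2 !inE aA andbT.
Qed.

Lemma Ssum_imset (T : finType) (f : T -> E) (A : {set T}) H : {in A &, injective f} ->
  Ssum (f @: A) H =
  (\sum_(t : {set T} | t \subset A) (\prod_(p in A) wE (p \in t) (f p)) * H (f @: t))%R.
Proof.
move=> inj; rewrite /Ssum (reindex_onto (fun t : {set T} => f @: t)
  (fun X => [set p in A | f p \in X])) /=; last first.
  move=> X /subsetP XA; apply/setP => a; apply/imsetP/idP => [[p]|aX].
    by rewrite inE => /andP[_ ?] ->.
  by have /imsetP[p pA e] := XA a aX; exists p; rewrite // inE pA -e.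
have memf (t : {set T}) p : t \subset A -> p \in A -> (f p \in f @: t) = (p \in t).
  move=> tA pA; apply/imsetP/idP => [[q qt e]|pt]; last by exists p.
  by rewrite (inj p q) // (subsetP tA).
apply: eq_big => [t|t /andP[_ /eqP e]].
  apply/andP/idP => [[_ /eqP <-]|tA]; first by apply/subsetP => p; rewrite inE => /andP[].
  rewrite imsetS //; split=> //; apply/eqP/setP => p; rewrite inE.
  by case: (boolP (p \in A)) => [pA|pA] /=; [rewrite memf | apply/esym/negbTE; apply: contra pA; apply: (subsetP tA)].
have tA : t \subset A by rewrite -e; apply/subsetP => p; rewrite inE => /andP[].
congr (_ * _)%R; rewrite big_imset //; apply: eq_bigr => p pA.
by rewrite memf.
Qed.

(** Expansion of a product of binomials; this is how atoms invisible to the formula factor out. *)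
Lemma Ssum_const A c : Ssum A (fun=> c) = ((\prod_(a in A) (wE true a + wE false a)) * c)%R.
Proof.
rewrite /Ssum -big_distrl /=; congr (_ * _)%R.
transitivity (\prod_(a : E) ((if a \in A then wE true a else 0) +
   (if a \in A then wE false a else 1)))%R; last first.
  rewrite [RHS]big_mkcond; apply: eq_bigr => a _; case: ifP => // _; exact: add0r.
rewrite bigA_distr [LHS]big_mkcond; apply: eq_bigr => X _.
case: ifP => XA; last first.
  have /subsetPn[a aX aA] := negbT XA.
  by rewrite (bigD1 a) //= aX (negbTE aA) mul0r.
rewrite [LHS]big_mkcond; apply: eq_bigr => a _.
by case: (boolP (a \in A)) => aA; case: (boolP (a \in X)) => // /(subsetP XA); rewrite (negbTE aA).
Qed.
End Subsets.

Lemma var_eqbC u v : var_eqb u v = var_eqb v u.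
Proof. by case: u v => [] []. Qed.

(** * Worlds extended by bits *)

Section World.
Variables (m : nat) (ar : 'I_m -> nat) (n : nat) (w wbar : 'I_m -> rat).
Notation gat := (gatom ar n).

Lemma card_tag (r : 'I_m) : #|[set g : gat | tag g == r]| = n ^ ar r.
Proof.
rewrite -[in RHS](card_ord n) -card_tuple -(card_imset predT (f := fun t => Tagged (fun r => (ar r).-tuple 'I_n) (t : (ar r).-tuple 'I_n))).
  apply: eq_card => -[r' t]; rewrite inE /=; apply/eqP/imsetP => [e|[t' _ /(congr1 (@tag _ _))] //].
  by subst r'; exists t.
by move=> t t' /eqP; rewrite eq_Tagged => /eqP.
Qed.

Lemma weightE (om : world ar n) :
  weight w wbar om = (\prod_(g : gat) (if g \in om then w (tag g) else wbar (tag g)))%R.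
Proof.
rewrite (partition_big (fun g : gat => tag g) predT) //=; apply: eq_bigr => r _.
rewrite (bigID (fun g => g \in om)) /=; congr (_ * _)%R.
  rewrite (eq_bigr (fun=> w r)) => [|g /andP[/eqP<- ->] //].
  rewrite prodr_const; congr (_ ^+ _)%R; apply: eq_card => g.
  by rewrite !inE unfold_in andbC.
rewrite (eq_bigr (fun=> wbar r)) => [|g /andP[/eqP<- /negbTE->] //].
rewrite prodr_const; congr (_ ^+ _)%R; rewrite -card_tag /Ncount.
rewrite -(cardsID om [set g | tag g == r]).
rewrite (_ : [set g in om | tag g == r] = [set g | tag g == r] :&: om); last first.
  by apply/setP => g; rewrite !inE andbC.
by rewrite addKn; apply: eq_card => g; rewrite !inE unfold_in andbC.
Qed.

Variable (Phi : c2form ar).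
Definition mx := (cmp Phi 0).1.
Definition defs := (cmp Phi 0).2.
Definition nd := size defs.
Definition def0 : qdef ar := (0, QBit ar 0 Vx, Phi).
Definition dnth (j : nat) := nth def0 defs j.

Notation EA := (gat + 'I_nd * 'I_n)%type.
Implicit Types (X : {set EA}).

Definition wE (b : bool) (a : EA) : rat :=
  if a is inl g then if b then w (tag g) else wbar (tag g) else 1%R.

Definition omX X : world ar n := [set g | inl g \in X].
Definition btX X (j : nat) (v : 'I_n) : bool :=
  if insub j is Some i then inr (i, v) \in X else false.
(** The condition is attached to one element, so the requirement on a whole world becomes a product
    over the elements. *)
Definition okw X v : bool :=
  [forall j : 'I_nd, (inr (j, v) \in X) == def_val (omX X) (btX X) (dnth j) v] &&
  qevw (omX X) (btX X) (fun=> v) mx.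

Lemma cons_bitsP om bt k (D : seq (qdef ar)) : cons_bits (n := n) om bt k D <->
  forall i, i < size D -> forall e, bt (k + i) e = def_val om bt (nth def0 D i) e.
Proof.
elim: D k => [|d D IH] k /=; first by split.
rewrite IH; split=> [[H0 H] [|i] lt e|H]; rewrite ?addn0 ?H0 ?addnS -?addSn ?H //.
by split=> [e|i lt e]; [rewrite -[k]addn0 (H 0) | rewrite addSn -addnS (H i.+1)].
Qed.
Lemma semP om bt k (D : seq (qdef ar)) : sem (n := n) om bt k D <->
  forall i, i < size D -> forall e, bt (k + i) e = tholds om (fun=> e) (nth def0 D i).2.
Proof.
elim: D k => [|d D IH] k /=; first by split.
rewrite IH; split=> [[H0 H] [|i] lt e|H]; rewrite ?addn0 ?H0 ?addnS -?addSn ?H //.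
by split=> [e|i lt e]; [rewrite -[k]addn0 (H 0) | rewrite addSn -addnS (H i.+1)].
Qed.

(** [v0] witnesses a nonempty domain; over the empty one the left side would hold in every world. *)
Lemma okw_models X (v0 : 'I_n) : (forall v, okw X v) <->
  (forall j v, (inr (j, v) \in X) = tholds (omX X) (fun=> v) (dnth j).2) /\
  tholds (omX X) (fun=> v0) Phi /\ forall v, tholds (omX X) (fun=> v) Phi.
Proof.
have bE (j : 'I_nd) v : btX X j v = (inr (j, v) \in X) by rewrite /btX valK.
have [E1 E2] := cmpP (omX X) (btX X) Phi 0; rewrite semP cons_bitsP in E2; rewrite semP in E1.
split=> [H|[H1 [_ H2]] v].
  have S : forall i, i < nd -> forall e, btX X (0 + i) e = tholds (omX X) (fun=> e) (dnth i).2.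
    apply/E2 => i lt e; have /andP[/forallP/(_ (Ordinal lt))/eqP <- _] := H e.
    by rewrite -bE.
  have H2 v : tholds (omX X) (fun=> v) Phi by rewrite -(E1 S); have /andP[] := H v.
  by split=> [j v|//]; rewrite -bE (S j).
have S : forall i, i < nd -> forall e, btX X (0 + i) e = tholds (omX X) (fun=> e) (dnth i).2.
  by move=> i lt e; rewrite (bE (Ordinal lt)) H1.
apply/andP; split; last by rewrite [qevw _ _ _ _](E1 S).
by apply/forallP => j; apply/eqP; rewrite -bE; exact: (proj2 E2 S).
Qed.

Lemma holds_free (om : world ar n) (f : c2form ar) (a b : var -> option 'I_n) :
  (forall v, free f v -> a v = b v) -> holds om a f = holds om b f.
Proof.
elim: f a b => /=.
- move=> r t a b H; apply: eq_existsb => tt; congr (_ && _); apply: eq_forallb => i.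
  rewrite H //; apply/hasP; exists (tnth t i); first exact: mem_tnth.
  by case: (tnth t i).
- by move=> g IH a b H; rewrite (IH _ b).
1-4: by move=> g IH h IH' a b H; rewrite (IH _ b) ?(IH' _ b) // => v fv; apply: H; rewrite fv ?orbT.
- move=> v g IH a b H; apply: eq_forallb => d; apply: IH => u fu; rewrite /upd.
  by case: ifP => // vu; apply: H; rewrite var_eqbC vu.
- move=> v g IH a b H; apply: eq_existsb => d; apply: IH => u fu; rewrite /upd.
  by case: ifP => // vu; apply: H; rewrite var_eqbC vu.
- move=> k v g IH a b H; congr (_ <= _); apply: eq_card => d; apply: IH => u fu; rewrite /upd.
  by case: ifP => // vu; apply: H; rewrite var_eqbC vu.
- move=> k v g IH a b H; congr (_ <= _); apply: eq_card => d; apply: IH => u fu; rewrite /upd.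
  by case: ifP => // vu; apply: H; rewrite var_eqbC vu.
- move=> k v g IH a b H; congr (_ == _); apply: eq_card => d; apply: IH => u fu; rewrite /upd.
  by case: ifP => // vu; apply: H; rewrite var_eqbC vu.
Qed.

Lemma models_tholds om (v : 'I_n) : sentence Phi -> models om Phi = tholds om (fun=> v) Phi.
Proof.
by move=> /andP[fx fy]; apply: holds_free => -[]; rewrite ?(negbTE fx) ?(negbTE fy).
Qed.

Lemma WFOMC_okw (v0 : 'I_n) : sentence Phi ->
  WFOMC n Phi w wbar = Ssum wE setT (fun X => (\prod_(v <- enum 'I_n) (okw X v)%:R)%R).
Proof.
move=> sPhi; pose A : {set EA} := inl @: setT; pose C : {set EA} := inr @: setT.
have disAC : [disjoint A & C].
  by apply/pred0P => -[g|b] /=; apply/negP => /andP[/imsetP[x _ e] /imsetP[y _ e']].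
have AC : A :|: C = setT by apply/setP => -[g|b]; rewrite !inE ?imset_f ?orbT.
pose G (X Y : {set EA}) : rat := (\prod_(v <- enum 'I_n) (okw (X :|: Y) v)%:R)%R.
transitivity (Ssum wE (A :|: C) (fun Z => G (Z :&: A) (Z :&: C))); last first.
  by rewrite AC; apply: Ssum_ext => Z _; rewrite /G -setIUr AC setIT.
rewrite Ssum_union // /G.
rewrite Ssum_imset => [|x y _ _ []//]; rewrite /WFOMC big_mkcond.
rewrite [RHS](eq_bigl predT) => [|om]; last by rewrite subsetT.
apply: eq_bigr => om _; rewrite Ssum_imset => [|x y _ _ []//].
rewrite (_ : \prod_(p in setT) wE _ _ = weight w wbar om)%R; last first.
  by rewrite weightE; apply: eq_bigl => g; rewrite inE.
pose X0 (b : {set 'I_nd * 'I_n}) : {set EA} := inl @: om :|: inr @: b.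
have inl0 b g : (inl g \in X0 b) = (g \in om).
  rewrite inE mem_imset => [|x y []//]; rewrite orbC.
  by case: imsetP => // -[].
have inr0 b g : (inr g \in X0 b) = (g \in b).
  rewrite inE orbC mem_imset => [|x y []//]; rewrite orbC.
  by case: imsetP => // -[].
have omE b : omX (X0 b) = om by apply/setP => g; rewrite inE inl0.
(* The bits that tell the truth: the only choice that contributes to the inner sum. *)
pose b0 := [set jv : 'I_nd * 'I_n | tholds om (fun=> jv.2) (dnth jv.1).2].
have okE b : (forall v, okw (X0 b) v) <-> b = b0 /\ models om Phi.
  rewrite (okw_models _ v0) omE; split=> [[H [H' _]]|[-> mo]].
    rewrite (models_tholds _ v0) //; split=> //.
    by apply/setP => -[j v]; rewrite inE -inr0 H.
  split=> [j v|]; first by rewrite inr0 inE.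
  by rewrite -models_tholds //; split=> // v; rewrite -models_tholds.
rewrite -[if _ then _ else _]mulr1 -[X in (_ = _ * X)%R]/(\sum_(t | _) _)%R.
rewrite (bigD1 b0) ?subsetT //= [X in (_ + X)%R]big1 ?addr0; last first.
  move=> b /andP[_ bb0].
  have nok : ~ forall v, okw (X0 b) v by move/okE => [e _]; rewrite e eqxx in bb0.
  have /forallPn[v nv] : ~~ [forall v, okw (X0 b) v] by apply/negP => /forallP.
  by rewrite [X in (_ * X)%R](big_rem v) ?mem_enum //= (negbTE nv) mul0r mulr0.
rewrite [X in (_ * (X * _))%R]big1 ?mul1r //.
case: ifP => mo; rewrite ?mul1r ?mulr1.
  rewrite big1_seq ?mulr1 // => v _; rewrite (_ : okw _ v) //.
  by have /(_ v) := proj2 (okE b0) (conj erefl mo).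
have nok : ~ forall v, okw (X0 b0) v by move/okE => [_]; rewrite mo.
have /forallPn[v nv] : ~~ [forall v, okw (X0 b0) v] by apply/negP => /forallP.
by rewrite (big_rem v) ?mem_enum //= (negbTE nv) mul0r mulr0.
Qed.
End World.

(** * Classes of elements and cells of atoms *)

Section Labels.
Variables (m : nat) (ar : 'I_m -> nat) (Phi : c2form ar) (w wbar : 'I_m -> rat).
Notation pat T := {r : 'I_m & (ar r).-tuple T}.
Notation gpat := (gpat ar).

Definition gsupp (T : finType) (p : pat T) : {set T} := [set u in val (tagged p)].

Lemma gsupp_mapp (T U : finType) (f : T -> U) (p : pat T) : gsupp (mapp f p) = f @: gsupp p.
Proof.
apply/setP => u; rewrite inE /=; apply/mapP/imsetP => -[v vp ->]; exists v => //.
  by rewrite inE.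
by rewrite inE in vp.
Qed.

Lemma mapp_in (T : finType) U (f g : T -> U) (p : pat T) :
  {in gsupp p, f =1 g} -> mapp f p = mapp g p.
Proof.
case: p => r t H; rewrite /mapp /=; congr (Tagged _ _); apply: val_inj => /=.
by apply/eq_in_map => u ut; apply: H; rewrite inE.
Qed.

Notation lp := (gpat + 'I_(nd Phi))%type.
Notation body j := (dnth Phi j).1.2.
Notation thr j := (dnth Phi j).1.1.

Definition pat0 : {set gpat} := [set p | gsupp p == set0].
Definition pat1 : {set lp} := [set l : lp | if l is inl p then gsupp p == [set Vx] else true].
Definition pat2 : {set gpat} := [set p | gsupp p == setT].

(** Unary labels are written with [x], so an atom on [y] alone is renamed before it is read from the
    label of the second element. *)
Definition lab (g : {set gpat}) (x y : {set lp}) (t : {set gpat}) (p : gpat) : bool :=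
  if gsupp p == set0 then p \in g
  else if gsupp p == [set Vx] then inl p \in x
  else if gsupp p == [set Vy] then inl (mapp other p) \in y
  else p \in t.
Definition bitl (x y : {set lp}) (j : nat) (u : var) : bool :=
  if insub j is Some i then inr i \in (if u is Vx then x else y) else false.
(** The case where both variables denote one element: every atom with arguments becomes unary. *)
Definition lab_self (g : {set gpat}) (x : {set lp}) (p : gpat) : bool :=
  if gsupp p == set0 then p \in g else inl (mapp (fun=> Vx) p) \in x.

Definition cl g x y t (j : 'I_(nd Phi)) := qev (lab g x y t) (bitl x y) (body j).
Definition cself g x (j : 'I_(nd Phi)) := qev (lab_self g x) (bitl x x) (body j).

Definition Kc := \max_(d <- defs Phi) d.1.1.
Definition cap (k : nat) : 'I_Kc.+1 := inord (minn Kc k).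
(* The class of an element: its unary atoms and bits, and for each counting
   definition the number of witnesses met so far, capped at the largest
   threshold. *)
Definition cls := ({set lp} * {ffun 'I_(nd Phi) -> 'I_Kc.+1})%type.

(** Of [q] only the unary label is consulted, never the counters. This is what makes meetings
    commute. *)
Definition up g (p q : cls) (t : {set gpat}) : cls :=
  (p.1, [ffun j => cap (p.2 j + cl g p.1 q.1 t j)]).
Definition op (t : {set gpat}) : {set gpat} := [set p | mapp other p \in t].
(** An element may witness its own counting formula, so the counters start with this reflexive
    case. *)
Definition inP g (x : {set lp}) : cls := (x, [ffun j => cap (cself g x j)]).
Definition ok g (p : cls) : bool :=
  [forall j, (inr j \in p.1) == (thr j <= p.2 j)] && qev (lab_self g p.1) (bitl p.1 p.1) (mx Phi).

Definition wl (b : bool) (l : lp) : rat :=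
  if l is inl p then if b then w (tag p) else wbar (tag p) else 1%R.
Definition wt0 (g : {set gpat}) : rat := (\prod_(p in pat0) wl (p \in g) (inl p))%R.
Definition wt1 (x : {set lp}) : rat := (\prod_(l in pat1) wl (l \in x) l)%R.
Definition wt2 (t : {set gpat}) : rat := (\prod_(p in pat2) wl (p \in t) (inl p))%R.
Definition Gs := [seq g : {set gpat} <- enum predT | g \subset pat0].
Definition Ts := [seq t : {set gpat} <- enum predT | t \subset pat2].
Definition Ths := [seq x : {set lp} <- enum predT | x \subset pat1].

Lemma capE k : cap k = minn Kc k :> nat.
Proof. by rewrite inordK // ltnS geq_minl. Qed.
(** [Kc] is the largest threshold, so capping preserves every comparison with a threshold. *)
Lemma leq_thr (j : 'I_(nd Phi)) k : (thr j <= minn Kc k) = (thr j <= k).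
Proof.
have le : thr j <= Kc by rewrite /Kc /dnth (big_nth (def0 Phi)) big_mkord (leq_bigmax j).
by rewrite leq_min le.
Qed.

Lemma mapp_other_K : involutive (@mapp m ar _ _ other).
Proof. by move=> p; rewrite mapp_comp -[RHS]mapp_id; apply: eq_mapp => -[]. Qed.

Lemma opK : involutive op.
Proof. by move=> t; apply/setP => p; rewrite !inE mapp_other_K. Qed.

Lemma gsupp_other p : gsupp (mapp other p) = other @: gsupp p.
Proof. exact: gsupp_mapp. Qed.

Lemma pat2_other p : (mapp other p \in pat2) = (p \in pat2).
Proof.
rewrite !inE gsupp_other; apply/eqP/eqP => e; last first.
  by rewrite e; apply/setP => u; rewrite inE -[u]otherK imset_f.
apply/setP => u; have : other u \in other @: gsupp p by rewrite e.
by rewrite mem_imset ?inE //; exact: inv_inj otherK.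
Qed.

Lemma op_sub t : (op t \subset pat2) = (t \subset pat2).
Proof.
have H : forall t : {set gpat}, t \subset pat2 -> op t \subset pat2.
  by move=> u /subsetP H; apply/subsetP => p; rewrite inE => /H; rewrite pat2_other.
by apply/idP/idP => /H //; rewrite opK.
Qed.

Lemma sum_op (f : {set gpat} -> rat) : (\sum_(t <- Ts) f (op t) = \sum_(t <- Ts) f t)%R.
Proof.
rewrite /Ts !big_filter !big_enum_cond /= [RHS](reindex_inj (inv_inj opK)) /=.
by apply: eq_bigl => t; rewrite op_sub.
Qed.

Lemma wt_op t : wt2 (op t) = wt2 t.
Proof.
rewrite /wt2 (reindex_inj (inv_inj mapp_other_K)) /=; apply: eq_big => [p|p _].
  exact: pat2_other.
by rewrite inE mapp_other_K.
Qed.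

Lemma up_static g p q r t u : up g p (up g q r u) t = up g p q t.
Proof. by []. Qed.
Lemma up_comm g p q r t u : up g (up g p q t) r u = up g (up g p r u) q t.
Proof.
congr pair; apply/ffunP => j; rewrite !ffunE /=; apply: val_inj; rewrite /= !capE; lia.
Qed.

Section Cells.
Variable n : nat.
Notation EA := (gatom ar n + 'I_(nd Phi) * 'I_n)%type.
Implicit Types X Y : {set EA}.

Definition supp (a : EA) : {set 'I_n} :=
  match a with inl g => gsupp g | inr jv => [set jv.2] end.
Definition cell (C : {set 'I_n}) : {set EA} := [set a | supp a == C].

(** Instantiation asks for some element; [v0] supplies it for patterns without arguments. *)
Definition in0 v0 (p : gpat) : EA := inl (inst (fun=> v0) p).
Definition in1 v (l : lp) : EA :=
  match l with inl p => inl (inst (fun=> v) p) | inr j => inr (j, v) end.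
Definition in2 ij (p : gpat) : EA := inl (inst (asg ij.1 ij.2) p).

Lemma cell0E v0 : cell set0 = in0 v0 @: pat0.
Proof.
apply/setP => a; rewrite inE; apply/idP/imsetP => [|[p]].
  case: a => [g|[j v]] /= /eqP e; last by move/setP/(_ v): e; rewrite !inE eqxx.
  exists (mapp (fun=> Vx) g); first by rewrite inE gsupp_mapp e imset0.
  rewrite /in0 /inst mapp_comp -[g in LHS]mapp_id; congr inl; apply: mapp_in.
  by rewrite e => v; rewrite inE.
by rewrite inE => /eqP e ->; rewrite /= gsupp_mapp e imset0.
Qed.

Lemma in0_inj v0 : {in pat0 &, injective (in0 v0)}.
Proof.
move=> p q; rewrite !inE => /eqP ep /eqP eq.
move/(congr1 (fun a : EA => if a is inl g then mapp (fun=> Vx) g else p)) => /=.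
rewrite !mapp_comp => e; rewrite -[p]mapp_id -[q]mapp_id.
rewrite (@mapp_in _ _ id (fun=> Vx) p) ?(@mapp_in _ _ id (fun=> Vx) q) //.
  by rewrite eq => v; rewrite inE.
by rewrite ep => v; rewrite inE.
Qed.

Lemma cell1E v : cell [set v] = in1 v @: pat1.
Proof.
apply/setP => a; rewrite inE; apply/idP/imsetP => [|[p]].
  case: a => [g|[j u]] /= /eqP e; last by move/set1_inj: e => ->; exists (inr j); rewrite ?inE.
  exists (inl (mapp (fun=> Vx) g)); first by rewrite inE gsupp_mapp e imset_set1.
  rewrite /= /inst mapp_comp -[g in LHS]mapp_id; congr inl; apply: mapp_in.
  by rewrite e => u; rewrite inE => /eqP ->.
case: p => [p|j]; rewrite inE; last by move=> _ -> /=.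
by move=> /eqP e -> /=; rewrite gsupp_mapp e imset_set1.
Qed.

Lemma in1_inj v : {in pat1 &, injective (in1 v)}.
Proof.
move=> [p|j] [q|k] //=; last by move=> _ _ [->].
rewrite !inE => /eqP ep /eqP eq.
move/(congr1 (fun a : EA => if a is inl g then mapp (fun=> Vx) g else p)) => /=.
rewrite !mapp_comp => e; congr inl; rewrite -[p]mapp_id -[q]mapp_id.
rewrite (@mapp_in _ _ id (fun=> Vx) p) ?(@mapp_in _ _ id (fun=> Vx) q) //.
  by rewrite eq => u; rewrite inE => /eqP.
by rewrite ep => u; rewrite inE => /eqP.
Qed.

Definition back (i : 'I_n) (v : 'I_n) : var := if v == i then Vx else Vy.

Lemma backK i j : i != j -> forall p : gpat, mapp (back i) (inst (asg i j) p) = p.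
Proof.
move=> ij p; rewrite mapp_comp -[RHS]mapp_id; apply: eq_mapp => -[] /=; rewrite /back ?eqxx //.
by rewrite eq_sym (negbTE ij).
Qed.

Lemma gsupp_inst (a : var -> 'I_n) (p : gpat) : gsupp (inst a p) = a @: gsupp p.
Proof. exact: gsupp_mapp. Qed.

Lemma setT_var : [set: var] = [set Vx; Vy].
Proof. by apply/setP => -[]; rewrite !inE. Qed.

Lemma cell2E i j : i != j -> cell [set i; j] = in2 (i, j) @: pat2.
Proof.
move=> ij; apply/setP => a; rewrite inE; apply/idP/imsetP => [|[p]].
  case: a => [g|[k u]] /= /eqP e; last first.
    by move/(congr1 (fun A : {set 'I_n} => #|A|)): e; rewrite cards1 cards2 ij.
  exists (mapp (back i) g).
    rewrite inE gsupp_mapp e; apply/eqP/setP => u; rewrite inE.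
    by apply/imsetP; case: u; [exists i | exists j]; rewrite ?inE ?eqxx ?orbT // /back ?eqxx // eq_sym (negbTE ij).
  rewrite /in2 /= /inst mapp_comp -[g in LHS]mapp_id; congr inl; apply: mapp_in.
  rewrite e => u; rewrite !inE /back /= => /orP[] /eqP ->; first by rewrite eqxx.
  by rewrite eq_sym (negbTE ij).
rewrite inE => /eqP e -> /=; rewrite gsupp_inst e setT_var imsetU1 imset_set1 //.
Qed.

Lemma in2_inj i j : i != j -> injective (in2 (i, j)).
Proof.
move=> ij p q; move/(congr1 (fun a : EA => if a is inl g then mapp (back i) g else p)) => /=.
by rewrite !backK.
Qed.

Definition rd0 v0 X : {set gpat} := [set p in pat0 | in0 v0 p \in X].
Definition rd1 X v : {set lp} := [set l in pat1 | in1 v l \in X].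
Definition rd2 X ij : {set gpat} := [set p in pat2 | in2 ij p \in X].

Lemma var_set (A : {set var}) : [\/ A = set0, A = [set Vx], A = [set Vy] | A = setT].
Proof.
have E (C : {set var}) : (Vx \in A) = (Vx \in C) -> (Vy \in A) = (Vy \in C) -> A = C.
  by move=> ex ey; apply/setP => -[].
case ex: (Vx \in A); case ey: (Vy \in A).
- by constructor 4; apply: E; rewrite ?ex ?ey !inE.
- by constructor 2; apply: E; rewrite ?ex ?ey !inE.
- by constructor 3; apply: E; rewrite ?ex ?ey !inE.
- by constructor 1; apply: E; rewrite ?ex ?ey !inE.
Qed.

Lemma set_neqs : [/\ ([set Vx] == set0) = false, ([set Vy] == set0) = false,
  ([set Vy] == [set Vx]) = false, ([set: var] == set0) = false &
  (([set: var] == [set Vx]) = false) * (([set: var] == [set Vy]) = false)].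
Proof.
have N (A C : {set var}) v : v \in A -> v \notin C -> (A == C) = false.
  by move=> vA vC; apply/eqP => e; rewrite e (negbTE vC) in vA.
by split; [apply: (N _ _ Vx)|apply: (N _ _ Vy)|apply: (N _ _ Vy)|apply: (N _ _ Vx)
  |split; [apply: (N _ _ Vy)|apply: (N _ _ Vx)]]; rewrite !inE.
Qed.

Lemma in_omX X g : (g \in omX X) = (inl g \in X). Proof. by rewrite inE. Qed.
Lemma in_rd0 v0 X p : (p \in rd0 v0 X) = (gsupp p == set0) && (inl (inst (fun=> v0) p) \in X).
Proof. by rewrite inE inE. Qed.
Lemma in_rd1 X v p : (inl p \in rd1 X v) = (gsupp p == [set Vx]) && (inl (inst (fun=> v) p) \in X).
Proof. by rewrite inE inE. Qed.
Lemma in_rd2 X ij p :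
  (p \in rd2 X ij) = (gsupp p == setT) && (inl (inst (asg ij.1 ij.2) p) \in X).
Proof. by rewrite inE inE. Qed.

(** The four possible supports of a pattern in two variables are the four branches of [lab]. *)
Lemma labP v0 X i j p :
  lab (rd0 v0 X) (rd1 X i) (rd1 X j) (rd2 X (i, j)) p = (inst (asg i j) p \in omX X).
Proof.
have [n1 n2 n3 n4 [n5 n6]] := set_neqs; rewrite /lab in_omX.
case: (var_set (gsupp p)) => e; rewrite e ?eqxx ?n1 ?n2 ?n3 ?n4 ?n5 ?n6.
- rewrite in_rd0 e eqxx /=; congr (inl _ \in X); apply: mapp_in.
  by rewrite e => v; rewrite inE.
- rewrite in_rd1 e eqxx /=; congr (inl _ \in X); apply: mapp_in.
  by rewrite e => v; rewrite inE => /eqP->.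
- rewrite in_rd1 gsupp_other e imset_set1 eqxx /=; congr (inl _ \in X).
  by rewrite /inst mapp_comp; apply: mapp_in; rewrite e => v; rewrite inE => /eqP->.
- by rewrite in_rd2 e eqxx.
Qed.

Lemma lab_selfP v0 X v p : lab_self (rd0 v0 X) (rd1 X v) p = (inst (fun=> v) p \in omX X).
Proof.
rewrite /lab_self in_omX; case: eqP => e.
  rewrite in_rd0 e eqxx /=; congr (inl _ \in X); apply: mapp_in.
  by rewrite e => u; rewrite inE.
rewrite in_rd1 gsupp_mapp.
have -> : [set Vx | _ in gsupp p] = [set Vx].
  apply/setP => u; rewrite !inE; apply/imsetP/eqP => [[? _ ->] //|->].
  by move/eqP/set0Pn: e => [x xp]; exists x.
by rewrite eqxx /=; congr (inl _ \in X); rewrite /inst mapp_comp.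
Qed.

Lemma bitlP X i j k u : bitl (rd1 X i) (rd1 X j) k u = btX X k (asg i j u).
Proof.
rewrite /bitl /btX; case: insubP => // k' _ _.
by case: u; rewrite inE inE.
Qed.

Definition cw X e d (j : nat) := qevw (omX X) (btX X) (asg e d) (body j).

Lemma clP v0 X i j k : cl (rd0 v0 X) (rd1 X i) (rd1 X j) (rd2 X (i, j)) k = cw X i j k.
Proof. by apply: eq_qev => [p|? ?]; [exact: labP | exact: bitlP]. Qed.

Lemma cselfP v0 X v k : cself (rd0 v0 X) (rd1 X v) k = cw X v v k.
Proof.
apply: eq_qev => [p|? ?]; last exact: bitlP.
by rewrite lab_selfP /inst (@eq_mapp _ _ _ _ _ (asg v v)) // => -[].
Qed.

Lemma op_rd2 X i j : op (rd2 X (i, j)) = rd2 X (j, i).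
Proof.
apply/setP => p; rewrite !inE -!/(_ \in pat2).
have := pat2_other p; rewrite !inE => ->; congr (_ && (inl _ \in X)).
by rewrite /inst mapp_comp; apply: eq_mapp => -[].
Qed.
End Cells.
End Labels.

(** * Summation cell by cell *)

Lemma Ssum_set0 (E : finType) (wE : bool -> E -> rat) H : Ssum wE set0 H = H set0.
Proof.
rewrite /Ssum (big_pred1 set0) => [|X]; last by rewrite subset0.
by rewrite big_set0 mul1r.
Qed.

(** A pair is listed once but serves both members, so each element gathers one term from every other
    element. *)
Lemma sum_prs n (r : seq 'I_n) (v : 'I_n) (h : 'I_n -> 'I_n -> nat) : uniq r ->
  \sum_(ij <- prs r) (if v == ij.1 then h ij.1 ij.2 else if v == ij.2 then h ij.2 ij.1 else 0) =
  if v \in r then \sum_(d <- r | d != v) h v d else 0.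
Proof.
elim: r => [|i r IH] /=; first by rewrite big_nil.
case/andP=> ir ur; rewrite big_cat IH // big_map /= big_cons inE.
have [vi|vi] /= := eqVneq v i.
  subst v; rewrite (negbTE ir) addn0 /=.
  rewrite big_seq [RHS]big_seq_cond; apply: eq_bigl => j.
  by case: (boolP (j \in r)) => //= jr; apply/esym; apply: contraNneq ir => <-.
case: (boolP (v \in r)) => vr; last first.
  by rewrite big1_seq ?addn0 // => j /= jr; case: eqP => // e; rewrite e jr in vr.
rewrite (bigD1_seq v) //= eqxx big1 ?addn0 // => j jv.
by rewrite eq_sym (negbTE jv).
Qed.

Section Chain.
Variables (m : nat) (ar : 'I_m -> nat) (Phi : c2form ar) (w wbar : 'I_m -> rat) (n : nat).
Notation EA := (gatom ar n + 'I_(nd Phi) * 'I_n)%type.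
Notation gpat := (gpat ar).
Notation wE := (@wE m ar n w wbar Phi).
Implicit Types X Y Z : {set EA}.
Variables (g : {set gpat}).
Notation P := (cls Phi).
Notation meetg := (meet (up g) (@op m ar)).
Notation Fg := (F (Ts ar) (wt2 Phi w wbar) (up g) (@op m ar) (ok g)).
Notation F1g := (F1 (Ts ar) (Ths Phi) (wt1 w wbar) (wt2 Phi w wbar) (inP g) (up g) (@op m ar) (ok g)).
Implicit Types s : {ffun 'I_n -> P}.

(** The state reached when all pair labels are prescribed: the bridge between a sum over worlds and
    the recursion [F]. *)
Definition foldm (t : 'I_n * 'I_n -> {set gpat}) s l := foldl (fun s ij => meetg s ij (t ij)) s l.
Definition folds (x : 'I_n -> {set gpat + 'I_(nd Phi)}) s l :=
  foldl (fun s v => setv s v (inP g (x v))) s l.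

Lemma foldm_ext t t' s l : {in l, t =1 t'} -> foldm t s l = foldm t' s l.
Proof.
rewrite /foldm; elim: l s => //= ij l IH s e.
rewrite e ?mem_head // IH // => kl h; apply: e; rewrite inE h orbT //.
Qed.
Lemma folds_ext t t' s l : {in l, t =1 t'} -> folds t s l = folds t' s l.
Proof.
rewrite /folds; elim: l s => //= ij l IH s e.
rewrite e ?mem_head // IH // => kl h; apply: e; rewrite inE h orbT //.
Qed.

Definition U1 (l : seq 'I_n) : {set EA} := [set a | has (fun v => supp a == [set v]) l].
Definition U2 (l : seq ('I_n * 'I_n)) : {set EA} :=
  [set a | has (fun ij => supp a == [set ij.1; ij.2]) l].

Lemma mem_rd1 X v l : (l \in rd1 X v) = (l \in pat1 Phi) && (in1 v l \in X).
Proof. by rewrite in_set. Qed.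

Lemma rd1_cap X (C : {set EA}) v : cell Phi [set v] \subset C -> rd1 (X :&: C) v = rd1 X v.
Proof.
move/subsetP=> sub; apply/setP => l; rewrite !mem_rd1 in_setI.
case: (boolP (l \in pat1 Phi)) => //= lp; case: (boolP (in1 v l \in X)) => //= _.
by apply: sub; rewrite cell1E imset_f.
Qed.

Lemma rd2_cap X (C : {set EA}) ij : cell Phi [set ij.1; ij.2] \subset C -> proper ij -> rd2 (X :&: C) ij = rd2 X ij.
Proof.
case: ij => i j /= /subsetP sub ij; apply/setP => p; rewrite !in_rd2 in_setI.
case: eqP => //= e; case: (boolP (_ \in X)) => //= _.
by apply: sub; rewrite cell2E // (imset_f (in2 Phi (i, j))) // inE e.
Qed.

Lemma rd2_imset (ij : 'I_n * 'I_n) (t : {set gpat}) : proper ij -> t \subset pat2 ar -> rd2 (in2 Phi ij @: t : {set EA}) ij = t.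
Proof.
case: ij => i j ij /subsetP tp; apply/setP => p; rewrite in_rd2 -/(in2 Phi (i, j) p).
rewrite mem_imset; last exact: in2_inj.
by case: (boolP (p \in t)) => [/tp|]; rewrite ?andbF // inE => ->.
Qed.

Lemma rd1_imset (v : 'I_n) (x : {set gpat + 'I_(nd Phi)}) : x \subset pat1 Phi -> rd1 (in1 v @: x : {set EA}) v = x.
Proof.
move=> /subsetP xp; apply/setP => l; rewrite mem_rd1.
apply/andP/idP => [[lp /imsetP[l' l'x e]]|lx].
  by rewrite (in1_inj lp (xp _ l'x) e).
by rewrite imset_f // xp.
Qed.

Lemma pair_set (i j k l : 'I_n) : [set i; j] = [set k; l] -> orient (i, j) = orient (k, l).
Proof.
move=> e; have swap (a b : 'I_n) : orient (a, b) = orient (b, a).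
  by rewrite /orient /=; case: ltngtP => // /val_inj->.
have /set2P[hi|hi] : i \in [set k; l] by rewrite -e set21.
  have /set2P[hl|hl] : l \in [set i; j] by rewrite e set22.
    have /set2P[hj|hj] : j \in [set k; l] by rewrite -e set22.
      by subst.
    by subst.
  by subst.
have /set2P[hk|hk] : k \in [set i; j] by rewrite e set21.
  have /set2P[hj|hj] : j \in [set k; l] by rewrite -e set22.
    by subst.
  by subst.
by rewrite hi hk swap.
Qed.

(** Pairs are peeled off one by one. Distinct oriented pairs have disjoint cells, and a subset of a
    cell is the same as a label. *)
Lemma chain2 l vs s : all (@proper n) l -> uniq (map (@orient n) l) ->
  Ssum wE (U2 l) (fun Y => \prod_(v <- vs) (ok g (foldm (rd2 Y) s l v))%:R)%R = Fg l vs s.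
Proof.
elim: l s => [|ij l IH] s.
  by move=> _ _; rewrite (_ : U2 _ = set0) ?Ssum_set0 //; apply/setP => a; rewrite !inE.
case/andP=> pij pl; rewrite map_cons cons_uniq => /andP[nij ul].
have -> : U2 (ij :: l) = cell Phi [set ij.1; ij.2] :|: U2 l by apply/setP => a; rewrite !inE.
pose G X Y := (\prod_(v <- vs) (ok g (foldm (rd2 Y) (meetg s ij (rd2 X ij)) l v))%:R)%R : rat.
rewrite (Ssum_ext wE (H' := fun Z => G (Z :&: cell Phi [set ij.1; ij.2]) (Z :&: U2 l))); last first.
  move=> Z _; pose s1 := meetg s ij (rd2 Z ij).
  suff e : foldm (rd2 Z) s1 l = foldm (rd2 (Z :&: U2 l)) s1 l.
    rewrite /G (rd2_cap Z (subxx _) pij) -/s1 -e; exact: eq_bigr.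
  apply: foldm_ext => kl kll; rewrite rd2_cap //; last exact: (allP pl).
  by apply/subsetP => a; rewrite !inE => ?; apply/hasP; exists kl.
rewrite Ssum_union; last first.
  apply/pred0P => a /=; rewrite !inE; apply/negP => /andP[/eqP e /hasP[kl kll]].
  rewrite e => /eqP e'; case/negP: nij; apply/mapP; exists kl => //.
  by case: ij kl e' {pij G e kll} => [i j] [k k'] /pair_set.
rewrite (Ssum_ext wE (H' := fun X => Fg l vs (meetg s ij (rd2 X ij)))); last first.
  by move=> X _; rewrite -IH.
case: ij pij {nij G} => i j pij; rewrite cell2E // Ssum_imset; last by move=> ? ? _ _; exact: in2_inj.
rewrite [RHS]/= /Ts big_filter big_enum_cond /=; apply: eq_bigr => t tp.
by rewrite rd2_imset.
Qed.

(** The same peeling for the cells of single elements, with the recursion over pairs as the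
    summand. *)
Lemma chain1 l vs s l2 : uniq l ->
  Ssum wE (U1 l) (fun Y => Fg l2 vs (folds (rd1 Y) s l)) =
  foldr (fun v f s => \sum_(t <- Ths Phi) wt1 w wbar t * f (setv s v (inP g t)))%R (Fg l2 vs) l s.
Proof.
elim: l s => [|v l IH] s.
  by move=> _; rewrite (_ : U1 _ = set0) ?Ssum_set0 //; apply/setP => a; rewrite !inE.
case/andP=> vl ul.
have -> : U1 (v :: l) = cell Phi [set v] :|: U1 l by apply/setP => a; rewrite !inE.
pose G X Y := (Fg l2 vs (folds (rd1 Y) (setv s v (inP g (rd1 X v))) l)) : rat.
rewrite (Ssum_ext wE (H' := fun Z => G (Z :&: cell Phi [set v]) (Z :&: U1 l))); last first.
  move=> Z _; rewrite /G rd1_cap // [LHS]/=; congr (F _ _ _ _ _ _ _ _).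
  apply: folds_ext => u ul'; rewrite rd1_cap //.
  by apply/subsetP => a; rewrite !inE => ?; apply/hasP; exists u.
rewrite Ssum_union; last first.
  apply/pred0P => a /=; rewrite !inE; apply/negP => /andP[/eqP e /hasP[u ul']].
  by rewrite e => /eqP/set1_inj vu; rewrite vu ul' in vl.
rewrite (Ssum_ext wE (H' := fun X => foldr (fun v f s => \sum_(t <- Ths Phi) wt1 w wbar t * f (setv s v (inP g t)))%R
   (Fg l2 vs) l (setv s v (inP g (rd1 X v))))); last by move=> X _; rewrite -IH.
rewrite cell1E Ssum_imset; last exact: in1_inj.
rewrite [RHS]/= /Ths big_filter big_enum_cond /=; apply: eq_bigr => t tp.
rewrite rd1_imset //; congr (_ * _)%R; apply: eq_bigr => -[p|j] _ //.
Qed.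

Lemma F1_foldr all_v l s : F1g all_v l s =
  foldr (fun v f s => \sum_(t <- Ths Phi) wt1 w wbar t * f (setv s v (inP g t)))%R (Fg (prs all_v) all_v) l s.
Proof. by elim: l s => //= v l IH s; apply: eq_bigr => t _; rewrite IH. Qed.

Lemma cap_add a b : cap Phi (cap Phi a + b) = cap Phi (a + b).
Proof. by apply: val_inj; rewrite /= !capE; lia. Qed.

(** Unary labels never change, and capping after each step agrees with capping the total; so final
    counters are capped sums. *)
Lemma foldm_acc t x l s (a : 'I_n -> 'I_(nd Phi) -> nat) :
  (forall u, s u = (x u, [ffun j => cap Phi (a u j)])) -> forall u,
  foldm t s l u = (x u, [ffun j => cap Phi (a u j + \sum_(ij <- l)
    (if u == ij.1 then cl g (x ij.1) (x ij.2) (t ij) j : nat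
     else if u == ij.2 then cl g (x ij.2) (x ij.1) (op (t ij)) j : nat else 0))]).
Proof.
elim: l s a => [|ij l IH] s a H u.
  by rewrite /= H; congr pair; apply/ffunP => j; rewrite !ffunE big_nil addn0.
rewrite /foldm /= -/(foldm _ _ _).
rewrite (IH _ (fun u j => a u j + (if u == ij.1 then cl g (x ij.1) (x ij.2) (t ij) j : nat
     else if u == ij.2 then cl g (x ij.2) (x ij.1) (op (t ij)) j : nat else 0))).
  by congr pair; apply/ffunP => j; rewrite !ffunE big_cons addnA.
move=> v; rewrite ffunE /up !H /=; case: (eqVneq v ij.1) => [->|_].
  by congr pair; apply/ffunP => j; rewrite !ffunE cap_add.
case: (eqVneq v ij.2) => [->|_].
  by congr pair; apply/ffunP => j; rewrite !ffunE cap_add.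
by congr pair; apply/ffunP => j; rewrite !ffunE addn0.
Qed.

Lemma foldsE x s l v : v \in l -> folds x s l v = inP g (x v).
Proof.
elim/last_ind: l => // l u IH; rewrite /folds -cats1 foldl_cat /= ffunE mem_cat inE.
by case: eqP => [->//|_]; rewrite orbF => /IH.
Qed.
End Chain.

Section Total.
Variables (m : nat) (ar : 'I_m -> nat) (Phi : c2form ar) (w wbar : 'I_m -> rat) (n : nat).
Notation EA := (gatom ar n + 'I_(nd Phi) * 'I_n)%type.
Notation gpat := (gpat ar).
Notation wE := (@wE m ar n w wbar Phi).
Implicit Types X Y Z : {set EA}.
Notation all_v := (enum 'I_n).
Notation P := (cls Phi).

Definition s0 : {ffun 'I_n -> P} := [ffun=> (set0, [ffun=> ord0])].

(** After all meetings a counter holds the capped number of witnesses: the reflexive one, then one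
    term per other element. *)
Lemma okwE (v0 v : 'I_n) Z : okw Z v =
  ok (rd0 v0 Z) (foldm (rd0 v0 Z) (rd2 Z) (folds (rd0 v0 Z) (rd1 Z) s0 all_v) (prs all_v) v).
Proof.
set g := rd0 v0 Z.
rewrite (@foldm_acc _ _ _ _ g (rd2 Z) (rd1 Z) (prs all_v) _ (fun u j => cself g (rd1 Z u) j)); last first.
  by move=> u; rewrite foldsE ?mem_enum.
have acc j : cself g (rd1 Z v) j + \sum_(ij <- prs all_v)
    (if v == ij.1 then cl g (rd1 Z ij.1) (rd1 Z ij.2) (rd2 Z ij) j : nat
     else if v == ij.2 then cl g (rd1 Z ij.2) (rd1 Z ij.1) (op (rd2 Z ij)) j : nat else 0) =
    #|[pred d | cw Z v d (j : 'I_(nd Phi))]|.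
  rewrite (eq_bigr (fun ij : 'I_n * 'I_n => if v == ij.1 then cw Z ij.1 ij.2 j : nat
     else if v == ij.2 then cw Z ij.2 ij.1 j : nat else 0)); last first.
    by move=> [i k] _ /=; rewrite op_rd2 !clP.
  rewrite (sum_prs v (fun e d => cw Z e d j)) ?enum_uniq // mem_enum cselfP.
  rewrite -sum1_card [RHS]big_mkcond /= [RHS](bigD1 v) //= big_enum_cond /=; congr (_ + _).
rewrite /okw /ok; congr (_ && _).
  apply: eq_forallb => j; rewrite ffunE acc capE leq_thr; congr (_ == _).
  by rewrite mem_rd1 !inE.
apply: eq_qev => [p|j u]; first by rewrite lab_selfP.
by rewrite bitlP; congr (btX _ _ _); case: u.
Qed.

(* Atoms on at least three elements: no quantifier-free formula in [x], [y] sees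
   them, so each contributes the factor [w + wbar]. *)
Definition rest : {set EA} := [set a | 2 < #|supp a|].
Definition restfactor : rat := (\prod_(a in rest) (wE true a + wE false a))%R.

(** Supports have size 0, 1, 2 or at least 3. *)
Lemma cover : setT = cell Phi set0 :|: (U1 Phi all_v :|: (U2 Phi (prs all_v) :|: rest)) :> {set EA}.
Proof.
apply/setP => a; rewrite in_setT !in_setU; apply/esym.
case: (ltnP 2 #|supp a|) => [a2|le2].
  by have -> : a \in rest by [rewrite inE]; rewrite !orbT.
case: (ltnP 1 #|supp a|) => [lt1|le1].
  have /cards2P[i [j [ij e]]] : #|supp a| == 2 by rewrite eqn_leq le2.
  suff -> : a \in U2 Phi (prs all_v) by rewrite !orbT.
  suff [k [l [p kl]]] : exists k l : 'I_n, [set i; j] = [set k; l] /\ k < l.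
    have : (k, l) \in map (@orient n) (prs all_v) by rewrite mem_orient ?enum_uniq ?mem_enum ?kl.
    case/mapP=> -[k' l'] kl' e2; rewrite inE; apply/hasP; exists (k', l') => //=; rewrite e p.
    by move: e2; rewrite /orient /=; case: ifP => _ [-> ->] //; rewrite setUC.
  move: ij; rewrite neq_ltn => /orP[lt|lt]; [exists i, j | exists j, i]; split=> //.
  by rewrite setUC.
case: (posnP #|supp a|) => [/cards0_eq s0|p0].
  by have -> : a \in cell Phi set0 by [rewrite inE s0].
have /cards1P[v e] : #|supp a| == 1 by rewrite eqn_leq le1.
have -> : a \in U1 Phi all_v; last by rewrite orbT.
by rewrite inE; apply/hasP; exists v; rewrite ?mem_enum //= e.
Qed.

Lemma card_U1 l (a : EA) : a \in U1 Phi l -> #|supp a| = 1.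
Proof. by rewrite inE => /hasP[v _ /eqP ->]; rewrite cards1. Qed.
Lemma card_U2 l (a : EA) : all (@proper n) l -> a \in U2 Phi l -> #|supp a| = 2.
Proof. by move=> pl; rewrite inE => /hasP[[i j] /(allP pl)]; rewrite /proper /= => ij /eqP ->; rewrite cards2 ij. Qed.
Lemma card_cell0 (a : EA) : a \in cell Phi set0 -> #|supp a| = 0.
Proof. by rewrite inE => /eqP ->; rewrite cards0. Qed.

Lemma disj_rest : [disjoint U2 Phi (prs all_v) & rest].
Proof.
apply/pred0P => a /=; apply/negP => /andP[/card_U2 h]; rewrite inE h //.
by rewrite prs_proper ?enum_uniq.
Qed.
Lemma disj1 : [disjoint U1 Phi all_v & U2 Phi (prs all_v) :|: rest].
Proof.
apply/pred0P => a /=; apply/negP => /andP[/card_U1 h]; rewrite in_setU => /orP[/card_U2 h2|].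
  by move: h; rewrite h2 // prs_proper ?enum_uniq.
by rewrite inE h.
Qed.
Lemma disj0 : [disjoint cell Phi set0 & U1 Phi all_v :|: (U2 Phi (prs all_v) :|: rest)].
Proof.
apply/pred0P => a /=; apply/negP => /andP[/card_cell0 h]; rewrite !in_setU => /orP[/card_U1|/orP[/card_U2|]].
- by rewrite h.
- by rewrite h prs_proper ?enum_uniq // => /(_ isT).
- by rewrite inE h.
Qed.

Notation F1g g := (F1 (Ts ar) (Ths Phi) (wt1 w wbar) (wt2 Phi w wbar) (inP g) (up g) (@op m ar) (ok g)).

(** Nullary atoms affect how every other cell is read, so they are summed outermost; the cells of
    elements, of pairs and of larger supports follow inside. *)
Theorem wfomc_sum (v0 : 'I_n) : sentence Phi -> WFOMC n Phi w wbar =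
  (\sum_(g <- Gs ar) wt0 Phi w wbar g * (F1g g all_v all_v s0 * restfactor))%R.
Proof.
move=> sPhi; rewrite (WFOMC_okw _ _ v0) //.
pose K2 g x Y : rat := (\prod_(v <- all_v) (ok g (foldm g (rd2 Y) (folds g x s0 all_v) (prs all_v) v))%:R)%R.
pose K1 g X Y := K2 g (rd1 X) (Y : {set EA}).
have pp : all (@proper n) (prs all_v) by rewrite prs_proper ?enum_uniq.
have H1 g : Ssum wE (U1 Phi all_v :|: (U2 Phi (prs all_v) :|: rest)) (fun Z => K1 g Z Z) =
    (F1g g all_v all_v s0 * restfactor)%R.
  pose G X Y := K1 g X (Y : {set EA}).
  rewrite (Ssum_ext wE (H' := fun Z => G (Z :&: U1 Phi all_v) (Z :&: (U2 Phi (prs all_v) :|: rest)))); last first.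
    move=> Z _; rewrite /G /K1 /K2.
    rewrite (folds_ext g (t' := rd1 (Z :&: U1 Phi all_v))); last first.
      move=> v vl; rewrite rd1_cap //; apply/subsetP => a; rewrite inE => e.
      by rewrite inE; apply/hasP; exists v.
    apply: eq_bigr => v _; rewrite (foldm_ext g (t' := rd2 (Z :&: (U2 Phi (prs all_v) :|: rest)))) //.
    move=> ij ijl; rewrite rd2_cap ?(allP pp) //; apply/subsetP => a; rewrite inE => e.
    by rewrite in_setU inE; apply/orP; left; apply/hasP; exists ij.
  rewrite (Ssum_union _ _ disj1).
  pose G2 X Y := (\prod_(v <- all_v) (ok g (foldm g (rd2 Y) (folds g (rd1 (X : {set EA})) s0 all_v) (prs all_v) v))%:R : rat)%R.
  rewrite (Ssum_ext wE (H' := fun X =>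
     (restfactor * F (Ts ar) (wt2 Phi w wbar) (up g) (@op m ar) (ok g) (prs all_v) all_v (folds g (rd1 X) s0 all_v))%R)); last first.
    move=> X _; rewrite (Ssum_ext wE (H' := fun Z => (fun A _ => G2 X A) (Z :&: U2 Phi (prs all_v)) (Z :&: rest))); last first.
      move=> Z _; rewrite /G /K1 /K2 /G2; apply: eq_bigr => v _.
      rewrite (foldm_ext g (t' := rd2 (Z :&: U2 Phi (prs all_v)))) //.
      move=> ij ijl; rewrite rd2_cap ?(allP pp) //; apply/subsetP => a; rewrite inE => e.
      by rewrite inE; apply/hasP; exists ij.
    rewrite (Ssum_union _ (fun A _ => G2 X A) disj_rest).
    rewrite (Ssum_ext wE (H' := fun A => (restfactor * G2 X A)%R)); last by move=> A _; rewrite Ssum_const.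
    rewrite -chain2 ?uniq_orient ?enum_uniq // /Ssum big_distrr; apply: eq_bigr => A _ /=.
    by rewrite mulrCA.
  rewrite F1_foldr -chain1 ?enum_uniq // [RHS]mulrC /Ssum big_distrr; apply: eq_bigr => A _ /=.
  by rewrite mulrCA.
pose G X Y := K1 (rd0 v0 (X : {set EA})) Y (Y : {set EA}).
rewrite cover (Ssum_ext wE (H' := fun Z => G (Z :&: cell Phi set0) (Z :&: (U1 Phi all_v :|: (U2 Phi (prs all_v) :|: rest))))); last first.
  move=> Z _; set C := _ :|: _; rewrite /G.
  have -> : rd0 v0 (Z :&: cell Phi set0) = rd0 v0 Z.
    apply/setP => p; rewrite !in_rd0 in_setI; case: (boolP (gsupp p == set0)) => //= p0.
    by rewrite [X in _ && X](_ : _ = true) ?andbT // (cell0E Phi v0) (imset_f (in0 Phi v0)) // inE.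
  rewrite /K1 /K2; apply: eq_bigr => v _; rewrite (okwE v0).
  rewrite (folds_ext _ (t' := rd1 (Z :&: C))); last first.
    move=> u ul; rewrite rd1_cap //; apply/subsetP => a; rewrite inE => e.
    by rewrite /C !in_setU [a \in U1 _ _]inE; apply/orP; left; apply/hasP; exists u.
  rewrite (foldm_ext _ (t' := rd2 (Z :&: C))) //.
  move=> ij ijl; rewrite rd2_cap ?(allP pp) //; apply/subsetP => a; rewrite inE => e.
  by rewrite /C !in_setU [a \in U2 _ _]inE; apply/orP; right; apply/orP; left; apply/hasP; exists ij.
rewrite (Ssum_union _ _ disj0).
rewrite (Ssum_ext wE (H' := fun X => (F1g (rd0 v0 X) all_v all_v s0 * restfactor)%R)); last first.
  by move=> X _; rewrite -H1.
rewrite (cell0E Phi v0) Ssum_imset; last exact: in0_inj.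
rewrite /Gs big_filter big_enum_cond /=; apply: eq_bigr => t /subsetP tp.
suff -> : rd0 v0 (in0 Phi v0 @: t) = t by [].
apply/setP => p; rewrite in_rd0 -/(in0 Phi v0 p).
apply/andP/idP => [[p0 /imsetP[q qt e]]|pt].
  have pp0 : p \in pat0 ar by rewrite inE.
  by rewrite (in0_inj pp0 (tp _ qt) e).
by have := tp _ pt; rewrite inE => ->; rewrite imset_f.
Qed.
End Total.

(** * Atoms on three or more elements *)

(** The number of unordered pairs, written as a sum to avoid division. *)
Definition tri (n : nat) := foldr addn 0 (iota 0 n).

Lemma size_prs (V : Type) (s : seq V) : size (prs s) = tri (size s).
Proof.
have E k : tri k.+1 = k + tri k.
  have H : forall l i, foldr addn i l = i + foldr addn 0 l.
    by elim=> [|j l IH] i /=; [rewrite addn0 | rewrite IH addnCA].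
  by rewrite /tri -[k.+1]addn1 iotaD foldr_cat H /= addn0 add0n.
by elim: s => // i s IH; rewrite [LHS]/= size_cat size_map IH E.
Qed.

Section Count.
Variables (m : nat) (ar : 'I_m -> nat) (Phi : c2form ar) (n : nat).
Notation EA := (gatom ar n + 'I_(nd Phi) * 'I_n)%type.
Notation all_v := (enum 'I_n).
Implicit Types (r : 'I_m).

Definition isr r (a : EA) : bool := if a is inl g then tag g == r else false.
Definition cnt r (A : {set EA}) := \sum_(a in A) isr r a.
Definition lpr r (l : gpat ar + 'I_(nd Phi)) : bool := if l is inl p then tag p == r else false.
Definition c0 r := \sum_(p in pat0 ar) (tag p == r).
Definition c1 r := \sum_(l in pat1 Phi) lpr r l.
Definition c2 r := \sum_(p in pat2 ar) (tag p == r).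
(** Counted by complement: the number of atoms of [r] in the cell of one element, or of one pair,
    does not depend on the domain. *)
Definition rest_count r k := k ^ ar r - (c0 r + (k * c1 r + tri k * c2 r)).

Lemma cntU r (A B : {set EA}) : [disjoint A & B] -> cnt r (A :|: B) = cnt r A + cnt r B.
Proof.
move=> dis; rewrite /cnt (eq_bigl [predU A & B]) => [|a]; last by rewrite !inE.
by rewrite bigU.
Qed.

Lemma cntT r : cnt r setT = n ^ ar r.
Proof.
rewrite -card_tag /cnt (eq_bigl predT) => [|a]; last by rewrite inE.
rewrite big_sumType /= [X in _ + X]big1 // addn0 -sum1_card big_mkcond /=.
by rewrite [RHS]big_mkcond; apply: eq_bigr => g _; rewrite inE; case: eqP.
Qed.

Lemma cnt_U1 r l : uniq l -> cnt r (U1 Phi l) = size l * c1 r.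
Proof.
elim: l => [|v l IH] /=.
  by move=> _; rewrite mul0n /cnt big1 // => a; rewrite inE.
case/andP=> vl ul; rewrite (_ : U1 _ _ = cell Phi [set v] :|: U1 Phi l); last first.
  by apply/setP => a; rewrite !inE.
rewrite cntU; last first.
  apply/pred0P => a /=; rewrite !inE; apply/negP => /andP[/eqP e /hasP[u ul']].
  by rewrite e => /eqP/set1_inj vu; rewrite vu ul' in vl.
rewrite IH // mulSn; congr (_ + _); rewrite /cnt cell1E big_imset /=; last exact: in1_inj.
by apply: eq_bigr => -[].
Qed.

Lemma cnt_U2 r l : all (@proper n) l -> uniq (map (@orient n) l) ->
  cnt r (U2 Phi l) = size l * c2 r.
Proof.
elim: l => [|ij l IH].
  by move=> _; rewrite mul0n /cnt big1 // => a; rewrite inE.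
case/andP=> pij pl; rewrite map_cons cons_uniq => /andP[nij ul].
rewrite (_ : U2 _ _ = cell Phi [set ij.1; ij.2] :|: U2 Phi l); last by apply/setP => a; rewrite !inE.
rewrite cntU; last first.
  apply/pred0P => a /=; rewrite !inE; apply/negP => /andP[/eqP e /hasP[kl kll]].
  rewrite e => /eqP e'; case/negP: nij; apply/mapP; exists kl => //.
  by case: ij kl e' {pij e kll} => [i j] [k k'] /pair_set.
rewrite IH // mulSn; congr (_ + _); case: ij pij {nij} => i j pij.
rewrite /cnt cell2E // big_imset //=.
by move=> ? ? _ _; exact: in2_inj.
Qed.

Variable v0 : 'I_n.

Lemma cnt_rest r : cnt r (rest Phi n) = rest_count r n.
Proof.
rewrite /rest_count -cntT cover (cntU _ (@disj0 _ _ Phi n)) (cntU _ (@disj1 _ _ Phi n)).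
rewrite (cntU _ (@disj_rest _ _ Phi n)) cnt_U1 ?enum_uniq //.
rewrite cnt_U2 ?prs_proper ?uniq_orient ?enum_uniq // size_prs size_enum_ord.
suff -> : cnt r (cell Phi set0) = c0 r by lia.
rewrite /cnt (cell0E Phi v0) big_imset //=; exact: in0_inj.
Qed.

Variables (w wbar : 'I_m -> rat).

Lemma restfactorE : restfactor Phi w wbar n = (\prod_r (w r + wbar r) ^+ rest_count r n)%R.
Proof.
rewrite /restfactor.
transitivity (\prod_(a in rest Phi n) \prod_r (if isr r a then w r + wbar r else 1))%R.
  apply: eq_bigr => -[g|[j v]]; rewrite inE /=; last by rewrite cards1.
  move=> _; rewrite (bigD1 (tag g)) //= eqxx big1 ?mulr1 // => r.
  by rewrite eq_sym => /negbTE->.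
rewrite exchange_big /=; apply: eq_bigr => r _; rewrite -cnt_rest /cnt.
rewrite -big_mkcondr prodr_const; congr (_ ^+ _)%R.
by rewrite -sum1_card big_mkcondr.
Qed.
End Count.

(** In every world the two exponents of [r] add up to the number of its ground atoms, so the scaling
    factor is the same for all worlds. *)
Lemma WFOMC_scale m (ar : 'I_m -> nat) n (Phi : c2form ar) (w wbar D : 'I_m -> rat) :
  WFOMC n Phi (fun r => w r * D r)%R (fun r => wbar r * D r)%R =
  ((\prod_r D r ^+ (n ^ ar r)) * WFOMC n Phi w wbar)%R.
Proof.
rewrite /WFOMC big_distrr; apply: eq_bigr => om _ /=; rewrite /weight -big_split /=.
apply: eq_bigr => r _; rewrite !exprMn.
have le : Ncount r om <= n ^ ar r.
  by rewrite -card_tag; apply: subset_leq_card; apply/subsetP => g; rewrite !inE => /andP[].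
rewrite (_ : D r ^+ (n ^ ar r) = D r ^+ Ncount r om * D r ^+ (n ^ ar r - Ncount r om))%R.
  by ring.
by rewrite -exprD subnKC.
Qed.

(** * The integer-weighted count *)

Section Total.
Context (X : Type) {eX : Enc X}.
Variables (m : nat) (ar : 'I_m -> nat) (Phi : c2form ar).
Variables (n : X -> nat) (W Wb : 'I_m -> X -> bint).
Hypotheses (Hn : FP n) (HW : forall r, FP (W r)) (HWb : forall r, FP (Wb r)).
Notation lp := (gpat ar + 'I_(nd Phi))%type.

Definition lw (b : bool) (l : lp) (x : X) : bint :=
  if l is inl p then if b then W (tag p) x else Wb (tag p) x else vone.
Definition mono0 (g : {set gpat ar}) x := vprod [seq lw (p \in g) (inl p) x | p <- enum (pat0 ar)].
Definition mono1 (t : {set lp}) x := vprod [seq lw (l \in t) l x | l <- enum (pat1 Phi)].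
Definition mono2 (t : {set gpat ar}) x := vprod [seq lw (p \in t) (inl p) x | p <- enum (pat2 ar)].
(* Entry 0 is the weight of the moves of [mstep] that make no choice. *)
Definition table x := vone :: [seq mono1 t x | t <- enum {set lp}] ++
  [seq mono2 t x | t <- enum {set gpat ar}].
Definition i1 (t : {set lp}) := (index t (enum {set lp})).+1.
Definition i2 (t : {set gpat ar}) := (#|{set lp}| + index t (enum {set gpat ar})).+1.

Definition run_g (g : {set gpat ar}) : X -> bint :=
  mrun #|{: cls Phi}| (ini_tab (Ths Phi) (inP (Phi := Phi) g) i1)
    (up_tab (Ts ar) (up (Phi := Phi) g) (@op m ar) i2) (ok_tab (ok (Phi := Phi) g)) n table.
Definition total1 x := vmul (vsum [seq vmul (mono0 g x) (run_g g x) | g <- Gs ar])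
  (vprod [seq vpow (vadd (W r x) (Wb r x)) (rest_count Phi r (n x)) | r <- enum 'I_m]).
(** Over the empty domain the worlds form a fixed finite set, so the sum is written out. *)
Definition total0 x := vsum [seq vprod [seq vmul (vpow (W r x) (Ncount r om))
    (vpow (Wb r x) (0 ^ ar r - Ncount r om)) | r <- enum 'I_m]
  | om : world ar 0 <- enum [pred om : world ar 0 | models om Phi]].
Definition total x := if n x == 0 then total0 x else total1 x.

Lemma FP_lw b l : FP (lw b l).
Proof. by case: l => [p|j]; [case: b; [exact: HW | exact: HWb] | exact: FP_const]. Qed.

Lemma FP_table : FP table.
Proof.
apply: FP_cons; first exact: FP_const.
apply: FP_cat; apply: FP_list => t.
  apply: (@FP_vprod _ _ _ (enum (pat1 Phi)) (fun l => lw (l \in t) l)) => l; exact: FP_lw.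
apply: (@FP_vprod _ _ _ (enum (pat2 ar)) (fun p => lw (p \in t) (inl p))) => p; exact: FP_lw.
Qed.

Lemma FP_rest_count r : FP (fun x => rest_count Phi r (n x)).
Proof.
have Ht : FP (fun x => tri (n x)).
  apply: (FP_foldr_add (F := fun _ => addn) (q := fun z => 2 * tz z)); try fpp.
  - exact: FP_iota.
  - by apply: FP_addn; fpp.
  - by pbt.
  - by move=> a e k; rewrite tz_pair /= !tz_nat; lia.
apply: FP_subn; first exact: FP_expn.
apply: FP_addn; first exact: FP_const.
by apply: FP_addn; apply: FP_muln => //; exact: FP_const.
Qed.

Lemma FP_total : FP total.
Proof.
apply: FP_if; first exact: FP_eq0.
  apply: FP_vsum => om; apply: FP_vprod => r.
  by apply: FP_vmul; apply: FP_vpow => //; exact: FP_const.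
apply: FP_vmul.
  apply: FP_vsum => g; apply: FP_vmul; last by apply: FP_mrun => //; exact: FP_table.
  by apply: (@FP_vprod _ _ _ (enum (pat0 ar)) (fun p => lw (p \in g) (inl p))) => p; exact: FP_lw.
by apply: FP_vprod => r; apply: FP_vpow; [exact: FP_vadd | exact: FP_rest_count].
Qed.

Section Values.
Variable x : X.
Notation w := (fun r => vval (W r x)).
Notation wbar := (fun r => vval (Wb r x)).

Lemma lwE b l : vval (lw b l x) = wl w wbar b l.
Proof. by case: l => [p|j] /=; [case: b | exact: vval1]. Qed.

Lemma vprod_map I (s : seq I) (f : I -> bint) :
  vval (vprod [seq f i | i <- s]) = (\prod_(i <- s) vval (f i))%R.
Proof. by rewrite vprodE big_map. Qed.
Lemma vsum_map I (s : seq I) (f : I -> bint) :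
  vval (vsum [seq f i | i <- s]) = (\sum_(i <- s) vval (f i))%R.
Proof. by rewrite vsumE big_map. Qed.

Lemma mono0E g : vval (mono0 g x) = wt0 Phi w wbar g.
Proof. by rewrite vprod_map big_enum; apply: eq_bigr => p _; rewrite lwE. Qed.
Lemma mono1E t : vval (mono1 t x) = wt1 w wbar t.
Proof. by rewrite vprod_map big_enum; apply: eq_bigr => p _; rewrite lwE. Qed.
Lemma mono2E t : vval (mono2 t x) = wt2 Phi w wbar t.
Proof. by rewrite vprod_map big_enum; apply: eq_bigr => p _; rewrite lwE. Qed.

Lemma totalP : sentence Phi -> vval (total x) = WFOMC (n x) Phi w wbar.
Proof.
move=> sPhi; rewrite /total; case: eqP => [n0|/eqP]; last rewrite -lt0n => n0.
  rewrite n0 /total0 vsum_map big_enum; apply: eq_bigr => om _.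
  rewrite vprod_map big_enum; apply: eq_bigr => r _.
  by rewrite vvalM !vpowE.
rewrite (wfomc_sum _ _ (Ordinal n0)) // vvalM vsum_map big_distrl /=.
apply: eq_bigr => g _; rewrite vvalM mono0E -mulrA; congr (_ * (_ * _))%R; last first.
  rewrite (restfactorE Phi (Ordinal n0)) vprod_map big_enum; apply: eq_bigr => r _.
  by rewrite vpowE vvalD.
pose v i := vval (nth vzero (table x) i).
rewrite (F1_mval (Ths Phi) (inP g) (ok g) (opK (ar := ar)) (sum_op (ar := ar)) (wt_op Phi w wbar)
  (@up_static _ _ Phi g) (@up_comm _ _ Phi g) (i1 := i1) (i2 := i2) (w := v)) ?enum_uniq //.
- rewrite size_enum_ord; apply: mrunP => // p q e; exact: up_tabK.
- move=> t; rewrite /v /= nth_cat size_map index_mem mem_enum /=.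
  by rewrite (nth_map set0) ?index_mem ?mem_enum // nth_index ?mem_enum // mono1E.
- move=> t; rewrite /v /= nth_cat size_map -cardE ltnNge leq_addr /= addKn.
  by rewrite (nth_map set0) ?index_mem ?mem_enum // nth_index ?mem_enum // mono2E.
Qed.
End Values.
End Total.

(** * Rational input and output *)

Import Order.TTheory GRing.Theory Num.Theory.

Lemma split_flatten sep (L : seq (seq sym)) : all (fun s => sep \notin s) L ->
  split sep (flatten [seq s ++ [:: sep] | s <- L]) = rcons L [::].
Proof.
elim: L => //= s L IH /andP[h /IH e].
by rewrite -catA split_cat // e.
Qed.

Lemma bin_bin k : all (fun c => (c == S0) || (c == S1)) (bin k).
Proof. by have [x -> _] := bin_bv k; rewrite all_map; apply/allP => -[]. Qed.

Lemma notin_bin c k : c != S0 -> c != S1 -> c \notin bin k.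
Proof. by move=> c0 c1; apply/negP => /(allP (bin_bin k)); rewrite (negbTE c0) (negbTE c1). Qed.

Lemma notin_rat c q : c \in [:: SSep; SBlank] -> c \notin enc_rat q.
Proof.
move=> h; have [c0 c1 cs cp cm] : [/\ c != S0, c != S1, c != SSlash, c != SPlus & c != SMinus].
  by case: c h.
rewrite /enc_rat /enc_int mem_cat !in_cons !negb_or !notin_bin // cs !andbT.
by case: ifP.
Qed.

Lemma filled_rat q : filled (enc_rat q).
Proof. by apply/allP => c; apply: contraL => /eqP->; exact: notin_rat. Qed.

Definition unbin (s : seq sym) := [seq bit_sym c | c <- s].
Lemma unbinP k : bv (unbin (bin k)) = k.
Proof. by have [x -> <-] := bin_bv k; rewrite /unbin mapK //; exact: sym_bitK. Qed.

Definition rat_mag (c : seq sym) := unbin (head [::] (split SSlash (behead c))).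
Definition rat_num (c : seq sym) : bint :=
  if head SBlank c == SMinus then ([::], rat_mag c) else (rat_mag c, [::]).
Definition rat_den (c : seq sym) := unbin (nth [::] (split SSlash (behead c)) 1).

Lemma rat_numP q : (vval (rat_num (enc_rat q)) = (numq q)%:~R)%R.
Proof.
rewrite /rat_num /rat_mag /enc_rat /enc_int /= split_cat ?notin_bin //= /vval.
case: (ltrP (numq q) 0) => h /=; rewrite unbinP ?subr0 ?sub0r pmulrn abszE.
  by rewrite ltr0_norm // rmorphN opprK.
by rewrite ger0_norm.
Qed.

Lemma rat_denP q : ((bv (rat_den (enc_rat q)))%:R = (denq q)%:~R :> rat)%R.
Proof.
rewrite /rat_den /enc_rat /enc_int /= split_cat ?notin_bin //= split_id ?notin_bin //= unbinP.
by case: (denq q) (denq_gt0 q).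
Qed.

(** The output format prescribes lowest terms, hence the gcd. *)
Definition reduce (z : bint) (d : seq bool) : seq sym :=
  let s := bsub z.1 z.2 in
  let mag := if s.1 then (bsub z.2 z.1).2 else s.2 in
  let g := bgcd mag d in
  (if s.1 then SMinus else SPlus) :: [seq sym_bit b | b <- bnorm (bdivmod mag g).1] ++
  SSlash :: [seq sym_bit b | b <- bnorm (bdivmod d g).1].

Lemma bdivE x d : 0 < bv d -> bv (bdivmod x d).1 = bv x %/ bv d.
Proof. by move=> d0; have [e lt] := bdivmodP x d0; rewrite [in RHS]e divnMDl // divn_small // addn0. Qed.

Lemma reduceP z d q : 0 < bv d -> vval z = ((bv d)%:R * q)%R -> reduce z d = enc_rat q.
Proof.
move=> d0 zq; rewrite /reduce; have [-> s2] := bsubP z.1 z.2.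
have [_ s2'] := bsubP z.2 z.1; set mag := if _ then (bsub _ _).2 else _.
set neg := _ < _.
have mE : vval z = ((-1) ^+ neg * (bv mag)%:R)%R.
  rewrite /vval /mag /neg; case: ltnP => h.
    by rewrite expr1 mulN1r s2' ?natrB ?opprB //; exact: ltnW.
  by rewrite expr0 mul1r s2 ?natrB.
have m0 : neg -> 0 < bv mag by rewrite /mag /neg => h; rewrite h s2' //; lia.
set g := bgcd mag d; have gE : bv g = gcdn (bv mag) (bv d) by exact: bgcdP.
have g0 : 0 < bv g by rewrite gE gcdn_gt0 d0 orbT.
rewrite !bin_bits !bdivE // gE; rewrite gE in g0; set G := gcdn _ _ in g0 *.
set a := bv mag in mE m0 G g0 *; set b := bv d in d0 zq G g0 *.
have aE : a = (a %/ G) * G by rewrite divnK // dvdn_gcdl.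
have bE : b = (b %/ G) * G by rewrite divnK // dvdn_gcdr.
set a' := a %/ G in aE *; set b' := b %/ G in bE *.
have b0 : 0 < b' by case: (b') bE => // e; rewrite e in d0.
have co : coprime a' b'.
  by rewrite /coprime -(eqn_pmul2r g0) muln_gcdl -aE -bE mul1n.
have qE : q = (((-1) ^+ neg * a'%:Z)%:~R / (b'%:Z)%:~R)%R.
  have G0 : (G%:R : rat) != 0%R by rewrite pnatr_eq0 -lt0n.
  have B0 : (b'%:R : rat) != 0%R by rewrite pnatr_eq0 -lt0n.
  have {}zq : ((-1) ^+ neg * (a'%:R * G%:R) = (b'%:R * G%:R) * q :> rat)%R.
    by rewrite -!natrM -aE -bE -mE.
  rewrite rmorphM rmorphXn rmorphN1 /= -!pmulrn; apply: (mulfI G0); apply: (mulfI B0).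
  by rewrite mulrA -zq; field.
have co' : coprime (absz ((-1) ^+ neg * a'%:Z)%R) (absz (b'%:Z)%R) by rewrite abszMsign.
rewrite /enc_rat qE coprimeq_num // coprimeq_den //.
rewrite (_ : (b'%:Z == 0)%R = false) /=; last by case: (b') b0.
rewrite gtr0_sg // mul1r.
rewrite /enc_int abszMsign /=; congr cons.
(* A negative sign comes with a nonzero magnitude, so zero is printed with [SPlus], as [enc_int]
   demands. *)
case: (neg) m0 => m0; last by rewrite expr0 mul1r.
rewrite expr1 mulN1r oppr_lt0 ltz_nat.
by case: (a') aE => // e; have := m0 isT; rewrite e.
Qed.

Section FPs.
Context (A : Type) {eA : Enc A}.
Lemma FP_unbin (s : A -> seq sym) : FP s -> FP (fun a => unbin (s a)).
Proof. by move=> H; apply: FP_map => //; apply: FP_comp (FP_sym bit_sym); fpp. Qed.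
Lemma FP_bits_out (s : A -> seq bool) : FP s -> FP (fun a => [seq sym_bit b | b <- bnorm (s a)]).
Proof.
by move=> H; apply: FP_map; [exact: FP_bnorm | apply: FP_comp (FP_bool1 sym_bit); fpp].
Qed.

Lemma FP_rat_parts (s : A -> seq sym) : FP s -> FP (fun a => split SSlash (behead (s a))).
Proof. by move=> H; apply: FP_split; exact: FP_behead. Qed.
Lemma FP_rat_num (s : A -> seq sym) : FP s -> FP (fun a => rat_num (s a)).
Proof.
move=> H; have Hm : FP (fun a => rat_mag (s a)).
  by apply: FP_unbin; apply: FP_head; [fpp | exact: FP_rat_parts].
apply: FP_if; [|fpp|fpp].
by apply: FP_comp (FP_sym (fun c => c == SMinus)); apply: FP_head; fpp.
Qed.
Lemma FP_rat_den (s : A -> seq sym) : FP s -> FP (fun a => rat_den (s a)).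
Proof. by move=> H; apply: FP_unbin; apply: FP_nth; [fpp | exact: FP_rat_parts | fpp]. Qed.

Lemma FP_reduce (z : A -> bint) (d : A -> seq bool) : FP z -> FP d -> FP (fun a => reduce (z a) (d a)).
Proof.
move=> Hz Hd.
have Hs : FP (fun a => bsub (z a).1 (z a).2) by apply: FP_bsub; fpp.
have Hs' : FP (fun a => bsub (z a).2 (z a).1) by apply: FP_bsub; fpp.
have Hm : FP (fun a => if (bsub (z a).1 (z a).2).1 then (bsub (z a).2 (z a).1).2 else (bsub (z a).1 (z a).2).2).
  by apply: FP_if; fpp.
have Hg := FP_bgcd Hm Hd.
apply: FP_cons; first by apply: FP_if; fpp.
apply: FP_cat; first by apply: FP_bits_out; apply: FP_fst; exact: FP_bdivmod.
apply: FP_cons; first fpp.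
by apply: FP_bits_out; apply: FP_fst; exact: FP_bdivmod.
Qed.
End FPs.

(** * The algorithm on input strings *)

Section Main.
Variables (m : nat) (ar : 'I_m -> nat) (Phi : c2form ar).
Implicit Types (s : seq sym) (r : 'I_m).

(** Field 0 is the unary domain size; the next [m] fields hold [w], and [m] more hold [wbar]. *)
Definition chunk i s := nth [::] (split SSep s) i.
Definition in_n s := size (chunk 0 s).
Definition in_w r s := chunk (1 + r) s.
Definition in_wbar r s := chunk (1 + m + r) s.
Definition nat_bint (d : seq bool) : bint := (d, [::]).
(** Both weights of [r] must be scaled by the same factor. The product of their denominators is
    taken, so each numerator is multiplied by the other denominator. *)
Definition int_w r s := vmul (rat_num (in_w r s)) (nat_bint (rat_den (in_wbar r s))).
Definition int_wbar r s := vmul (rat_num (in_wbar r s)) (nat_bint (rat_den (in_w r s))).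
Definition denom r s := bmul (rat_den (in_w r s)) (rat_den (in_wbar r s)).
Definition denoms s := bprod [seq bpow (denom r s) (in_n s ^ ar r) | r <- enum 'I_m].
Definition solve_wfomc s := reduce (total Phi in_n int_w int_wbar s) (denoms s).

Lemma FP_chunk i : FP (chunk i).
Proof. by apply: FP_nth; [fpp | apply: FP_split; fpp | fpp]. Qed.
Lemma FP_in_n : FP in_n.
Proof. by apply: FP_sizes; exact: FP_chunk. Qed.

Lemma FP_solve : FP solve_wfomc.
Proof.
have Hw r : FP (in_w r) by exact: FP_chunk.
have Hb r : FP (in_wbar r) by exact: FP_chunk.
apply: FP_reduce.
  apply: FP_total; first exact: FP_in_n.
  - move=> r; apply: FP_vmul; first exact: FP_rat_num.
    by apply: FP_pair; [exact: FP_rat_den | fpp].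
  - move=> r; apply: FP_vmul; first exact: FP_rat_num.
    by apply: FP_pair; [exact: FP_rat_den | fpp].
apply: (@FP_bprod _ _ _ (enum 'I_m) (fun r s => bpow (denom r s) (in_n s ^ ar r))) => r; apply: FP_bpow; last by apply: FP_expn; exact: FP_in_n.
by apply: FP_bmul; exact: FP_rat_den.
Qed.

Section Spec.
Variables (n : nat) (w wbar : 'I_m -> rat).
Notation inp := (enc_input n w wbar).

Lemma split_inp : split SSep inp =
  rcons (nseq n S1 :: [seq enc_rat (w r) | r <- enum 'I_m] ++ [seq enc_rat (wbar r) | r <- enum 'I_m]) [::].
Proof.
rewrite -(@split_flatten SSep); last first.
  rewrite /= all_cat !all_map; apply/and3P; split; first by elim: (n).
    by apply/allP => r _; exact: notin_rat.
  by apply/allP => r _; exact: notin_rat.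
by rewrite /enc_input /= map_cat flatten_cat -!map_comp -catA.
Qed.

Lemma in_nE : in_n inp = n.
Proof. by rewrite /in_n /chunk split_inp /= size_nseq. Qed.
Let sz T (f : 'I_m -> T) : size [seq f r | r <- enum 'I_m] = m.
Proof. by rewrite size_map size_enum_ord. Qed.
Lemma in_wE r : in_w r inp = enc_rat (w r).
Proof.
rewrite /in_w /chunk split_inp add1n /= nth_rcons nth_cat size_cat !sz.
by rewrite ltn_addr // ltn_ord (nth_map r) ?size_enum_ord // nth_ord_enum.
Qed.
Lemma in_wbarE r : in_wbar r inp = enc_rat (wbar r).
Proof.
rewrite /in_wbar /chunk split_inp -addnA add1n /= nth_rcons nth_cat size_cat !sz.
rewrite ltn_add2l ltn_ord ltnNge leq_addr /= addKn.
by rewrite (nth_map r) ?size_enum_ord // nth_ord_enum.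
Qed.

Lemma solveP : sentence Phi -> solve_wfomc inp = enc_rat (WFOMC n Phi w wbar).
Proof.
move=> sPhi; pose D r : rat := ((bv (denom r inp))%:R)%R.
have DE r : D r = ((denq (w r))%:~R * (denq (wbar r))%:~R)%R.
  by rewrite /D /denom bmulP natrM in_wE in_wbarE !rat_denP.
have dE : ((bv (denoms inp))%:R = \prod_r D r ^+ (n ^ ar r) :> rat)%R.
  rewrite bprodE big_map big_enum /= natr_prod; apply: eq_bigr => r _.
  by rewrite bpowE natrX in_nE.
have d0 q : ((denq q)%:~R : rat) != 0%R by rewrite intr_eq0 denq_eq0.
apply: reduceP.
  rewrite lt0n -(pnatr_eq0 rat) dE; apply/prodf_neq0 => r _.
  by rewrite expf_eq0 negb_and DE mulf_neq0 ?orbT.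
rewrite totalP // dE -WFOMC_scale in_nE; apply: eq_bigr => om _.
rewrite /weight; apply: eq_bigr => r _.
rewrite /int_w /int_wbar !vvalM in_wE in_wbarE !rat_numP /nat_bint /vval /= !subr0 !rat_denP DE.
congr (_ ^+ _ * _ ^+ _)%R.
  by rewrite -{2}[w r]divq_num_den; field; exact: d0.
by rewrite -{2}[wbar r]divq_num_den; field; exact: d0.
Qed.
End Spec.
End Main.

Theorem theorem4 (m : nat) (ar : 'I_m -> nat) (Phi : c2form ar) :
  sentence Phi ->
  exists (M : TM) (c : nat),
    forall (n : nat) (w wbar : 'I_m -> rat),
      exists t : nat,
        t <= c * (size (enc_input n w wbar)).+1 ^ c /\
        exists cfg : config M,
          exec t (init M (enc_input n w wbar)) = Some cfg /\
          outputs cfg (WFOMC n Phi w wbar).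
Proof.
move=> sPhi.
pose inp (x : nat * ('I_m -> rat) * ('I_m -> rat)) := enc_input x.1.1 x.1.2 x.2.
pose out x := enc_rat (WFOMC x.1.1 Phi x.1.2 x.2) : seq sym.
have [] := @FP_TM _ inp out.
(* The function on strings is retyped to triples, whose code is by definition that of the input
   string. *)
- apply: (FP_recast (i := inp)) (FP_solve Phi) => // -[[n w] wbar].
  by rewrite solveP.
- have H (f : 'I_m -> rat) : filled (flatten [seq enc_rat (f r) ++ [:: SSep] | r <- enum 'I_m]).
    elim: (enum _) => //= r l IH; rewrite /filled !all_cat -!/(filled _) IH /= andbT.
    by have := filled_rat (f r); rewrite /filled /= !all_cat /= andbT.
  by move=> [[n w] wbar]; rewrite /inp /filled all_cat /= all_cat -!/(filled _) !H andbT; elim: n.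
- by move=> x; exact: filled_rat.
move=> M [c H]; exists M, c => n w wbar; exact: (H (n, w, wbar)).
Qed.
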